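(* For every function $f\in\mathcal{S}$, with logarithmic coefficients $\gamma_1,\gamma_2$, one has $$-\frac{\sqrt2}{2}\le |\gamma_2|-|\gamma_1|\le \frac12 .$$ Both inequalities are sharp: there is a function in $\mathcal{S}$ for which equality holds in the left inequality, and there is a function in $\mathcal{S}$ for which equality holds in the right inequality.
   Context: Let $\mathbb{D}=\{z\in\mathbb{C}:|z|<1\}$ be the open unit disk. Let $\mathcal{A}$ be the class of functions $f$ analytic in $\mathbb{D}$ and normalized so that $f(z)=z+a_2z^2+a_3z^3+\cdots$ (that is, $f(0)=0$, $f'(0)=1$). Let $\mathcal{S}\subset\mathcal{A}$ be the subclass of univalent functions, i.e. those $f\in\mathcal{A}$ that are injective on $\mathbb{D}$. For $f\in\mathcal{S}$, the logarithmic coefficients $\gamma_n$, $n=1,2,\ldots$, are defined by $$\log\frac{f(z)}{z}=2\sum_{n=1}^\infty\gamma_n z^n,\qquad z\in\mathbb{D},$$ where $f(z)/z$ is taken to be $1$ at $z=0$ and the branch of the logarithm is the one vanishing at $z=0$. Equating coefficients gives $\gamma_1=\frac{a_2}{2}$ and $\gamma_2=\frac12\left(a_3-\frac{a_2^2}{2}\right)$. *)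

(* Defs.v *)
From Stdlib Require Import Reals.
From Coquelicot Require Import Coquelicot.

Open Scope R_scope.

Definition unit_disk (z : C) : Prop := Cmod z < 1.

Definition Cexp (z : C) : C := (exp (Re z) * cos (Im z), exp (Re z) * sin (Im z)).

(* Functions on the disk are total functions on C whose values outside the disk
   are irrelevant.  Since the domain is C as an AbsRing, [ex_derive] and
   [is_derive] below are complex differentiability, so this is analyticity. *)
Definition class_A (f : C -> C) : Prop :=
  (forall z : C, unit_disk z -> ex_derive f z) /\
  f (RtoC 0) = RtoC 0 /\
  is_derive f (RtoC 0) (RtoC 1).

Definition class_S (f : C -> C) : Prop :=
  class_A f /\
  (forall z w : C, unit_disk z -> unit_disk w -> f z = f w -> z = w).

(* [L] is the branch of log (f z / z) on the disk with L 0 = 0.  At z = 0 the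
   quotient is read as 1, and Cexp (L 0) = 1 follows from L 0 = 0. *)
Definition is_log_branch (f L : C -> C) : Prop :=
  (forall z : C, unit_disk z -> continuous L z) /\
  L (RtoC 0) = RtoC 0 /\
  (forall z : C, unit_disk z -> z <> RtoC 0 -> Cexp (L z) = Cdiv (f z) z).

(* log (f z / z) = 2 * sum_{n >= 1} gamma_n z^n on the disk; [gamma 0] plays no
   role. *)
Definition is_log_coeffs (f : C -> C) (gamma : nat -> C) : Prop :=
  exists L : C -> C,
    is_log_branch f L /\
    forall z : C, unit_disk z ->
      exists s : C,
        is_series (fun n : nat => Cmult (gamma (S n)) (Cpow z (S n))) s /\
        L z = Cmult (RtoC 2) s.

(* Main.v *)
Require Import Defs.
From Stdlib Require Import Reals Lra Lia Factorial.
From Coquelicot Require Import Coquelicot.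
Open Scope R_scope.

(** Write f(z) = z exp(L(z)), where L is twice the power series of the logarithmic
    coefficients, and 1/f(z) = 1/z + b_0 + b_1 z + .... The inequality is a consequence of
    two classical facts about univalent functions: |b_1| <= 1, which reads
    |gamma_1^2 - gamma_2| <= 1/2, and |gamma_1| <= 1, which is the first fact applied to the
    square root transform sqrt(f(z^2)) (schlicht_log_sqrt, schlicht_log_first). Given both,
    log_coeffs_bounds is elementary algebra in |gamma_1| and |gamma_2|.

    The bound |b_1| <= 1 (coefficient_bound) is usually read off from the area theorem. Here it
    comes from the positivity of the logarithmic energy. Put the charge cos(x - alpha), of
    total mass zero, at the points W(x) = 1/f(r e^(i x)). Then
    - log |W(x) - W(y)| has nonnegative double integral against the charge
    (energy_bound). Factor
      1/f(z) - 1/f(zeta) = (1/z - 1/zeta) q(z, zeta).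
    Since f is injective, q has no zero in the bidisc (qker_neq_0), so log |q| is harmonic in
    each variable and its moments are computed at the origin (cos_moment_ln), which brings in
    b_1. The moment of log |1/z - 1/zeta| is that of the circle itself. Comparing the two
    gives r^2 |b_1| <= 1, up to a regularisation of the logarithm on the diagonal whose effect
    is bounded by a Poisson kernel of vanishing mass (coefficient_estimate).

    The complex analysis needed for this is the mean value property on circles (mean_value),
    proved by differentiating the integral in the radius. It also gives the minimum modulus
    principle, from which the derivative of f has no zero (qker_neq_0_diag). Analyticity is
    available from the start, because the logarithmic coefficients give a convergent power
    series for L.

    Equality holds for z / ((1 - a z) (1 - b z)) with |a| = |b| = 1, whose logarithmic
    coefficients are (a^n + b^n) / (2 n): on the left for a, b = e^(+- i PI / 4), and on the
    right for a, b = 1, -1. *)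

(** * Complex derivatives in terms of estimates *)

Lemma locally_C_eps (z : C) (P : C -> Prop) :
  locally z P <-> exists d, 0 < d /\ forall w : C, Cmod (w - z) < d -> P w.
Proof.
split.
- intros H. apply (locally_norm_le_locally (V := C_NormedModule)) in H.
  destruct H as [d Hd]. exists d. split; [apply cond_pos|].
  intros w Hw. apply Hd. exact Hw.
- intros [d [Hd H]].
  apply (locally_le_locally_norm (V := C_NormedModule)).
  exists (mkposreal d Hd). intros w Hw. apply H. exact Hw.
Qed.

Lemma is_derive_C_eps (f : C -> C) (z l : C) :
  is_derive f z l <->
  forall eps, 0 < eps -> exists d, 0 < d /\ forall w : C, Cmod (w - z) < d ->
    Cmod (f w - f z - (w - z) * l) <= eps * Cmod (w - z).
Proof.
split.
- intros [_ H] eps Heps.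
  specialize (H z (fun P HP => HP) (mkposreal eps Heps)).
  destruct H as [d Hd]. exists d. split; [apply cond_pos|].
  intros w Hw. apply (Hd w Hw).
- intros H. split; [apply is_linear_scal_l|].
  intros x Hx eps.
  apply (@is_filter_lim_locally_unique C_AbsRing (AbsRing_NormedModule C_AbsRing)) in Hx.
  subst x.
  destruct (H eps (cond_pos eps)) as [d [Hd H']]. exists (mkposreal d Hd). exact H'.
Qed.

Lemma is_derive_R_eps (f : R -> R) (t l : R) :
  is_derive f t l <->
  forall eps, 0 < eps -> exists d, 0 < d /\ forall s, Rabs (s - t) < d ->
    Rabs (f s - f t - (s - t) * l) <= eps * Rabs (s - t).
Proof.
split.
- intros [_ H] eps Heps.
  specialize (H t (fun P HP => HP) (mkposreal eps Heps)).
  destruct H as [d Hd]. exists d. split; [apply cond_pos|].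
  intros w Hw. apply (Hd w Hw).
- intros H. split; [apply is_linear_scal_l|].
  intros x Hx eps.
  apply (@is_filter_lim_locally_unique R_AbsRing (AbsRing_NormedModule R_AbsRing)) in Hx.
  subst x.
  destruct (H eps (cond_pos eps)) as [d [Hd H']]. exists (mkposreal d Hd). exact H'.
Qed.

Lemma continuous_C_eps (f : C -> C) (z : C) :
  continuous f z <->
  forall eps, 0 < eps -> exists d, 0 < d /\ forall w : C, Cmod (w - z) < d ->
    Cmod (f w - f z) < eps.
Proof.
split.
- intros H eps Heps.
  apply (proj1 (locally_C_eps z (fun w => Cmod (f w - f z) < eps))).
  apply (H (fun v => Cmod (v - f z) < eps)).
  apply (proj2 (locally_C_eps (f z) _)). exists eps. split; auto.
- intros H P HP. apply (proj1 (locally_C_eps _ _)) in HP.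
  destruct HP as [e [He HP]]. destruct (H e He) as [d [Hd Hw]].
  apply (proj2 (locally_C_eps _ _)). exists d. split; auto.
Qed.

Lemma is_derive_continuous_C (f : C -> C) (z l : C) :
  is_derive f z l -> continuous f z.
Proof.
intros H. apply continuous_C_eps. intros eps Heps.
destruct (proj1 (is_derive_C_eps f z l) H 1 Rlt_0_1) as [d [Hd Hw]].
set (B := 2 + Cmod l).
assert (HB : 0 < B) by (unfold B; pose proof (Cmod_ge_0 l); lra).
exists (Rmin d (eps / B)). split.
{ apply Rmin_glb_lt; auto. apply Rdiv_lt_0_compat; auto. }
intros w Hm.
assert (H1 : Cmod (w - z) < d) by (eapply Rlt_le_trans; [apply Hm|apply Rmin_l]).
assert (H2 : Cmod (w - z) < eps / B)
  by (eapply Rlt_le_trans; [apply Hm|apply Rmin_r]).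
replace (f w - f z)%C with ((f w - f z - (w - z) * l) + (w - z) * l)%C by ring.
eapply Rle_lt_trans; [apply Cmod_triangle|]. rewrite Cmod_mult.
specialize (Hw w H1).
apply Rle_lt_trans with (Cmod (w - z) * (1 + Cmod l)); [lra|].
apply Rle_lt_trans with (Cmod (w - z) * B).
{ apply Rmult_le_compat_l; [apply Cmod_ge_0|unfold B; lra]. }
replace eps with (eps / B * B) by (field; lra).
apply Rmult_lt_compat_r; auto.
Qed.

(** The product and chain rules are stated for the module structure that an absolute ring
    carries over itself, which is not convertible to the normed module structure of C. *)
Lemma is_derive_C_AbsRing (f : C -> C) (z l : C) :
  @is_derive C_AbsRing (AbsRing_NormedModule C_AbsRing) f z l <-> is_derive f z l.
Proof.
split.
- intros [_ H]. apply is_derive_C_eps. intros eps Heps.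
  specialize (H z (fun P HP => HP) (mkposreal eps Heps)).
  destruct H as [d Hd]. exists d. split; [apply cond_pos|].
  intros w Hw. apply (Hd w Hw).
- intros H. split; [apply is_linear_scal_l|].
  intros x Hx eps.
  apply (@is_filter_lim_locally_unique C_AbsRing (AbsRing_NormedModule C_AbsRing)) in Hx.
  subst x.
  destruct (proj1 (is_derive_C_eps f z l) H eps (cond_pos eps)) as [d [Hd H']].
  exists (mkposreal d Hd). exact H'.
Qed.

Lemma is_derive_C_const (c z : C) : is_derive (fun _ : C => c) z (RtoC 0).
Proof. apply (is_derive_const (K := C_AbsRing) (V := C_NormedModule)). Qed.

Lemma is_derive_C_id (z : C) : is_derive (fun w : C => w) z (RtoC 1).
Proof. apply is_derive_C_AbsRing, (is_derive_id (K := C_AbsRing)). Qed.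

Lemma is_derive_C_plus (f g : C -> C) (z df dg : C) :
  is_derive f z df -> is_derive g z dg ->
  is_derive (fun w => f w + g w)%C z (df + dg)%C.
Proof. intros; apply (is_derive_plus (K := C_AbsRing) (V := C_NormedModule)); auto. Qed.

Lemma is_derive_C_mult (f g : C -> C) (z df dg : C) :
  is_derive f z df -> is_derive g z dg ->
  is_derive (fun w => f w * g w)%C z (df * g z + f z * dg)%C.
Proof.
intros Hf Hg. apply is_derive_C_AbsRing. apply (is_derive_mult (K := C_AbsRing)).
- apply is_derive_C_AbsRing, Hf.
- apply is_derive_C_AbsRing, Hg.
- intros; apply Cmult_comm.
Qed.

Lemma is_derive_C_comp (f g : C -> C) (z df dg : C) :
  is_derive f (g z) df -> is_derive g z dg ->
  is_derive (fun w => f (g w)) z (dg * df)%C.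
Proof.
intros Hf Hg. apply (is_derive_comp (K := C_AbsRing) (V := C_NormedModule)).
- exact Hf.
- apply is_derive_C_AbsRing, Hg.
Qed.

Lemma is_derive_C_eq (f : C -> C) (z l l' : C) :
  is_derive f z l -> l = l' -> is_derive f z l'.
Proof. intros; subst; auto. Qed.

Lemma is_derive_C_inv_id (z : C) : z <> 0%C ->
  is_derive (fun w : C => (/ w)%C) z (- (/ z * / z))%C.
Proof.
intros Hz. apply is_derive_C_eps. intros eps Heps.
assert (Hm : 0 < Cmod z) by (apply Cmod_gt_0; auto).
set (m := Cmod z) in *.
exists (Rmin (m / 2) (eps * (m * m * m) / 2)). split.
{ apply Rmin_glb_lt; [lra|].
  assert (0 < m * m * m) by (repeat apply Rmult_lt_0_compat; auto).
  assert (0 < eps * (m*m*m)) by (apply Rmult_lt_0_compat; auto). lra. }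
intros w Hw.
assert (H1 : Cmod (w - z) < m / 2) by (eapply Rlt_le_trans; [apply Hw|apply Rmin_l]).
assert (H2 : Cmod (w - z) < eps * (m * m * m) / 2)
  by (eapply Rlt_le_trans; [apply Hw|apply Rmin_r]).
assert (H3 : m / 2 < Cmod w).
{ assert (m <= Cmod w + Cmod (w - z)).
  { unfold m. replace z with (w + (- (w - z)))%C at 1 by ring.
    eapply Rle_trans; [apply Cmod_triangle|]. rewrite Cmod_opp. lra. }
  lra. }
assert (Hw0 : w <> 0%C) by (apply Cmod_gt_0; lra).
replace (/ w - / z - (w - z) * - (/ z * / z))%C
  with ((w - z) * (w - z) * (/ (w * z * z)))%C by (field; auto).
rewrite !Cmod_mult, Cmod_inv, !Cmod_mult; [|repeat apply Cmult_neq_0; auto].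
fold m.
rewrite Rmult_assoc, (Rmult_comm eps). apply Rmult_le_compat_l; [apply Cmod_ge_0|].
assert (Hp : 0 < Cmod w * m * m) by (repeat apply Rmult_lt_0_compat; lra).
apply Rmult_le_reg_r with (1 := Hp). rewrite Rmult_assoc, Rinv_l, Rmult_1_r by lra.
apply Rlt_le. eapply Rlt_le_trans; [apply H2|].
replace (eps * (m * m * m) / 2) with (eps * ((m / 2) * m * m)) by field.
apply Rmult_le_compat_l; [lra|]. apply Rmult_le_compat_r; [lra|].
apply Rmult_le_compat_r; lra.
Qed.

Lemma is_derive_C_inv (f : C -> C) (z df : C) : f z <> 0%C ->
  is_derive f z df -> is_derive (fun w => / f w)%C z (- (df * (/ f z * / f z)))%C.
Proof.
intros H0 H. eapply is_derive_C_eq.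
{ apply (is_derive_C_comp (fun w => / w)%C f); [apply is_derive_C_inv_id; auto|apply H]. }
ring.
Qed.

Lemma im_le_Cmod (c : C) : Rabs (Im c) <= Cmod c.
Proof. eapply Rle_trans; [apply Rmax_r|apply (Rmax_Cmod c)]. Qed.

Lemma Cmod_le_re_im (c : C) : Cmod c <= Rabs (Re c) + Rabs (Im c).
Proof.
assert (E : c = (RtoC (Re c) + Ci * RtoC (Im c))%C).
{ destruct c as [x y]; unfold RtoC, Ci, Cplus, Cmult, Re, Im; simpl. f_equal; ring. }
rewrite E at 1. eapply Rle_trans; [apply Cmod_triangle|].
rewrite Cmod_mult, Cmod_Ci, !Cmod_R. lra.
Qed.

(** Applied to rays and circles: this is how complex differentiability is turned into
    identities between derivatives of real functions. *)
Lemma is_derive_along (f : C -> C) (g : R -> C) (t : R) (df dg : C) :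
  is_derive f (g t) df ->
  is_derive (fun s => Re (g s)) t (Re dg) -> is_derive (fun s => Im (g s)) t (Im dg) ->
  is_derive (fun s => Re (f (g s))) t (Re (dg * df)%C) /\
  is_derive (fun s => Im (f (g s))) t (Im (dg * df)%C).
Proof.
intros Hf Hr Hi.
assert (key : forall eps, 0 < eps -> exists d, 0 < d /\ forall s, Rabs (s - t) < d ->
  Cmod (f (g s) - f (g t) - RtoC (s - t) * (dg * df)) <= eps * Rabs (s - t)).
{ intros eps Heps.
  set (B := Cmod dg + 1 + Cmod df).
  assert (HB : 1 <= B)
    by (unfold B; pose proof (Cmod_ge_0 dg); pose proof (Cmod_ge_0 df); lra).
  set (eta := Rmin 1 (eps / B)).
  assert (He1 : eta <= 1) by apply Rmin_l.
  assert (He2 : eta * B <= eps).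
  { replace eps with (eps / B * B) by (field; lra).
    apply Rmult_le_compat_r; [lra|apply Rmin_r]. }
  assert (He0 : 0 < eta) by (apply Rmin_glb_lt; [lra|apply Rdiv_lt_0_compat; lra]).
  destruct (proj1 (is_derive_C_eps f _ _) Hf eta He0) as [d1 [Hd1 H1]].
  destruct (proj1 (is_derive_R_eps _ _ _) Hr (eta / 2) ltac:(lra)) as [d2 [Hd2 H2]].
  destruct (proj1 (is_derive_R_eps _ _ _) Hi (eta / 2) ltac:(lra)) as [d3 [Hd3 H3]].
  exists (Rmin (Rmin d2 d3) (d1 / B)). split.
  { repeat apply Rmin_glb_lt; auto. apply Rdiv_lt_0_compat; lra. }
  intros s Hs.
  assert (Hs2 : Rabs (s - t) < d2).
  { eapply Rlt_le_trans; [apply Hs|]. eapply Rle_trans; [apply Rmin_l|apply Rmin_l]. }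
  assert (Hs3 : Rabs (s - t) < d3).
  { eapply Rlt_le_trans; [apply Hs|]. eapply Rle_trans; [apply Rmin_l|apply Rmin_r]. }
  assert (Hs1 : Rabs (s - t) < d1 / B).
  { eapply Rlt_le_trans; [apply Hs|apply Rmin_r]. }
  assert (Hg : Cmod (g s - g t - RtoC (s - t) * dg) <= eta * Rabs (s - t)).
  { eapply Rle_trans; [apply Cmod_le_re_im|].
    replace (Re (g s - g t - RtoC (s - t) * dg)) with
      (Re (g s) - Re (g t) - (s - t) * Re dg)
      by (unfold Cminus; rewrite !re_plus, !re_opp, re_scal_l; ring).
    replace (Im (g s - g t - RtoC (s - t) * dg)) with
      (Im (g s) - Im (g t) - (s - t) * Im dg)
      by (unfold Cminus, Cplus, Copp, Cmult, RtoC, Re, Im; simpl; ring).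
    specialize (H2 s Hs2). specialize (H3 s Hs3). lra. }
  assert (Hg2 : Cmod (g s - g t) <= (Cmod dg + 1) * Rabs (s - t)).
  { replace (g s - g t)%C with
      ((g s - g t - RtoC (s - t) * dg) + RtoC (s - t) * dg)%C by ring.
    eapply Rle_trans; [apply Cmod_triangle|]. rewrite Cmod_mult, Cmod_R.
    pose proof (Rabs_pos (s - t)). nra. }
  assert (Hg3 : Cmod (g s - g t) < d1).
  { eapply Rle_lt_trans; [apply Hg2|].
    apply Rle_lt_trans with (B * Rabs (s - t)).
    { apply Rmult_le_compat_r; [apply Rabs_pos|]. unfold B.
      pose proof (Cmod_ge_0 df); lra. }
    replace d1 with (B * (d1 / B)) by (field; lra).
    apply Rmult_lt_compat_l; lra. }
  specialize (H1 _ Hg3).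
  replace (f (g s) - f (g t) - RtoC (s - t) * (dg * df))%C with
    ((f (g s) - f (g t) - (g s - g t) * df) + (g s - g t - RtoC (s - t) * dg) * df)%C
    by ring.
  eapply Rle_trans; [apply Cmod_triangle|]. rewrite Cmod_mult.
  pose proof (Rabs_pos (s - t)). pose proof (Cmod_ge_0 df).
  apply Rle_trans with (eta * B * Rabs (s - t)).
  { unfold B.
    assert (eta * Cmod (g s - g t) <= eta * ((Cmod dg + 1) * Rabs (s - t)))
      by (apply Rmult_le_compat_l; lra).
    assert (Cmod (g s - g t - RtoC (s - t) * dg) * Cmod df
      <= eta * Rabs (s - t) * Cmod df) by (apply Rmult_le_compat_r; lra).
    lra. }
  apply Rmult_le_compat_r; auto. }
split; apply is_derive_R_eps; intros eps Heps;
  destruct (key eps Heps) as [d [Hd H]]; exists d; split; auto; intros s Hs;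
  (eapply Rle_trans; [|apply (H s Hs)]).
- eapply Rle_trans; [|apply re_le_Cmod]. right. f_equal.
  unfold Cminus. rewrite !re_plus, !re_opp, re_scal_l. reflexivity.
- eapply Rle_trans; [|apply im_le_Cmod]. right. f_equal.
  unfold Cminus, Cplus, Copp, Cmult, RtoC, Re, Im; simpl; ring.
Qed.

Lemma zero_derive_constant (f : C -> C) (z0 : C) (r : R) :
  (forall z, Cmod (z - z0) < r -> is_derive f z (RtoC 0)) ->
  forall z, Cmod (z - z0) < r -> f z = f z0.
Proof.
intros H z Hz.
set (g := fun t : R => (z0 + RtoC t * (z - z0))%C).
assert (Hg : forall t, 0 <= t <= 1 ->
  is_derive (fun s => Re (f (g s))) t 0 /\ is_derive (fun s => Im (f (g s))) t 0).
{ intros t Ht.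
  destruct (is_derive_along f g t (RtoC 0) (z - z0)%C) as [A B].
  - apply H. unfold g.
    replace (z0 + RtoC t * (z - z0) - z0)%C with (RtoC t * (z - z0))%C by ring.
    rewrite Cmod_mult, Cmod_R, Rabs_pos_eq by lra.
    apply Rle_lt_trans with (1 * Cmod (z - z0)); [|lra].
    apply Rmult_le_compat_r; [apply Cmod_ge_0|lra].
  - unfold g. apply is_derive_ext with (fun s => Re z0 + s * Re (z - z0)).
    + intros s. rewrite re_plus, re_scal_l. reflexivity.
    + generalize (Re z0) (Re (z - z0)%C); intros; auto_derive; auto; ring.
  - unfold g. apply is_derive_ext with (fun s => Im z0 + s * Im (z - z0)).
    + intros s. unfold Cplus, Cmult, RtoC, Im; simpl; ring.
    + generalize (Im z0) (Im (z - z0)%C); intros; auto_derive; auto; ring.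
  - split.
    + replace 0 with (Re ((z - z0) * RtoC 0)%C); auto.
      unfold Re, Cmult, RtoC; simpl; ring.
    + replace 0 with (Im ((z - z0) * RtoC 0)%C); auto.
      unfold Im, Cmult, RtoC; simpl; ring. }
assert (E0 : g 0 = z0) by (unfold g; apply injective_projections; simpl; ring).
assert (E1 : g 1 = z) by (unfold g; apply injective_projections; simpl; ring).
rewrite <- E1, <- E0.
assert (A : Re (f (g 0)) = Re (f (g 1)))
  by (apply (eq_is_derive (fun s => Re (f (g s)))); [intros; apply Hg; auto|lra]).
assert (B : Im (f (g 0)) = Im (f (g 1)))
  by (apply (eq_is_derive (fun s => Im (f (g s)))); [intros; apply Hg; auto|lra]).
apply injective_projections; symmetry; assumption.
Qed.

Lemma is_derive_C_unique (f : C -> C) (z l1 l2 : C) :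
  is_derive f z l1 -> is_derive f z l2 -> l1 = l2.
Proof.
intros H1 H2.
set (g := fun t : R => (z + RtoC t)%C).
assert (G0 : g 0 = z) by (unfold g; ring).
assert (A : is_derive (fun s => Re (g s)) 0 (Re (RtoC 1))).
{ apply is_derive_ext with (fun s => Re z + s).
  - intros s. unfold g. rewrite re_plus. reflexivity.
  - simpl. generalize (Re z). intros. auto_derive; auto; ring. }
assert (B : is_derive (fun s => Im (g s)) 0 (Im (RtoC 1))).
{ apply is_derive_ext with (fun s => Im z).
  - intros s. unfold g, Im, Cplus, RtoC; simpl. ring.
  - simpl. exact (is_derive_const (K := R_AbsRing) (V := R_NormedModule) (Im z) 0). }
rewrite <- G0 in H1, H2.
destruct (is_derive_along f g 0 l1 (RtoC 1) H1 A B) as [U1 V1].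
destruct (is_derive_along f g 0 l2 (RtoC 1) H2 A B) as [U2 V2].
replace (RtoC 1 * l1)%C with l1 in U1, V1 by ring.
replace (RtoC 1 * l2)%C with l2 in U2, V2 by ring.
apply injective_projections.
- change (Re l1 = Re l2). rewrite <- (is_derive_unique _ _ _ U1), <- (is_derive_unique _ _ _ U2).
  reflexivity.
- change (Im l1 = Im l2). rewrite <- (is_derive_unique _ _ _ V1), <- (is_derive_unique _ _ _ V2).
  reflexivity.
Qed.

(** Used with divided differences, where h is known in closed form. *)
Lemma is_derive_of_quotient (f h : C -> C) (z0 : C) (r : R) : 0 < r ->
  (forall z, Cmod (z - z0) < r -> ((z - z0) * h z = f z - f z0)%C) ->
  continuous h z0 -> is_derive f z0 (h z0).
Proof.
intros Hr H Hh. apply is_derive_C_eps. intros eps Heps.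
destruct (proj1 (continuous_C_eps h z0) Hh eps Heps) as [d [Hd Hd']].
exists (Rmin r d). split; [apply Rmin_glb_lt; auto|]. intros w Hw.
assert (H1 : Cmod (w - z0) < r) by (eapply Rlt_le_trans; [apply Hw|apply Rmin_l]).
assert (H2 : Cmod (w - z0) < d) by (eapply Rlt_le_trans; [apply Hw|apply Rmin_r]).
rewrite <- (H w H1).
replace ((w - z0) * h w - (w - z0) * h z0)%C with ((w - z0) * (h w - h z0))%C by ring.
rewrite Cmod_mult, Rmult_comm. apply Rmult_le_compat_r; [apply Cmod_ge_0|].
apply Rlt_le; auto.
Qed.

(** * Complex power series *)

(** Complex series are summed by components; csum_correct and csum_unique make the total
    function usable. *)
Definition csum (a : nat -> C) : C :=
  (Series (fun n => Re (a n)), Series (fun n => Im (a n))).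

Lemma sum_n_parts (a : nat -> C) (n : nat) :
  sum_n a n = (sum_n (fun k => Re (a k)) n, sum_n (fun k => Im (a k)) n).
Proof.
induction n as [|n IH].
- rewrite !sum_O. apply surjective_pairing.
- rewrite !sum_Sn, IH. reflexivity.
Qed.

Lemma is_series_parts (a : nat -> C) (s : C) :
  is_series (K := C_AbsRing) (V := C_NormedModule) a s <->
  is_series (fun n => Re (a n)) (Re s) /\ is_series (fun n => Im (a n)) (Im s).
Proof.
split.
- intros H. split; intros P [d HP];
  destruct (proj1 (filterlim_locally_ball_norm (K := C_AbsRing) (U := C_NormedModule)
              (F := eventually) (sum_n a) s) H d) as [N HN];
  exists N; intros n Hn; apply HP; specialize (HN n Hn);
  (eapply Rle_lt_trans; [|apply HN]);
  rewrite sum_n_parts.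
  + eapply Rle_trans; [|apply re_le_Cmod]. right. reflexivity.
  + eapply Rle_trans; [|apply im_le_Cmod]. right. reflexivity.
- intros [Hr Hi].
  apply (filterlim_locally_ball_norm (K := C_AbsRing) (U := C_NormedModule)).
  intros eps.
  assert (He : 0 < eps / 2) by (pose proof (cond_pos eps); lra).
  destruct (proj1 (filterlim_locally _ _) Hr (mkposreal _ He)) as [N1 H1].
  destruct (proj1 (filterlim_locally _ _) Hi (mkposreal _ He)) as [N2 H2].
  exists (max N1 N2). intros n Hn.
  specialize (H1 n ltac:(lia)). specialize (H2 n ltac:(lia)).
  rewrite sum_n_parts.
  eapply Rle_lt_trans; [apply Cmod_le_re_im|].
  change (Rabs (sum_n (fun k => Re (a k)) n - Re s) < eps / 2) in H1.
  change (Rabs (sum_n (fun k => Im (a k)) n - Im s) < eps / 2) in H2.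
  change (Rabs (sum_n (fun k => Re (a k)) n - Re s) +
    Rabs (sum_n (fun k => Im (a k)) n - Im s) < eps). lra.
Qed.

Lemma csum_unique (a : nat -> C) (s : C) :
  is_series (K := C_AbsRing) (V := C_NormedModule) a s -> csum a = s.
Proof.
intros H. apply is_series_parts in H. destruct H as [H1 H2].
apply injective_projections; apply is_series_unique; assumption.
Qed.

Lemma csum_correct (a : nat -> C) : ex_series (fun n => Cmod (a n)) ->
  is_series (K := C_AbsRing) (V := C_NormedModule) a (csum a).
Proof.
intros H. apply is_series_parts. split; apply Series_correct.
- apply (ex_series_le (K := R_AbsRing) (V := R_CompleteNormedModule)) with
    (fun n => Cmod (a n)); auto. intros n. apply re_le_Cmod.
- apply (ex_series_le (K := R_AbsRing) (V := R_CompleteNormedModule)) with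
    (fun n => Cmod (a n)); auto. intros n. apply im_le_Cmod.
Qed.

Lemma csum_ext (a b : nat -> C) : (forall n, a n = b n) -> csum a = csum b.
Proof.
intros H. unfold csum. f_equal; apply Series_ext; intros n; rewrite H; auto.
Qed.

Lemma Cmod_csum_le (a : nat -> C) (b : nat -> R) :
  (forall n, Cmod (a n) <= b n) -> ex_series b -> Cmod (csum a) <= Series b.
Proof.
intros H Hb.
assert (Ha : ex_series (fun n => Cmod (a n))).
{ apply (ex_series_le (K := R_AbsRing) (V := R_CompleteNormedModule)) with b; auto.
  intros n. change (Rabs (Cmod (a n)) <= b n). rewrite Rabs_pos_eq; auto.
  apply Cmod_ge_0. }
assert (Hs := csum_correct a Ha).
assert (Hn : forall n, Cmod (sum_n a n) <= sum_n b n).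
{ induction n as [|n IH].
  - rewrite !sum_O. apply H.
  - rewrite !sum_Sn. eapply Rle_trans; [apply Cmod_triangle|].
    apply Rplus_le_compat; auto. }
apply (is_lim_seq_le (fun n => Cmod (sum_n a n)) (sum_n b) (Cmod (csum a)) (Series b)); auto.
- apply (filterlim_comp _ _ _ (sum_n a) (norm (K := C_AbsRing) (V := C_NormedModule))
    eventually (locally (csum a))); [exact Hs|].
  apply (filterlim_norm (K := C_AbsRing) (V := C_NormedModule)).
- apply (Series_correct b Hb).
Qed.

Lemma csum_plus (a b : nat -> C) :
  ex_series (fun n => Cmod (a n)) -> ex_series (fun n => Cmod (b n)) ->
  csum (fun n => a n + b n)%C = (csum a + csum b)%C.
Proof.
intros Ha Hb. apply csum_unique.
apply (is_series_plus (K := C_AbsRing) (V := C_NormedModule)); apply csum_correct; auto.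
Qed.

Lemma csum_scal (c : C) (a : nat -> C) :
  ex_series (fun n => Cmod (a n)) ->
  csum (fun n => c * a n)%C = (c * csum a)%C.
Proof.
intros Ha. apply csum_unique.
apply (is_series_scal (K := C_AbsRing) (V := C_NormedModule)); apply csum_correct; auto.
Qed.

Lemma csum_incr (a : nat -> C) :
  ex_series (fun n => Cmod (a n)) ->
  csum a = (a O + csum (fun n => a (S n)))%C.
Proof.
intros Ha.
assert (E : csum (fun n => a (S n)) = (csum a - a O)%C).
{ apply csum_unique. apply (is_series_incr_1 (K := C_AbsRing) (V := C_NormedModule)).
  apply (eq_ind (csum a) (fun s => is_series a s) (csum_correct a Ha)).
  change (csum a = (csum a - a O) + a O)%C; ring. }
rewrite E. ring.
Qed.

Definition pser (a : nat -> C) (z : C) : C := csum (fun n => a n * z ^ n)%C.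

(** The radius of convergence is at least rad, in a form stable under differentiation and
    division. *)
Definition radius_ge (a : nat -> C) (rad : R) : Prop :=
  forall rho, 0 < rho < rad -> exists B, forall n, Cmod (a n) * rho ^ n <= B.

(** The n equal terms q^n are bounded by the geometric series; this absorbs the factor n
    of a differentiated series into a slightly larger radius. *)
Lemma INR_pow_le (q : R) (n : nat) : 0 <= q < 1 -> INR n * q ^ n <= / (1 - q).
Proof.
intros Hq.
assert (H1 : INR n * q ^ n <= sum_n (fun k => q ^ k) n).
{ induction n as [|n IH].
  - rewrite sum_O. simpl. lra.
  - rewrite sum_Sn, S_INR. change plus with Rplus.
    assert (0 <= q ^ n) by (apply pow_le; lra).
    assert (q ^ S n <= q ^ n) by (simpl; nra).
    assert (0 <= INR n) by apply pos_INR.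
    nra. }
eapply Rle_trans; [apply H1|].
apply (is_lim_seq_incr_compare (sum_n (fun k => q ^ k))).
- apply (is_series_geom q). rewrite Rabs_pos_eq; lra.
- intros m. rewrite sum_Sn. change plus with Rplus.
  assert (0 <= q ^ S m) by (apply pow_le; lra). lra.
Qed.

Lemma ex_series_le_R (a b : nat -> R) :
  (forall n, 0 <= a n <= b n) -> ex_series b -> ex_series a.
Proof.
intros H. apply (ex_series_le (K := R_AbsRing) (V := R_CompleteNormedModule)).
intros n. change (Rabs (a n) <= b n). rewrite Rabs_pos_eq; apply H.
Qed.

Lemma radius_ge_abs (a : nat -> C) (rad r : R) : radius_ge a rad -> 0 <= r < rad ->
  ex_series (fun n => Cmod (a n) * r ^ n).
Proof.
intros H Hr.
set (rho := (r + rad) / 2).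
destruct (H rho ltac:(unfold rho; lra)) as [B HB].
apply ex_series_le_R with (fun n => B * (r / rho) ^ n).
- intros n. split.
  + apply Rmult_le_pos; [apply Cmod_ge_0|apply pow_le; lra].
  + unfold Rdiv. rewrite Rpow_mult_distr, pow_inv.
    assert (0 < rho ^ n) by (apply pow_lt; unfold rho; lra).
    assert (0 <= r ^ n) by (apply pow_le; lra).
    replace (Cmod (a n) * r ^ n) with (Cmod (a n) * rho ^ n * (r ^ n * / rho ^ n))
      by (field; lra).
    apply Rmult_le_compat_r; [|apply HB].
    apply Rmult_le_pos; [lra|]. apply Rlt_le, Rinv_0_lt_compat; lra.
- apply (ex_series_scal (K := R_AbsRing) (V := R_NormedModule)). exists (/ (1 - r / rho)).
  apply is_series_geom.
  assert (0 < rho) by (unfold rho; lra).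
  rewrite Rabs_pos_eq.
  + apply Rmult_lt_reg_r with rho; [lra|]. unfold Rdiv. rewrite Rmult_assoc, Rinv_l; unfold rho; lra.
  + apply Rdiv_le_0_compat; lra.
Qed.

Lemma radius_ge_abs_term (a : nat -> C) (rad : R) (z : C) :
  radius_ge a rad -> Cmod z < rad -> ex_series (fun n => Cmod (a n * z ^ n)%C).
Proof.
intros H Hz. apply ex_series_ext with (fun n => Cmod (a n) * (Cmod z) ^ n).
- intros n. rewrite Cmod_mult, Cmod_pow. reflexivity.
- apply radius_ge_abs with rad; auto. split; auto. apply Cmod_ge_0.
Qed.

Lemma radius_ge_mul_INR (a : nat -> C) (rad : R) :
  radius_ge a rad -> radius_ge (fun n => RtoC (INR n) * a n)%C rad.
Proof.
intros H r Hr.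
set (rho := (r + rad) / 2).
destruct (H rho ltac:(unfold rho; lra)) as [B HB].
assert (Hp : 0 < rho) by (unfold rho; lra).
assert (Hq : 0 <= r / rho < 1).
{ split; [apply Rdiv_le_0_compat; lra|].
  apply Rmult_lt_reg_r with rho; [lra|]. unfold Rdiv. rewrite Rmult_assoc, Rinv_l; unfold rho; lra. }
exists (B * / (1 - r / rho)). intros n.
rewrite Cmod_mult, Cmod_R, Rabs_pos_eq by apply pos_INR.
assert (0 < rho ^ n) by (apply pow_lt; lra).
replace (INR n * Cmod (a n) * r ^ n) with
  ((Cmod (a n) * rho ^ n) * (INR n * (r / rho) ^ n))
  by (unfold Rdiv; rewrite Rpow_mult_distr, pow_inv; field; lra).
apply Rmult_le_compat; auto.
- apply Rmult_le_pos; [apply Cmod_ge_0|lra].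
- apply Rmult_le_pos; [apply pos_INR|apply pow_le; lra].
- apply INR_pow_le; auto.
Qed.

Lemma radius_ge_shift (a : nat -> C) (rad : R) :
  radius_ge a rad -> radius_ge (fun n => a (S n)) rad.
Proof.
intros H r Hr. destruct (H r Hr) as [B HB]. exists (B / r). intros n.
specialize (HB (S n)). simpl in HB.
apply Rmult_le_reg_r with r; [lra|]. unfold Rdiv. rewrite (Rmult_assoc B), Rinv_l by lra. lra.
Qed.

Definition dcoef (a : nat -> C) (n : nat) : C := (RtoC (INR (S n)) * a (S n))%C.

Lemma radius_ge_dcoef (a : nat -> C) (rad : R) : radius_ge a rad -> radius_ge (dcoef a) rad.
Proof.
intros H. apply (radius_ge_shift (fun n => RtoC (INR n) * a n)%C).
apply radius_ge_mul_INR; auto.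
Qed.

(** The second-order Taylor remainder of w^n. Writing rho^n / rho^2 instead of rho^(n-2)
    avoids truncated exponents and makes the bound summable against the coefficients. *)
Lemma pow_taylor2 (w z : C) (rho : R) (n : nat) :
  0 < rho -> Cmod w <= rho -> Cmod z <= rho ->
  Cmod (w ^ S n - z ^ S n - (w - z) * (RtoC (INR (S n)) * z ^ n))%C
    <= INR (S n) * INR (S n) * rho ^ S n / (rho * rho) * (Cmod (w - z)%C * Cmod (w - z)%C).
Proof.
intros Hr Hw Hz. induction n as [|n IH].
- replace (w ^ 1 - z ^ 1 - (w - z) * (RtoC (INR 1) * z ^ 0))%C with (RtoC 0)
    by (simpl; ring).
  rewrite Cmod_0. simpl. apply Rmult_le_pos.
  + apply Rlt_le. apply Rdiv_lt_0_compat; nra.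
  + apply Rmult_le_pos; apply Cmod_ge_0.
- set (m := S n) in *.
  replace (w ^ S m - z ^ S m - (w - z) * (RtoC (INR (S m)) * z ^ m))%C with
    (w * (w ^ m - z ^ m - (w - z) * (RtoC (INR m) * z ^ n)) +
     RtoC (INR m) * z ^ n * ((w - z) * (w - z)))%C.
  2: { rewrite (S_INR m), RtoC_plus. unfold m. simpl Cpow. ring. }
  eapply Rle_trans; [apply Cmod_triangle|].
  rewrite Cmod_mult, (Cmod_mult (_ * _)), (Cmod_mult (RtoC _)), Cmod_pow, Cmod_R,
    Rabs_pos_eq, (Cmod_mult (w - z)) by apply pos_INR.
  set (D := Cmod (w - z) * Cmod (w - z)) in *.
  assert (HD : 0 <= D) by (apply Rmult_le_pos; apply Cmod_ge_0).
  assert (P : Cmod z ^ n <= rho ^ n) by (apply pow_incr; split; [apply Cmod_ge_0|auto]).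
  assert (Q : 0 < rho ^ n) by (apply pow_lt; auto).
  assert (Im1 : 1 <= INR m) by (unfold m; rewrite S_INR; pose proof (pos_INR n); lra).
  assert (E : rho ^ S m / (rho * rho) = rho ^ n).
  { unfold m; simpl; field; lra. }
  assert (E' : rho * (rho ^ m / (rho * rho)) = rho ^ n).
  { unfold m; simpl; field; lra. }
  apply Rle_trans with (rho * (INR m * INR m * rho ^ m / (rho * rho) * D) + INR m * rho ^ n * D).
  { apply Rplus_le_compat.
    - apply Rmult_le_compat; auto; apply Cmod_ge_0.
    - apply Rmult_le_compat_r; auto. apply Rmult_le_compat_l; lra. }
  replace (rho * (INR m * INR m * rho ^ m / (rho * rho) * D)) with
    (INR m * INR m * (rho * (rho ^ m / (rho * rho))) * D) by (unfold Rdiv; ring).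
  rewrite E'.
  replace (INR (S m) * INR (S m) * rho ^ S m / (rho * rho) * D) with
    (INR (S m) * INR (S m) * (rho ^ S m / (rho * rho)) * D) by (unfold Rdiv; ring).
  rewrite E, S_INR.
  assert (0 <= rho ^ n * D) by (apply Rmult_le_pos; lra).
  nra.
Qed.

(** Termwise Taylor expansion: the quadratic remainders sum to a constant times |w - z|^2
    on a disc of radius rho between |z| and rad. *)
Lemma is_derive_pser (a : nat -> C) (rad : R) (z : C) :
  radius_ge a rad -> Cmod z < rad -> is_derive (pser a) z (pser (dcoef a) z).
Proof.
intros Ha Hz. apply is_derive_C_eps. intros eps Heps.
set (rho := (Cmod z + rad) / 2).
assert (Hz0 := Cmod_ge_0 z).
assert (Hrho : 0 < rho < rad) by (unfold rho; lra).
set (b := fun n => Cmod (RtoC (INR n) * (RtoC (INR n) * a n))%C * rho ^ n).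
assert (Hb : ex_series b).
{ apply radius_ge_abs with rad; [|lra]. do 2 apply radius_ge_mul_INR; auto. }
set (S2 := Series b / (rho * rho) + 1).
assert (Hb0 : 0 <= Series b).
{ eapply Rle_trans; [apply (Cmod_ge_0 (csum (fun _ => RtoC 0)))|].
  apply Cmod_csum_le; auto.
  intros n. rewrite Cmod_0. apply Rmult_le_pos; [apply Cmod_ge_0|apply pow_le; lra]. }
assert (HS2 : 0 < S2).
{ unfold S2. assert (0 <= Series b / (rho * rho)) by (apply Rdiv_le_0_compat; nra). lra. }
exists (Rmin (rho - Cmod z) (eps / S2)). split.
{ apply Rmin_glb_lt; [unfold rho; lra|]. apply Rdiv_lt_0_compat; auto. }
intros w Hw.
assert (H1 : Cmod (w - z) < rho - Cmod z) by (eapply Rlt_le_trans; [apply Hw|apply Rmin_l]).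
assert (H2 : Cmod (w - z) < eps / S2) by (eapply Rlt_le_trans; [apply Hw|apply Rmin_r]).
assert (Hwr : Cmod w <= rho).
{ replace w with ((w - z) + z)%C by ring.
  eapply Rle_trans; [apply Cmod_triangle|]. lra. }
assert (Hzr : Cmod z <= rho) by (unfold rho; lra).
set (t := fun n => (a (S n) * (w ^ S n - z ^ S n - (w - z) * (RtoC (INR (S n)) * z ^ n)))%C).
assert (E : (pser a w - pser a z - (w - z) * pser (dcoef a) z)%C = csum t).
{ assert (A1 := radius_ge_abs_term a rad w Ha ltac:(lra)).
  assert (A2 := radius_ge_abs_term a rad z Ha ltac:(lra)).
  assert (A3 := radius_ge_abs_term (dcoef a) rad z (radius_ge_dcoef a rad Ha) ltac:(lra)).
  unfold pser. rewrite (csum_incr (fun n => a n * w ^ n)%C) by auto.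
  rewrite (csum_incr (fun n => a n * z ^ n)%C) by auto.
  rewrite (ex_series_incr_1 (fun n => Cmod (a n * w ^ n)%C)) in A1.
  rewrite (ex_series_incr_1 (fun n => Cmod (a n * z ^ n)%C)) in A2.
  symmetry. unfold t.
  rewrite (csum_ext _ (fun n => (a (S n) * w ^ S n + (-(1) * (a (S n) * z ^ S n)))
     + (- (w - z)) * (dcoef a n * z ^ n))%C)
    by (intros n; unfold dcoef; ring).
  assert (B2 : ex_series (fun n => Cmod (- (1) * (a (S n) * z ^ S n))%C)).
  { eapply ex_series_ext; [|apply A2]. intros n. cbv beta. rewrite (Cmod_mult (- (1))), Cmod_m1.
    symmetry; apply Rmult_1_l. }
  assert (B3 : ex_series (fun n => Cmod (- (w - z) * (dcoef a n * z ^ n))%C)).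
  { eapply ex_series_ext; [|apply (ex_series_scal_l (Cmod (- (w - z))) _ A3)].
    intros n. cbv beta. rewrite (Cmod_mult (- (w - z))). reflexivity. }
  rewrite csum_plus, csum_plus, !csum_scal; auto.
  - simpl. ring.
  - eapply ex_series_le_R; [|apply (ex_series_plus _ _ A1 B2)].
    intros n. split; [apply Cmod_ge_0|apply Cmod_triangle]. }
rewrite E.
assert (HT : Cmod (csum t) <= Series (fun n => b (S n) * (/ (rho * rho) * (Cmod (w - z) * Cmod (w - z))))).
{ apply Cmod_csum_le.
  - intros n. unfold t. rewrite Cmod_mult.
    eapply Rle_trans.
    { apply Rmult_le_compat_l; [apply Cmod_ge_0|]. apply pow_taylor2 with (rho := rho); auto; lra. }
    unfold b. rewrite !Cmod_mult, Cmod_R, Rabs_pos_eq by apply pos_INR.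
    right. field. lra.
  - apply ex_series_scal_r. apply (ex_series_incr_1 b); auto. }
eapply Rle_trans; [apply HT|]. rewrite Series_scal_r.
assert (Hb1 : Series (fun n => b (S n)) = Series b).
{ rewrite (Series_incr_1 b) by auto. unfold b at 2. simpl. rewrite !Cmod_mult, Cmod_0. ring. }
rewrite Hb1.
assert (Hc := Cmod_ge_0 (w - z)).
replace (Series b * (/ (rho * rho) * (Cmod (w - z) * Cmod (w - z)))) with
  (Series b / (rho * rho) * Cmod (w - z) * Cmod (w - z)) by (unfold Rdiv; ring).
apply Rmult_le_compat_r; auto.
apply Rle_trans with (S2 * Cmod (w - z)).
{ apply Rmult_le_compat_r; auto. unfold S2; lra. }
apply Rlt_le. replace eps with (S2 * (eps / S2)) by (field; lra).
apply Rmult_lt_compat_l; auto.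
Qed.

(** * Iterated complex differentiability and the exponential *)

(** n-fold complex differentiability at the points of D, with unnamed derivatives. Finitely
    many orders suffice, so this replaces the theory of analytic functions: it is stable under
    algebra and composition by plain induction on n. *)
Fixpoint holo (n : nat) (D : C -> Prop) (f : C -> C) : Prop :=
  match n with
  | O => True
  | S m => exists f' : C -> C, (forall z, D z -> is_derive f z (f' z)) /\ holo m D f'
  end.

Definition Cdisc (r : R) (z : C) : Prop := Cmod z < r.

Lemma holo_S (n : nat) (D : C -> Prop) (f : C -> C) : holo (S n) D f -> holo n D f.
Proof.
revert f. induction n as [|n IH]; [simpl; auto|].
intros f [f' [H1 H2]]. exists f'. split; auto.
Qed.

Lemma holo_const (n : nat) (D : C -> Prop) (c : C) : holo n D (fun _ => c).
Proof.
revert c. induction n as [|n IH]; [simpl; auto|].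
intros c. exists (fun _ => RtoC 0). split; auto. intros; apply is_derive_C_const.
Qed.

Lemma holo_id (n : nat) (D : C -> Prop) : holo n D (fun z => z).
Proof.
destruct n; [simpl; auto|].
exists (fun _ => RtoC 1). split; [|apply holo_const]. intros; apply is_derive_C_id.
Qed.

Lemma holo_plus (n : nat) (D : C -> Prop) (f g : C -> C) :
  holo n D f -> holo n D g -> holo n D (fun z => f z + g z)%C.
Proof.
revert f g. induction n as [|n IH]; [simpl; auto|].
intros f g [f' [Hf Hf']] [g' [Hg Hg']].
exists (fun z => f' z + g' z)%C. split; [|apply IH; auto].
intros; apply is_derive_C_plus; auto.
Qed.

Lemma holo_mult (n : nat) (D : C -> Prop) (f g : C -> C) :
  holo n D f -> holo n D g -> holo n D (fun z => f z * g z)%C.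
Proof.
revert f g. induction n as [|n IH]; [simpl; auto|].
intros f g Hf Hg.
assert (Hf1 := holo_S _ _ _ Hf). assert (Hg1 := holo_S _ _ _ Hg).
destruct Hf as [f' [Hf Hf']]. destruct Hg as [g' [Hg Hg']].
exists (fun z => f' z * g z + f z * g' z)%C. split.
- intros; apply is_derive_C_mult; auto.
- apply holo_plus; apply IH; auto.
Qed.

Lemma Cneg (z : C) : (RtoC (-1) * z = - z)%C.
Proof. replace (RtoC (-1)) with (- RtoC 1)%C by (rewrite <- RtoC_opp; reflexivity). ring. Qed.

Lemma holo_opp (n : nat) (D : C -> Prop) (f : C -> C) : holo n D f -> holo n D (fun z => - f z)%C.
Proof.
intros Hf. destruct n; [simpl; auto|]. destruct Hf as [f' [H1 H2]].
exists (fun z => RtoC (-1) * f' z)%C. split.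
- intros z Hz. rewrite Cneg. apply (is_derive_opp (K := C_AbsRing) (V := C_NormedModule)); auto.
- apply holo_mult; auto. apply holo_const.
Qed.

Lemma holo_comp (n : nat) (D D' : C -> Prop) (F g : C -> C) :
  (forall z, D z -> D' (g z)) ->
  holo n D' F -> holo n D g -> holo n D (fun z => F (g z)).
Proof.
intros HD. revert F. induction n as [|n IH]; [simpl; auto|].
intros F HF Hg.
assert (Hg1 := holo_S _ _ _ Hg).
destruct HF as [F' [HF HF']]. destruct Hg as [g' [Hg Hg']].
exists (fun z => g' z * F' (g z))%C. split.
- intros; apply is_derive_C_comp; auto.
- apply holo_mult; auto.
Qed.

Lemma holo_inv (n : nat) (D : C -> Prop) (f : C -> C) :
  (forall z, D z -> f z <> RtoC 0) -> holo n D f -> holo n D (fun z => / f z)%C.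
Proof.
intros H0. induction n as [|n IH]; [simpl; auto|].
intros Hf.
assert (Hi := IH (holo_S _ _ _ Hf)).
destruct Hf as [f' [Hf Hf']].
exists (fun z => RtoC (-1) * (f' z * (/ f z * / f z)))%C. split.
- intros z Hz. eapply is_derive_C_eq; [apply is_derive_C_inv; auto|].
  replace (RtoC (-1)) with (- RtoC 1)%C by (rewrite <- RtoC_opp; reflexivity). ring.
- apply holo_mult; [apply holo_const|]. repeat apply holo_mult; auto.
Qed.

Lemma holo_sub (n : nat) (D D' : C -> Prop) (f : C -> C) :
  (forall z, D' z -> D z) -> holo n D f -> holo n D' f.
Proof.
intros H. revert f. induction n as [|n IH]; [simpl; auto|].
intros f [f' [Hf Hf']]. exists f'; auto.
Qed.

Lemma holo_pser (n : nat) (a : nat -> C) (rad : R) :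
  radius_ge a rad -> holo n (Cdisc rad) (pser a).
Proof.
revert a. induction n as [|n IH]; [simpl; auto|].
intros a Ha. exists (pser (dcoef a)). split.
- intros z Hz. apply is_derive_pser with rad; auto.
- apply IH, radius_ge_dcoef; auto.
Qed.

Lemma pser_0 (a : nat -> C) : pser a (RtoC 0) = a O.
Proof.
unfold pser. apply csum_unique.
apply (is_series_decr_1 (K := C_AbsRing) (V := C_NormedModule)).
refine (eq_ind (RtoC 0) (fun s => is_series (K := C_AbsRing) (V := C_NormedModule) _ s) _ _ _).
2: { change (RtoC 0 = a O - a O * RtoC 0 ^ 0)%C. simpl. ring. }
change (RtoC 0) with (@zero C_NormedModule) at 2.
apply filterlim_ext with (fun _ => @zero C_NormedModule).
- intros n. symmetry. induction n as [|n IH].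
  + rewrite sum_O. change (a 1%nat * RtoC 0 ^ 1 = RtoC 0)%C. simpl. ring.
  + rewrite sum_Sn, IH.
    change (RtoC 0 + a (S (S n)) * RtoC 0 ^ (S (S n)) = RtoC 0)%C. simpl. ring.
- apply filterlim_const.
Qed.

Definition expcoef (n : nat) : C := RtoC (/ INR (fact n)).

Lemma radius_ge_expcoef (rad : R) : radius_ge expcoef rad.
Proof.
intros r Hr.
assert (H : ex_series (fun n => / INR (fact n) * r ^ n)).
{ exists (exp r). assert (H := is_exp_Reals r).
  apply (is_series_ext (fun n => scal (pow_n r n) (/ INR (fact n)))); [|exact H].
  intros n. rewrite pow_n_pow. change (r ^ n * / INR (fact n) = / INR (fact n) * r ^ n). ring. }
assert (Hp : forall n, 0 <= / INR (fact n) * r ^ n).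
{ intros n. apply Rmult_le_pos; [apply Rlt_le, Rinv_0_lt_compat, INR_fact_lt_0|].
  apply pow_le; lra. }
exists (Series (fun n => / INR (fact n) * r ^ n)). intros n.
unfold expcoef. rewrite Cmod_R, Rabs_pos_eq by (apply Rlt_le, Rinv_0_lt_compat, INR_fact_lt_0).
assert (Hn : / INR (fact n) * r ^ n <= sum_n (fun n => / INR (fact n) * r ^ n) n).
{ destruct n; [rewrite sum_O; lra|]. rewrite sum_Sn. change plus with Rplus.
  assert (0 <= sum_n (fun n => / INR (fact n) * r ^ n) n).
  { clear -Hp. induction n; [rewrite sum_O; auto|]. rewrite sum_Sn. change plus with Rplus.
    specialize (Hp (S n)). lra. }
  lra. }
eapply Rle_trans; [apply Hn|].
apply (is_lim_seq_incr_compare (sum_n (fun k => / INR (fact k) * r ^ k))).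
- apply (Series_correct _ H).
- intros m. rewrite sum_Sn. change plus with Rplus. specialize (Hp (S m)). lra.
Qed.

Lemma dcoef_expcoef (n : nat) : dcoef expcoef n = expcoef n.
Proof.
unfold dcoef, expcoef. rewrite <- RtoC_mult. f_equal.
rewrite fact_simpl, mult_INR. field. split; [apply INR_fact_neq_0|apply not_0_INR; lia].
Qed.

Lemma is_derive_pser_exp (z : C) : is_derive (pser expcoef) z (pser expcoef z).
Proof.
eapply is_derive_C_eq.
- apply is_derive_pser with (Cmod z + 1); [apply radius_ge_expcoef|lra].
- apply csum_ext. intros n. rewrite dcoef_expcoef. reflexivity.
Qed.

Lemma Cexp_plus (z w : C) : Cexp (z + w) = (Cexp z * Cexp w)%C.
Proof.
destruct z as [x y], w as [u v]. unfold Cexp, Cplus, Cmult, Re, Im. simpl.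
rewrite exp_plus, cos_plus, sin_plus. apply injective_projections; simpl; ring.
Qed.

Lemma Cexp_0 : Cexp (RtoC 0) = RtoC 1.
Proof.
unfold Cexp, RtoC, Re, Im. simpl. rewrite exp_0, cos_0, sin_0.
apply injective_projections; simpl; ring.
Qed.

Lemma Cexp_opp (z : C) : (Cexp z * Cexp (- z) = RtoC 1)%C.
Proof. rewrite <- Cexp_plus. replace (z + - z)%C with (RtoC 0) by ring. apply Cexp_0. Qed.

Lemma Cexp_neq_0 (z : C) : Cexp z <> RtoC 0.
Proof.
intros H. assert (E := Cexp_opp z). rewrite H in E.
replace (RtoC 0 * Cexp (- z))%C with (RtoC 0) in E by ring.
apply RtoC_inj in E. lra.
Qed.

(** Both sides solve F' = F with F(0) = 1 along the segment from 0 to z. *)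
Lemma Cexp_pser (z : C) : Cexp z = pser expcoef z.
Proof.
set (g := fun t : R => (RtoC t * z)%C).
(* t -> S(t z) exp(- t z), S the exponential series, has zero derivative. *)
set (P := fun t : R => (pser expcoef (g t) * Cexp (- g t))%C).
assert (HP : forall t, is_derive (fun s => Re (P s)) t 0 /\ is_derive (fun s => Im (P s)) t 0).
{ intros t.
  destruct (is_derive_along (pser expcoef) g t (pser expcoef (g t)) z) as [A B].
  - apply is_derive_pser_exp.
  - unfold g. apply is_derive_ext with (fun s => s * Re z).
    + intros s. rewrite re_scal_l; reflexivity.
    + generalize (Re z); intros; auto_derive; auto; ring.
  - unfold g. apply is_derive_ext with (fun s => s * Im z).
    + intros s. unfold Cmult, RtoC, Im; simpl; ring.
    + generalize (Im z); intros; auto_derive; auto; ring.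
  - set (U := fun s => Re (pser expcoef (g s))) in *.
    set (V := fun s => Im (pser expcoef (g s))) in *.
    destruct z as [x y].
    assert (EU : U t = Re (pser expcoef (g t))) by reflexivity.
    assert (EV : V t = Im (pser expcoef (g t))) by reflexivity.
    assert (EE : forall s, Cexp (- g s) =
       (exp (- (s * x)) * cos (- (s * y)), exp (- (s * x)) * sin (- (s * y)))).
    { intros s. unfold Cexp, g, Copp, Cmult, RtoC, Re, Im; simpl.
      replace (- (s * x - 0 * y)) with (- (s * x)) by ring.
      replace (- (s * y + 0 * x)) with (- (s * y)) by ring. reflexivity. }
    assert (A' : is_derive U t (x * U t - y * V t)).
    { rewrite EU, EV. apply A. }
    assert (B' : is_derive V t (x * V t + y * U t)).
    { rewrite EU, EV. apply B. }
    split.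
    + apply is_derive_ext with (fun s => U s * (exp (- (s * x)) * cos (- (s * y)))
         - V s * (exp (- (s * x)) * sin (- (s * y)))).
      { intros s. unfold P. rewrite EE. reflexivity. }
      auto_derive.
      { repeat split; eexists; eauto. }
      change (Derive (fun r : R => U r) t) with (Derive U t). change (Derive (fun r : R => V r) t) with (Derive V t).
      rewrite (is_derive_unique _ _ _ A'), (is_derive_unique _ _ _ B'). ring.
    + apply is_derive_ext with (fun s => U s * (exp (- (s * x)) * sin (- (s * y)))
         + V s * (exp (- (s * x)) * cos (- (s * y)))).
      { intros s. unfold P. rewrite EE. reflexivity. }
      auto_derive.
      { repeat split; eexists; eauto. }
      change (Derive (fun r : R => U r) t) with (Derive U t). change (Derive (fun r : R => V r) t) with (Derive V t).
      rewrite (is_derive_unique _ _ _ A'), (is_derive_unique _ _ _ B'). ring. }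
assert (E : P 0 = P 1).
{ apply injective_projections.
  - apply (eq_is_derive (fun s => Re (P s))); [intros; apply HP|lra].
  - apply (eq_is_derive (fun s => Im (P s))); [intros; apply HP|lra]. }
assert (E1 : P 1 = RtoC 1).
{ rewrite <- E. unfold P, g.
  replace (RtoC 0 * z)%C with (RtoC 0) by ring.
  replace (- RtoC 0)%C with (RtoC 0) by (apply injective_projections; simpl; ring).
  rewrite Cexp_0, pser_0. unfold expcoef; simpl. rewrite Rinv_1. ring. }
assert (E2 := Cexp_opp z).
unfold P, g in E1. replace (RtoC 1 * z)%C with z in E1 by ring.
replace (Cexp z) with (Cexp z * (pser expcoef z * Cexp (- z)))%C by (rewrite E1; ring).
replace (Cexp z * (pser expcoef z * Cexp (- z)))%C with
  (pser expcoef z * (Cexp z * Cexp (- z)))%C by ring.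
rewrite E2. ring.
Qed.

Lemma is_derive_Cexp (z : C) : is_derive Cexp z (Cexp z).
Proof.
rewrite (Cexp_pser z).
apply (is_derive_ext (K := C_AbsRing) (V := C_NormedModule) (pser expcoef)).
- intros t. symmetry; apply Cexp_pser.
- apply is_derive_pser_exp.
Qed.

Lemma holo_Cexp (n : nat) (D : C -> Prop) : holo n D Cexp.
Proof.
induction n as [|n IH]; [simpl; auto|]. exists Cexp. split; auto.
intros; apply is_derive_Cexp.
Qed.

(** * Divided differences of power series *)

(** Synthetic division: these are the coefficients in z of the divided difference
    (pser a z - pser a z0) / (z - z0), a formula that stays meaningful at z = z0. *)
Definition dqcoef (a : nat -> C) (z0 : C) (i : nat) : C :=
  pser (fun j => a (S (i + j))) z0.

Definition dq (a : nat -> C) (z0 z : C) : C := pser (dqcoef a z0) z.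

Lemma radius_ge_shift_n (a : nat -> C) (rad : R) (i : nat) :
  radius_ge a rad -> radius_ge (fun j => a (S (i + j))) rad.
Proof.
revert a. induction i as [|i IH]; intros a Ha.
- apply (radius_ge_shift a rad Ha).
- apply (IH (fun n => a (S n))). apply radius_ge_shift; auto.
Qed.

Lemma dqcoef_rec (a : nat -> C) (rad : R) (z0 : C) (i : nat) :
  radius_ge a rad -> Cmod z0 < rad ->
  dqcoef a z0 i = (a (S i) + z0 * dqcoef a z0 (S i))%C.
Proof.
intros Ha H0. unfold dqcoef, pser.
assert (A1 := radius_ge_abs_term _ rad z0 (radius_ge_shift_n a rad i Ha) H0).
assert (A2 := radius_ge_abs_term _ rad z0 (radius_ge_shift_n a rad (S i) Ha) H0).
rewrite (csum_incr _ A1).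
rewrite <- csum_scal by exact A2.
f_equal.
- rewrite Nat.add_0_r. simpl. ring.
- apply csum_ext. intros n. rewrite Nat.add_succ_r. simpl. ring.
Qed.

(** The bound is uniform for |z0| <= rho, which makes the Lipschitz constant below
    independent of the base point. *)
Lemma dqcoef_bound (a : nat -> C) (rho rho1 B : R) (z0 : C) (i : nat) :
  0 < rho < rho1 -> (forall n, Cmod (a n) * rho1 ^ n <= B) -> Cmod z0 <= rho ->
  Cmod (dqcoef a z0 i) * rho1 ^ i <= B / (rho1 - rho).
Proof.
intros Hr HB H0.
assert (Hp : forall n, 0 < rho1 ^ n) by (intros; apply pow_lt; lra).
assert (Hq : 0 <= rho / rho1 < 1).
{ split; [apply Rdiv_le_0_compat; lra|].
  apply Rmult_lt_reg_r with rho1; [lra|]. unfold Rdiv. rewrite Rmult_assoc, Rinv_l; lra. }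
assert (Hs : is_series (fun j => B / rho1 ^ S i * (rho / rho1) ^ j)
   (B / rho1 ^ S i * / (1 - rho / rho1))).
{ apply (is_series_scal (K := R_AbsRing) (V := R_NormedModule)).
  apply is_series_geom. rewrite Rabs_pos_eq; lra. }
assert (HE : Cmod (dqcoef a z0 i) <= B / rho1 ^ S i * / (1 - rho / rho1)).
{ rewrite <- (is_series_unique _ _ Hs). apply Cmod_csum_le.
  - intros j. rewrite Cmod_mult, Cmod_pow.
    assert (H1 : Cmod (a (S (i + j))) <= B / rho1 ^ (S i + j)).
    { apply Rmult_le_reg_r with (rho1 ^ (S i + j)); auto.
      unfold Rdiv. rewrite Rmult_assoc, Rinv_l, Rmult_1_r by (apply Rgt_not_eq, Hp).
      apply HB. }
    assert (H2 : Cmod z0 ^ j <= rho ^ j).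
    { apply pow_incr. split; [apply Cmod_ge_0|auto]. }
    eapply Rle_trans.
    { apply Rmult_le_compat; [apply Cmod_ge_0|apply pow_le, Cmod_ge_0|apply H1|apply H2]. }
    right. unfold Rdiv. rewrite Rpow_mult_distr, pow_inv, pow_add. field.
    split; apply Rgt_not_eq, Hp.
  - eexists; apply Hs. }
apply Rle_trans with (B / rho1 ^ S i * / (1 - rho / rho1) * rho1 ^ i).
{ apply Rmult_le_compat_r; auto. apply Rlt_le; auto. }
right. simpl. field. repeat split; try lra. apply Rgt_not_eq, Hp.
Qed.

Lemma radius_ge_dqcoef (a : nat -> C) (rad : R) (z0 : C) :
  radius_ge a rad -> Cmod z0 < rad -> radius_ge (dqcoef a z0) rad.
Proof.
intros Ha H0 r Hr.
set (rho := Rmax r (Cmod z0)).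
assert (H1 : r <= rho) by apply Rmax_l.
assert (H2 : Cmod z0 <= rho) by apply Rmax_r.
assert (H3 : rho < rad) by (apply Rmax_lub_lt; lra).
set (rho1 := (rho + rad) / 2).
destruct (Ha rho1 ltac:(unfold rho1; lra)) as [B HB].
exists (B / (rho1 - rho)). intros i.
eapply Rle_trans; [|apply (dqcoef_bound a rho rho1 B z0 i); auto; unfold rho1; lra].
apply Rmult_le_compat_l; [apply Cmod_ge_0|]. apply pow_incr. unfold rho1; lra.
Qed.

Lemma dq_spec (a : nat -> C) (rad : R) (z0 z : C) :
  radius_ge a rad -> Cmod z0 < rad -> Cmod z < rad ->
  ((z - z0) * dq a z0 z = pser a z - pser a z0)%C.
Proof.
intros Ha H0 Hz.
assert (He := radius_ge_dqcoef a rad z0 Ha H0).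
assert (A := radius_ge_abs_term _ rad z He Hz).
assert (A1 := radius_ge_abs_term _ rad z Ha Hz).
assert (A2 := radius_ge_abs_term _ rad z0 Ha H0).
assert (B1 : (pser a z = a O + csum (fun n => a (S n) * z ^ S n))%C).
{ unfold pser. rewrite (csum_incr _ A1). simpl. ring. }
assert (B2 : (pser a z0 = a O + z0 * dqcoef a z0 O)%C).
{ unfold pser. rewrite (csum_incr _ A2). unfold dqcoef, pser.
  rewrite <- csum_scal by
    (apply (radius_ge_abs_term _ rad z0 (radius_ge_shift_n a rad O Ha) H0)).
  f_equal; [simpl; ring|]. apply csum_ext. intros n. simpl. ring. }
assert (B3 : (dq a z0 z = dqcoef a z0 O + csum (fun n => dqcoef a z0 (S n) * z ^ S n))%C).
{ unfold dq, pser. rewrite (csum_incr _ A). simpl. ring. }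
assert (A' : ex_series (fun n => Cmod (dqcoef a z0 (S n) * z ^ S n)%C)).
{ apply (ex_series_incr_1 (fun n => Cmod (dqcoef a z0 n * z ^ n)%C)). exact A. }
assert (A1' : ex_series (fun n => Cmod (a (S n) * z ^ S n)%C)).
{ apply (ex_series_incr_1 (fun n => Cmod (a n * z ^ n)%C)). exact A1. }
assert (B4 : (z * dq a z0 z = csum (fun n => a (S n) * z ^ S n) +
               z0 * csum (fun n => dqcoef a z0 (S n) * z ^ S n))%C).
{ unfold dq, pser. rewrite <- !csum_scal by auto. rewrite <- csum_plus; auto.
  - apply csum_ext. intros n. rewrite (dqcoef_rec a rad z0 n) by auto. simpl. ring.
  - eapply ex_series_ext; [|apply (ex_series_scal_l (Cmod z0) _ A')].
    intros n. cbv beta. rewrite (Cmod_mult z0). reflexivity. }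
rewrite B1, B2.
replace ((z - z0) * dq a z0 z)%C with (z * dq a z0 z - z0 * dq a z0 z)%C by ring.
rewrite B4, B3. ring.
Qed.

Lemma Cminus_neq_0 (z w : C) : z <> w -> (z - w)%C <> RtoC 0.
Proof.
intros N H. apply N. replace z with ((z - w) + w)%C by ring. rewrite H. ring.
Qed.

(** Off the diagonal the quotient is visibly symmetric; regularity in z thus transfers to
    regularity in z0. *)
Lemma dq_sym (a : nat -> C) (rad : R) (z0 z : C) :
  radius_ge a rad -> Cmod z0 < rad -> Cmod z < rad -> dq a z0 z = dq a z z0.
Proof.
intros Ha H0 Hz. destruct (Ceq_dec z z0) as [E|E]; [subst; auto|].
assert (H1 := dq_spec a rad z0 z Ha H0 Hz).
assert (H2 := dq_spec a rad z z0 Ha Hz H0).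
assert (N : (z - z0)%C <> RtoC 0) by (apply Cminus_neq_0; auto).
replace (dq a z0 z) with (/ (z - z0) * ((z - z0) * dq a z0 z))%C by (field; auto).
rewrite H1.
replace (pser a z - pser a z0)%C with (- (pser a z0 - pser a z))%C by ring.
rewrite <- H2. field; auto.
Qed.

Lemma pow_lipschitz (w z : C) (rho : R) (n : nat) :
  0 < rho -> Cmod w <= rho -> Cmod z <= rho ->
  Cmod (w ^ n - z ^ n)%C <= INR n * rho ^ n / rho * Cmod (w - z).
Proof.
intros Hr Hw Hz. induction n as [|n IH].
- simpl. replace (RtoC 1 - RtoC 1)%C with (RtoC 0) by ring.
  rewrite Cmod_0. right. unfold Rdiv; ring.
- replace (w ^ S n - z ^ S n)%C with (w * (w ^ n - z ^ n) + z ^ n * (w - z))%C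
    by (simpl; ring).
  eapply Rle_trans; [apply Cmod_triangle|].
  rewrite !Cmod_mult, Cmod_pow.
  assert (P : Cmod z ^ n <= rho ^ n) by (apply pow_incr; split; [apply Cmod_ge_0|auto]).
  assert (HD := Cmod_ge_0 (w - z)).
  apply Rle_trans with (rho * (INR n * rho ^ n / rho * Cmod (w - z)) + rho ^ n * Cmod (w - z)).
  + apply Rplus_le_compat; [apply Rmult_le_compat; auto; apply Cmod_ge_0|].
    apply Rmult_le_compat_r; auto.
  + right. rewrite S_INR. simpl. field; lra.
Qed.

(** The constant does not depend on the base point, so that symmetry upgrades this to
    joint continuity. *)
Lemma dq_lipschitz (a : nat -> C) (rad rho : R) : radius_ge a rad -> 0 < rho < rad ->
  exists K, 0 <= K /\ forall z0 z w, Cmod z0 <= rho -> Cmod z <= rho -> Cmod w <= rho ->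
    Cmod (dq a z0 w - dq a z0 z) <= K * Cmod (w - z).
Proof.
intros Ha Hr.
set (rho1 := (rho + rad) / 2).
assert (Hr1 : 0 < rho < rho1) by (unfold rho1; lra).
destruct (Ha rho1 ltac:(unfold rho1; lra)) as [B HB].
set (B' := B / (rho1 - rho)).
assert (HB' : 0 <= B').
{ apply Rdiv_le_0_compat; [|lra]. eapply Rle_trans; [|apply (HB O)].
  simpl. rewrite Rmult_1_r. apply Cmod_ge_0. }
assert (Hp : forall n, 0 < rho1 ^ n) by (intros; apply pow_lt; lra).
set (c := fun n => RtoC (/ rho1 ^ n)).
assert (Hc : radius_ge c rho1).
{ intros r Hrr. exists 1. intros n. unfold c.
  rewrite Cmod_R, Rabs_pos_eq by (apply Rlt_le, Rinv_0_lt_compat; auto).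
  apply Rmult_le_reg_l with (rho1 ^ n); auto.
  rewrite <- Rmult_assoc, Rinv_r by (apply Rgt_not_eq, Hp).
  rewrite Rmult_1_l, Rmult_1_r. apply pow_incr; lra. }
set (t := fun n => Cmod (RtoC (INR n) * c n)%C * rho ^ n).
assert (Ht : ex_series t).
{ apply radius_ge_abs with rho1; [apply radius_ge_mul_INR; auto|lra]. }
assert (Ht' : ex_series (fun n => B' / rho * t n)).
{ exact (ex_series_scal_l (B' / rho) t Ht). }
exists (Series (fun n => B' / rho * t n)).
assert (Htp : forall n, 0 <= t n).
{ intros n. apply Rmult_le_pos; [apply Cmod_ge_0|apply pow_le; lra]. }
split.
{ eapply Rle_trans; [apply (Cmod_ge_0 (csum (fun _ => RtoC 0)))|].
  apply Cmod_csum_le; auto. intros n. rewrite Cmod_0.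
  apply Rmult_le_pos; auto. apply Rdiv_le_0_compat; lra. }
intros z0 z w H0 Hz Hw.
assert (He := radius_ge_dqcoef a rad z0 Ha ltac:(lra)).
assert (A1 := radius_ge_abs_term _ rad w He ltac:(lra)).
assert (A2 := radius_ge_abs_term _ rad z He ltac:(lra)).
assert (A3 : ex_series (fun n => Cmod (- (1) * (dqcoef a z0 n * z ^ n))%C)).
{ eapply ex_series_ext; [|apply A2]. intros n. cbv beta. rewrite (Cmod_mult (- (1))), Cmod_m1.
  symmetry; apply Rmult_1_l. }
replace (dq a z0 w - dq a z0 z)%C with (csum (fun n => dqcoef a z0 n * (w ^ n - z ^ n))%C).
2: { rewrite (csum_ext _ (fun n => dqcoef a z0 n * w ^ n + - (1) * (dqcoef a z0 n * z ^ n))%C)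
       by (intros; ring).
     rewrite csum_plus, csum_scal by auto. unfold dq, pser. ring. }
rewrite <- Series_scal_r.
apply Cmod_csum_le; [|apply ex_series_scal_r; auto].
intros n. rewrite Cmod_mult.
assert (H1 := dqcoef_bound a rho rho1 B z0 n Hr1 HB H0). fold B' in H1.
assert (H2 : Cmod (dqcoef a z0 n) <= B' * / rho1 ^ n).
{ apply Rmult_le_reg_r with (rho1 ^ n); auto.
  rewrite Rmult_assoc, Rinv_l, Rmult_1_r; auto. apply Rgt_not_eq, Hp. }
eapply Rle_trans.
{ apply Rmult_le_compat; [apply Cmod_ge_0|apply Cmod_ge_0|apply H2|].
  apply pow_lipschitz with (rho := rho); auto; lra. }
right. unfold t, c. rewrite Cmod_mult, !Cmod_R, !Rabs_pos_eq.
- field. split; solve [lra|apply Rgt_not_eq, Hp].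
- apply Rlt_le, Rinv_0_lt_compat; auto.
- apply pos_INR.
Qed.

Lemma dq_continuous (a : nat -> C) (rad : R) (z0 z : C) :
  radius_ge a rad -> Cmod z0 < rad -> Cmod z < rad ->
  forall eps, 0 < eps -> exists d, 0 < d /\ forall w0 w,
    Cmod (w0 - z0) < d -> Cmod (w - z) < d -> Cmod (dq a w0 w - dq a z0 z) < eps.
Proof.
intros Ha H0 Hz eps Heps.
set (m := Rmax (Cmod z0) (Cmod z)).
assert (Hm1 : Cmod z0 <= m) by apply Rmax_l.
assert (Hm2 : Cmod z <= m) by apply Rmax_r.
assert (Hm3 : m < rad) by (apply Rmax_lub_lt; auto).
set (rho := (m + rad) / 2).
assert (Hm0 : 0 <= m) by (eapply Rle_trans; [apply Cmod_ge_0|apply Hm1]).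
destruct (dq_lipschitz a rad rho Ha ltac:(unfold rho; lra)) as [K [HK H]].
exists (Rmin (rho - m) (eps / (2 * K + 1))). split.
{ apply Rmin_glb_lt; [unfold rho; lra|apply Rdiv_lt_0_compat; lra]. }
intros w0 w H1 H2.
assert (H1a : Cmod (w0 - z0) < rho - m) by (eapply Rlt_le_trans; [apply H1|apply Rmin_l]).
assert (H2a : Cmod (w - z) < rho - m) by (eapply Rlt_le_trans; [apply H2|apply Rmin_l]).
assert (H1b : Cmod (w0 - z0) < eps / (2 * K + 1)) by (eapply Rlt_le_trans; [apply H1|apply Rmin_r]).
assert (H2b : Cmod (w - z) < eps / (2 * K + 1)) by (eapply Rlt_le_trans; [apply H2|apply Rmin_r]).
assert (B0 : Cmod w0 <= rho).
{ replace w0 with ((w0 - z0) + z0)%C by ring. eapply Rle_trans; [apply Cmod_triangle|]. lra. }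
assert (B1 : Cmod w <= rho).
{ replace w with ((w - z) + z)%C by ring. eapply Rle_trans; [apply Cmod_triangle|]. lra. }
assert (Hrho : m <= rho < rad) by (unfold rho; lra).
replace (dq a w0 w - dq a z0 z)%C with
  ((dq a w0 w - dq a w0 z) + (dq a z w0 - dq a z z0))%C.
2: { rewrite (dq_sym a rad z w0), (dq_sym a rad z z0) by (auto; lra). ring. }
eapply Rle_lt_trans; [apply Cmod_triangle|].
apply Rle_lt_trans with (K * Cmod (w - z) + K * Cmod (w0 - z0)).
{ apply Rplus_le_compat; apply H; lra. }
apply Rle_lt_trans with (2 * K * (eps / (2 * K + 1))).
{ assert (K * Cmod (w - z) <= K * (eps / (2 * K + 1))) by (apply Rmult_le_compat_l; lra).
  assert (K * Cmod (w0 - z0) <= K * (eps / (2 * K + 1))) by (apply Rmult_le_compat_l; lra).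
  lra. }
apply Rmult_lt_reg_r with (2 * K + 1); [lra|].
replace (2 * K * (eps / (2 * K + 1)) * (2 * K + 1)) with (2 * K * eps) by (field; lra).
nra.
Qed.

(** The entire function (e^w - 1) / w. It expresses the divided difference of exp(- L) through
    that of L. *)
Definition Cexp1 (w : C) : C := dq expcoef (RtoC 0) w.

Lemma Cexp1_spec (w : C) : (w * Cexp1 w = Cexp w - RtoC 1)%C.
Proof.
set (r := Cmod w + 1). assert (Hw := Cmod_ge_0 w).
assert (H := dq_spec expcoef r (RtoC 0) w (radius_ge_expcoef r)).
rewrite Cmod_0 in H. specialize (H ltac:(unfold r; lra) ltac:(unfold r; lra)).
rewrite <- !Cexp_pser, Cexp_0 in H. rewrite <- H. unfold Cexp1. ring.
Qed.

Lemma Cexp1_coef (n : nat) : dqcoef expcoef (RtoC 0) n = expcoef (S n).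
Proof. unfold dqcoef. rewrite pser_0, Nat.add_0_r. reflexivity. Qed.

Lemma radius_ge_Cexp1 (rad : R) : radius_ge (dqcoef expcoef (RtoC 0)) rad.
Proof.
intros r Hr. destruct (radius_ge_shift expcoef rad (radius_ge_expcoef rad) r Hr) as [B HB].
exists B. intros n. rewrite Cexp1_coef. apply HB.
Qed.

Lemma is_derive_Cexp1 (w : C) :
  is_derive Cexp1 w (pser (dcoef (dqcoef expcoef (RtoC 0))) w).
Proof.
apply (is_derive_pser _ (Cmod w + 1)); [apply radius_ge_Cexp1|lra].
Qed.

Lemma holo_Cexp1 (n : nat) (D : C -> Prop) : holo n D Cexp1.
Proof.
assert (G : forall n a, (forall rad, radius_ge a rad) -> holo n D (pser a)).
{ clear n. induction n as [|n IH]; [simpl; auto|]. intros a Ha.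
  exists (pser (dcoef a)). split.
  - intros z _. apply (is_derive_pser a (Cmod z + 1)); [apply Ha|lra].
  - apply IH. intros rad. apply radius_ge_dcoef, Ha. }
apply G. apply radius_ge_Cexp1.
Qed.

Lemma Cexp1_0 : Cexp1 (RtoC 0) = RtoC 1.
Proof.
unfold Cexp1, dq. rewrite pser_0, Cexp1_coef. unfold expcoef. simpl. f_equal. field.
Qed.

Lemma Cexp1_deriv_0 : pser (dcoef (dqcoef expcoef (RtoC 0))) (RtoC 0) = RtoC (1 / 2).
Proof.
rewrite pser_0. unfold dcoef. rewrite Cexp1_coef. unfold expcoef.
rewrite <- RtoC_mult. apply f_equal. simpl. field.
Qed.

(** * The mean value property on circles *)

Definition cis (x : R) : C := (cos x, sin x).

(** Joint continuity of a complex function of two real variables, with the Euclidean modulus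
    so that it composes with complex continuity. *)
Definition cont2 (F : R -> R -> C) (x y : R) : Prop :=
  forall eps, 0 < eps -> exists d, 0 < d /\ forall u v,
    Rabs (u - x) < d -> Rabs (v - y) < d -> Cmod (F u v - F x y) < eps.

Lemma cont2_parts (F : R -> R -> C) (x y : R) :
  cont2 F x y <-> continuity_2d_pt (fun u v => Re (F u v)) x y /\
                  continuity_2d_pt (fun u v => Im (F u v)) x y.
Proof.
split.
- intros H. split; intros eps; destruct (H eps (cond_pos eps)) as [d [Hd H']];
  exists (mkposreal d Hd); intros u v Hu Hv; specialize (H' u v Hu Hv);
  (eapply Rle_lt_trans; [|apply H']).
  + eapply Rle_trans; [|apply re_le_Cmod]. right. reflexivity.
  + eapply Rle_trans; [|apply im_le_Cmod]. right. reflexivity.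
- intros [H1 H2] eps Heps.
  assert (He : 0 < eps / 2) by lra.
  destruct (H1 (mkposreal _ He)) as [d1 G1]. destruct (H2 (mkposreal _ He)) as [d2 G2].
  simpl in G1, G2.
  exists (Rmin d1 d2). split; [apply Rmin_glb_lt; apply cond_pos|].
  intros u v Hu Hv.
  assert (A := Rmin_l d1 d2). assert (B := Rmin_r d1 d2).
  specialize (G1 u v ltac:(lra) ltac:(lra)). specialize (G2 u v ltac:(lra) ltac:(lra)).
  eapply Rle_lt_trans; [apply Cmod_le_re_im|].
  change (Rabs (Re (F u v) - Re (F x y)) + Rabs (Im (F u v) - Im (F x y)) < eps). lra.
Qed.

Lemma cont2_const (c : C) (x y : R) : cont2 (fun _ _ => c) x y.
Proof. apply cont2_parts. split; apply continuity_2d_pt_const. Qed.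

Lemma cont2_mult (F G : R -> R -> C) (x y : R) : cont2 F x y -> cont2 G x y ->
  cont2 (fun u v => F u v * G u v)%C x y.
Proof.
intros HF HG. apply cont2_parts in HF. apply cont2_parts in HG.
destruct HF as [F1 F2]. destruct HG as [G1 G2]. apply cont2_parts. split.
- apply (continuity_2d_pt_minus (fun u v => Re (F u v) * Re (G u v))
    (fun u v => Im (F u v) * Im (G u v))); apply continuity_2d_pt_mult; auto.
- apply (continuity_2d_pt_plus (fun u v => Re (F u v) * Im (G u v))
    (fun u v => Im (F u v) * Re (G u v))); apply continuity_2d_pt_mult; auto.
Qed.

Lemma cont2_plus (F G : R -> R -> C) (x y : R) : cont2 F x y -> cont2 G x y ->
  cont2 (fun u v => F u v + G u v)%C x y.
Proof.
intros HF HG. apply cont2_parts in HF. apply cont2_parts in HG.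
destruct HF as [F1 F2]. destruct HG as [G1 G2]. apply cont2_parts. split.
- apply (continuity_2d_pt_plus (fun u v => Re (F u v)) (fun u v => Re (G u v))); auto.
- apply (continuity_2d_pt_plus (fun u v => Im (F u v)) (fun u v => Im (G u v))); auto.
Qed.

Lemma cont2_opp (F : R -> R -> C) (x y : R) : cont2 F x y -> cont2 (fun u v => - F u v)%C x y.
Proof.
intros H. intros eps Heps. destruct (H eps Heps) as [d [Hd H']]. exists d. split; auto.
intros u v Hu Hv. replace (- F u v - - F x y)%C with (- (F u v - F x y))%C by ring.
rewrite Cmod_opp. auto.
Qed.

Lemma cont2_comp (f : C -> C) (F : R -> R -> C) (x y : R) :
  continuous f (F x y) -> cont2 F x y -> cont2 (fun u v => f (F u v)) x y.
Proof.
intros Hf HF eps Heps.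
destruct (proj1 (continuous_C_eps f _) Hf eps Heps) as [d [Hd H]].
destruct (HF d Hd) as [d' [Hd' H']]. exists d'. split; auto.
Qed.

Lemma continuity_2d_pt_fun1 (f : R -> R) (x y : R) :
  continuity_pt f x -> continuity_2d_pt (fun u _ => f u) x y.
Proof. intros H. apply (continuity_1d_2d_pt_comp f (fun u _ => u)); auto. apply continuity_2d_pt_id1. Qed.

Lemma continuity_2d_pt_fun2 (f : R -> R) (x y : R) :
  continuity_pt f y -> continuity_2d_pt (fun _ v => f v) x y.
Proof. intros H. apply (continuity_1d_2d_pt_comp f (fun _ v => v)); auto. apply continuity_2d_pt_id2. Qed.

Lemma cont2_cis1 (x y : R) : cont2 (fun u _ => cis u) x y.
Proof.
apply cont2_parts; split; apply (continuity_2d_pt_fun1 _ x y);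
  [apply continuity_cos|apply continuity_sin].
Qed.

Lemma cont2_cis2 (x y : R) : cont2 (fun _ u => cis u) x y.
Proof.
apply cont2_parts; split; apply (continuity_2d_pt_fun2 _ x y);
  [apply continuity_cos|apply continuity_sin].
Qed.

Lemma cont2_R1 (x y : R) : cont2 (fun u _ => RtoC u) x y.
Proof.
apply cont2_parts; split; [apply continuity_2d_pt_id1|].
apply (continuity_2d_pt_ext (fun _ _ => 0)); [reflexivity|apply continuity_2d_pt_const].
Qed.

Lemma Cmod_cis (x : R) : Cmod (cis x) = 1.
Proof.
unfold Cmod, cis. simpl. rewrite !Rmult_1_r.
replace (cos x * cos x + sin x * sin x) with 1
  by (pose proof (sin2_cos2 x) as H; unfold Rsqr in H; lra).
apply sqrt_1.
Qed.

Lemma Cmod_R_cis (r x : R) : 0 <= r -> Cmod (RtoC r * cis x) = r.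
Proof. intros. rewrite Cmod_mult, Cmod_cis, Cmod_R, Rabs_pos_eq; lra. Qed.

Lemma cis_plus (x y : R) : cis (x + y) = (cis x * cis y)%C.
Proof.
unfold cis, Cmult. simpl. rewrite cos_plus, sin_plus.
apply injective_projections; simpl; ring.
Qed.

Lemma cis_0 : cis 0 = RtoC 1.
Proof. unfold cis. rewrite cos_0, sin_0. reflexivity. Qed.

Lemma cis_2PI : cis (2 * PI) = RtoC 1.
Proof. unfold cis. rewrite cos_2PI, sin_2PI. reflexivity. Qed.

Lemma is_derive_Re_cis (f : C -> C) (df : C) (r x : R) :
  is_derive f (RtoC r * cis x)%C df ->
  is_derive (fun t => Re (f (RtoC r * cis t)%C)) x (Re (Ci * (RtoC r * cis x) * df)%C) /\
  is_derive (fun t => Im (f (RtoC r * cis t)%C)) x (Im (Ci * (RtoC r * cis x) * df)%C).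
Proof.
intros H. apply (is_derive_along f (fun t => RtoC r * cis t)%C x df (Ci * (RtoC r * cis x))%C); auto.
- apply is_derive_ext with (fun t => r * cos t).
  { intros t. rewrite re_scal_l. reflexivity. }
  auto_derive; auto. unfold Ci, cis, Cmult, RtoC, Re; simpl. ring.
- apply is_derive_ext with (fun t => r * sin t).
  { intros t. unfold cis, Cmult, RtoC, Im; simpl. ring. }
  auto_derive; auto. unfold Ci, cis, Cmult, RtoC, Im; simpl. ring.
Qed.

Lemma is_derive_Re_ray (f : C -> C) (df : C) (r x : R) :
  is_derive f (RtoC r * cis x)%C df ->
  is_derive (fun t => Re (f (RtoC t * cis x)%C)) r (Re (cis x * df)%C).
Proof.
intros H. apply (is_derive_along f (fun t => RtoC t * cis x)%C r df (cis x)); auto.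
- apply is_derive_ext with (fun t => t * cos x).
  { intros t. rewrite re_scal_l. reflexivity. }
  auto_derive; auto. unfold cis, Re; simpl. ring.
- apply is_derive_ext with (fun t => t * sin x).
  { intros t. unfold cis, Cmult, RtoC, Im; simpl. ring. }
  auto_derive; auto. unfold cis, Im; simpl. ring.
Qed.

Lemma holo_continuous (D : C -> Prop) (f : C -> C) (z : C) :
  holo 1 D f -> D z -> continuous f z.
Proof. intros [f' [H _]] Hz. apply (is_derive_continuous_C f z (f' z)); auto. Qed.

Lemma continuous_parts_circle (f : C -> C) (r x : R) :
  continuous f (RtoC r * cis x)%C ->
  continuous (fun t => Re (f (RtoC r * cis t)%C)) x /\
  continuous (fun t => Im (f (RtoC r * cis t)%C)) x.
Proof.
intros H.
assert (H2 : cont2 (fun _ t => f (RtoC r * cis t)%C) 0 x).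
{ apply (cont2_comp f (fun _ t => RtoC r * cis t)%C); auto.
  apply cont2_mult; [apply cont2_const|apply cont2_cis2]. }
apply cont2_parts in H2. destruct H2 as [A B].
split; apply continuity_pt_filterlim.
- intros eps Heps. destruct (A (mkposreal eps Heps)) as [d Hd]. exists d. split; [apply cond_pos|].
  intros t [_ Ht]. apply (Hd 0 t); auto. rewrite Rminus_diag, Rabs_R0. apply cond_pos.
- intros eps Heps. destruct (B (mkposreal eps Heps)) as [d Hd]. exists d. split; [apply cond_pos|].
  intros t [_ Ht]. apply (Hd 0 t); auto. rewrite Rminus_diag, Rabs_R0. apply cond_pos.
Qed.

Lemma ex_RInt_cont (f : R -> R) (a b : R) : (forall x, continuous f x) -> ex_RInt f a b.
Proof. intros H. apply (ex_RInt_continuous (V := R_CompleteNormedModule)). auto. Qed.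

Lemma RInt_derive_periodic (f df : R -> R) :
  (forall x, is_derive f x (df x)) -> (forall x, continuous df x) ->
  f (2 * PI) = f 0 -> RInt df 0 (2 * PI) = 0.
Proof.
intros H1 H2 H3. apply is_RInt_unique.
replace 0 with (f (2 * PI) - f 0) at 2 by lra.
apply (is_RInt_derive (V := R_CompleteNormedModule) f); auto.
Qed.

(** The derivative in r of the integral over the circle of radius r is, by Cauchy-Riemann, the
    integral over a period of an angular derivative, hence zero; at r = 0 the integrand is
    constant. *)
Lemma mean_value (K : C -> C) (rad r : R) :
  holo 2 (Cdisc rad) K -> 0 <= r < rad ->
  RInt (fun x => Re (K (RtoC r * cis x)%C)) 0 (2 * PI) = 2 * PI * Re (K (RtoC 0)).
Proof.
intros [K' [HK HK']] Hr.
assert (Hin : forall t x, Rabs t < rad -> Cdisc rad (RtoC t * cis x)%C).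
{ intros t x Ht. unfold Cdisc. rewrite Cmod_mult, Cmod_cis, Cmod_R. lra. }
set (I := fun t => RInt (fun x => Re (K (RtoC t * cis x)%C)) 0 (2 * PI)).
assert (HD : forall t x, Rabs t < rad ->
  Derive (fun u => Re (K (RtoC u * cis x)%C)) t = Re (cis x * K' (RtoC t * cis x))%C).
{ intros t x Ht. apply is_derive_unique, is_derive_Re_ray. apply HK; auto. }
assert (Hloc : forall t, Rabs t < rad -> exists d : posreal,
  forall u, Rabs (u - t) < d -> Rabs u < rad).
{ intros t Ht. exists (mkposreal (rad - Rabs t) ltac:(lra)). simpl. intros u Hu.
  replace u with ((u - t) + t) by ring. eapply Rle_lt_trans; [apply Rabs_triang|]. lra. }
assert (H0 : forall t, 0 <= t <= r -> is_derive I t 0).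
{ intros t Ht0.
  assert (Ht : Rabs t < rad) by (rewrite Rabs_pos_eq; lra).
  destruct (Hloc t Ht) as [d Hd].
  replace 0 with (RInt (fun x => Derive (fun u => Re (K (RtoC u * cis x)%C)) t) 0 (2 * PI)).
  - apply (is_derive_RInt_param (fun t x => Re (K (RtoC t * cis x)%C))).
    + exists d. intros u Hu x _. exists (Re (cis x * K' (RtoC u * cis x))%C).
      apply is_derive_Re_ray, HK, Hin, Hd. exact Hu.
    + intros x _.
      apply continuity_2d_pt_ext_loc with (fun u v => Re (cis v * K' (RtoC u * cis v))%C).
      { exists d. intros u v Hu _. symmetry. apply HD. apply Hd. exact Hu. }
      apply (proj1 (cont2_parts (fun u v => cis v * K' (RtoC u * cis v))%C t x)).
      apply cont2_mult; [apply cont2_cis2|].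
      apply (cont2_comp K' (fun u v => RtoC u * cis v)%C).
      * apply holo_continuous with (Cdisc rad); auto.
      * apply cont2_mult; [apply cont2_R1|apply cont2_cis2].
    + exists d. intros u Hu. apply ex_RInt_cont. intros x.
      apply continuous_parts_circle.
      apply (is_derive_continuous_C K _ (K' (RtoC u * cis x)%C)). apply HK, Hin, Hd. exact Hu.
  - rewrite (RInt_ext _ (fun x => Re (cis x * K' (RtoC t * cis x))%C))
      by (intros; apply HD; auto).
    assert (Hc : forall x, continuous (fun x => Re (cis x * K' (RtoC t * cis x))%C) x).
    { intros x.
      assert (A : cont2 (fun _ x => cis x * K' (RtoC t * cis x))%C 0 x).
      { apply cont2_mult; [apply cont2_cis2|].
        apply (cont2_comp K' (fun _ v => RtoC t * cis v)%C).
        - apply holo_continuous with (Cdisc rad); auto.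
        - apply cont2_mult; [apply cont2_const|apply cont2_cis2]. }
      apply cont2_parts in A. destruct A as [A _].
      apply continuity_pt_filterlim. intros eps Heps.
      destruct (A (mkposreal eps Heps)) as [d' Hd']. exists d'. split; [apply cond_pos|].
      intros v [_ Hv]. apply (Hd' 0 v); auto. rewrite Rminus_diag, Rabs_R0. apply cond_pos. }
    (* t times the integrand is the angular derivative of Im K, by Cauchy-Riemann; at t = 0
       the integrand is a trigonometric polynomial without constant term. *)
    destruct (Req_dec t 0) as [E|E].
    + subst t. apply (RInt_derive_periodic (fun x => Im (cis x * K' (RtoC 0))%C)).
      * intros x. replace (RtoC 0 * cis x)%C with (RtoC 0) by ring.
        apply is_derive_ext with (fun x => cos x * Im (K' (RtoC 0)) + sin x * Re (K' (RtoC 0))).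
        { intros u. unfold Im, Cmult, cis; simpl. unfold Im, Re; ring. }
        replace (Re (cis x * K' (RtoC 0))%C) with
          (- sin x * Im (K' (RtoC 0)) + cos x * Re (K' (RtoC 0)))
          by (rewrite re_mult; unfold cis, Re, Im; simpl; ring).
        generalize (Re (K' (RtoC 0))) (Im (K' (RtoC 0))); intros a b.
        auto_derive; auto; ring.
      * exact Hc.
      * rewrite cis_2PI, cis_0. reflexivity.
    + apply Rmult_eq_reg_l with t; auto. rewrite Rmult_0_r.
      rewrite <- (RInt_scal (V := R_CompleteNormedModule) _ 0 (2 * PI) t)
        by (apply ex_RInt_cont; auto).
      apply (RInt_derive_periodic (fun x => Im (K (RtoC t * cis x)%C))).
      * intros x.
        change (is_derive (fun x => Im (K (RtoC t * cis x)%C)) x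
          (t * Re (cis x * K' (RtoC t * cis x))%C)).
        replace (t * Re (cis x * K' (RtoC t * cis x))%C) with
          (Im (Ci * (RtoC t * cis x) * K' (RtoC t * cis x))%C)
          by (unfold Ci, Cmult, RtoC, Re, Im; simpl; ring).
        apply is_derive_Re_cis, HK, Hin; auto.
      * intros x. apply (continuous_scal_r (V := R_NormedModule) t). apply Hc.
      * rewrite cis_2PI, cis_0. reflexivity. }
assert (E : I 0 = I r).
{ destruct (Req_dec r 0) as [E|E]; [subst; auto|].
  apply (eq_is_derive I); [|lra]. intros t Ht. apply H0; auto. }
change (I r = 2 * PI * Re (K (RtoC 0))). rewrite <- E. unfold I.
rewrite (RInt_ext _ (fun _ => Re (K (RtoC 0)))).
- rewrite RInt_const. unfold scal; simpl; unfold mult; simpl. ring.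
- intros x _. replace (RtoC 0 * cis x)%C with (RtoC 0) by ring. reflexivity.
Qed.

(** * Moments on circles and the minimum modulus *)

(** The carrier of a normed module can hide that an equation is between reals, which ring
    has to see. *)
Ltac eqR := match goal with |- @eq _ ?a ?b => change (@eq R a b) end.

(** The squared modulus, whose logarithm is smooth without square roots. *)
Definition Csq (z : C) : R := Re z ^ 2 + Im z ^ 2.

Lemma Csq_Cmod (z : C) : Csq z = Cmod z ^ 2.
Proof. symmetry; apply Cmod2_alt. Qed.

Lemma Csq_mult (z w : C) : Csq (z * w)%C = Csq z * Csq w.
Proof. rewrite !Csq_Cmod, Cmod_mult. ring. Qed.

Lemma Csq_pos (z : C) : z <> RtoC 0 -> 0 < Csq z.
Proof. intros H. rewrite Csq_Cmod. apply pow_lt. apply Cmod_gt_0; auto. Qed.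

Lemma Csq_ge_0 (z : C) : 0 <= Csq z.
Proof. rewrite Csq_Cmod. apply pow_le. apply Cmod_ge_0. Qed.

Definition circ (r x : R) : C := (RtoC r * cis x)%C.

Lemma Cmod_circ (r x : R) : 0 <= r -> Cmod (circ r x) = r.
Proof. apply Cmod_R_cis. Qed.

Lemma continuous_Re_circ (f : C -> C) (rad r : R) :
  holo 1 (Cdisc rad) f -> 0 <= r < rad ->
  forall x, continuous (fun t => Re (f (circ r t))) x.
Proof.
intros H Hr x. apply continuous_parts_circle.
apply holo_continuous with (Cdisc rad); auto.
unfold Cdisc. rewrite Cmod_R_cis; lra.
Qed.

(** Integration by parts moves the cosine onto u', and u' sin(x - alpha) is the real part of a
    function holomorphic in z, to which the mean value property applies. It is used for
    u = Re f and u = ln |G|^2. *)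
Lemma cos_moment (K : C -> C) (rad r alpha : R) (u : R -> R) :
  holo 2 (Cdisc rad) K -> 0 < r < rad ->
  (forall x, is_derive u x (Re (Ci * circ r x * K (circ r x))%C)) ->
  u (2 * PI) = u 0 ->
  RInt (fun x => u x * cos (x - alpha)) 0 (2 * PI) = PI * r * Re (cis alpha * K (RtoC 0))%C.
Proof.
intros HK Hr Hu Hper.
(* On |z| = r, i z K(z) sin(x - alpha) = M(z): there e^(i x) = z / r and e^(- i x) = r / z. *)
set (M := fun z => (RtoC (/ 2) * (RtoC (/ r) * cis (- alpha) * (z * z) * K z
                      + RtoC (- r) * cis alpha * K z))%C).
assert (HM : holo 2 (Cdisc rad) M).
{ unfold M.
  assert (hc := holo_const 2 (Cdisc rad)). assert (hi := holo_id 2 (Cdisc rad)).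
  repeat (apply holo_mult || apply holo_plus); auto. }
assert (EM : forall x, Re (M (circ r x)) =
   Re (Ci * circ r x * K (circ r x))%C * sin (x - alpha)).
{ intros x. unfold M, circ. rewrite sin_minus.
  pose proof (sin2_cos2 x) as S. unfold Rsqr in S.
  assert (S' : sin x * sin x = 1 - cos x * cos x) by lra.
  unfold cis, Ci, Cmult, Cplus, RtoC, Re, Im; simpl.
  rewrite cos_neg, sin_neg. set (k := K _). destruct k as [k1 k2]. simpl.
  field_simplify; [|lra].
  replace (sin x ^ 2) with (1 - cos x * cos x) by (rewrite <- S'; ring).
  field. lra. }
assert (HRe : forall x, continuous (fun x => Re (M (circ r x))) x).
{ apply continuous_Re_circ with rad; [apply holo_S; auto|lra]. }
assert (Hcu : forall x, continuous u x).
{ intros x. apply (ex_derive_continuous (K := R_AbsRing) (V := R_NormedModule)).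
  eexists; apply Hu. }
assert (Hcc : forall x, continuous (fun x => cos (x - alpha)) x).
{ intros x. apply (ex_derive_continuous (K := R_AbsRing) (V := R_NormedModule)). auto_derive; auto. }
assert (Huc : forall x, continuous (fun x => u x * cos (x - alpha)) x).
{ intros x. apply (continuous_mult (K := R_AbsRing)); auto. }
assert (H1 := mean_value M rad r HM ltac:(lra)).
assert (H0 : RInt (fun x => Re (M (circ r x)) + u x * cos (x - alpha)) 0 (2 * PI) = 0).
{ apply (RInt_derive_periodic (fun x => u x * sin (x - alpha))).
  - intros x. rewrite EM.
    set (du := Re (Ci * circ r x * K (circ r x))%C).
    replace (du * sin (x - alpha) + u x * cos (x - alpha)) with
       (du * sin (x - alpha) + u x * (1 * cos (x - alpha))) by ring.
    apply (Derive.is_derive_mult u (fun x => sin (x - alpha))); [apply Hu|].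
    auto_derive; auto; ring.
  - intros x. apply (continuous_plus (K := R_AbsRing) (V := R_NormedModule)); auto.
  - rewrite Hper. f_equal.
    replace (2 * PI - alpha) with ((0 - alpha) + 2 * PI) by ring.
    rewrite sin_plus, sin_2PI, cos_2PI. ring. }
rewrite (RInt_plus (V := R_CompleteNormedModule)) in H0 by (apply ex_RInt_cont; auto).
change (RInt (fun x => Re (M (circ r x))) 0 (2 * PI) +
  RInt (fun x => u x * cos (x - alpha)) 0 (2 * PI) = 0) in H0.
change (RInt (fun x => Re (M (circ r x))) 0 (2 * PI) = 2 * PI * Re (M (RtoC 0))) in H1.
assert (E : Re (M (RtoC 0)) = - (r / 2) * Re (cis alpha * K (RtoC 0))%C).
{ unfold M. rewrite re_scal_l.
  replace (RtoC (/ r) * cis (- alpha) * (RtoC 0 * RtoC 0) * K (RtoC 0) +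
    RtoC (- r) * cis alpha * K (RtoC 0))%C with (RtoC (- r) * (cis alpha * K (RtoC 0)))%C by ring.
  rewrite re_scal_l. field. }
rewrite E in H1. lra.
Qed.

Lemma cos_moment_Re (f f1 : C -> C) (rad r alpha : R) :
  (forall z, Cdisc rad z -> is_derive f z (f1 z)) -> holo 2 (Cdisc rad) f1 -> 0 < r < rad ->
  RInt (fun x => Re (f (circ r x)) * cos (x - alpha)) 0 (2 * PI) =
    PI * r * Re (cis alpha * f1 (RtoC 0))%C.
Proof.
intros Hf Hf1 Hr. apply (cos_moment f1 rad r alpha (fun x => Re (f (circ r x)))); auto.
- intros x. apply is_derive_Re_cis. apply Hf. unfold Cdisc, circ. rewrite Cmod_R_cis; lra.
- unfold circ. rewrite cis_2PI, cis_0. reflexivity.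
Qed.

Lemma is_derive_ln_sumsq (U V : R -> R) (x u v : R) :
  is_derive U x u -> is_derive V x v -> 0 < U x ^ 2 + V x ^ 2 ->
  is_derive (fun t => ln (U t ^ 2 + V t ^ 2)) x
    (2 * (U x * u + V x * v) / (U x ^ 2 + V x ^ 2)).
Proof.
intros A B P. auto_derive.
- repeat split; try (eexists; eauto; fail). lra.
- replace (Derive (fun t : R => U t) x) with u by (symmetry; apply is_derive_unique, A).
  replace (Derive (fun t : R => V t) x) with v by (symmetry; apply is_derive_unique, B).
  field. lra.
Qed.

(** The moment of ln |G|^2 sees only the logarithmic derivative of G at the origin. No branch
    of the logarithm is needed: only the derivative G'/G enters. *)
Lemma cos_moment_ln (G G1 : C -> C) (rad r alpha : R) :
  (forall z, Cdisc rad z -> is_derive G z (G1 z)) -> holo 2 (Cdisc rad) G1 ->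
  (forall z, Cdisc rad z -> G z <> RtoC 0) -> 0 < r < rad ->
  RInt (fun x => ln (Csq (G (circ r x))) * cos (x - alpha)) 0 (2 * PI) =
    2 * PI * r * Re (cis alpha * (G1 (RtoC 0) / G (RtoC 0)))%C.
Proof.
intros HG HG1 Hn Hr.
assert (HGh : holo 2 (Cdisc rad) G) by (apply holo_S; exists G1; auto).
set (K := fun z => (RtoC 2 * (G1 z * / G z))%C).
assert (HK : holo 2 (Cdisc rad) K).
{ apply holo_mult; [apply holo_const|]. apply holo_mult; auto. apply holo_inv; auto. }
rewrite (cos_moment K rad r alpha (fun x => ln (Csq (G (circ r x))))); auto.
- unfold K. replace (cis alpha * (RtoC 2 * (G1 (RtoC 0) * / G (RtoC 0))))%C with
    (RtoC 2 * (cis alpha * (G1 (RtoC 0) / G (RtoC 0))))%C by (unfold Cdiv; ring).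
  rewrite re_scal_l. eqR. ring.
- intros x. assert (Hz : Cdisc rad (circ r x)) by (unfold Cdisc, circ; rewrite Cmod_R_cis; lra).
  destruct (is_derive_Re_cis G (G1 (circ r x)) r x (HG _ Hz)) as [A B].
  assert (P := Csq_pos _ (Hn _ Hz)). fold (circ r x) in A, B.
  set (z := circ r x) in *. set (g1 := (Ci * z * G1 z)%C) in *.
  assert (E : Re (Ci * z * K z)%C =
     (2 * (Re (G z) * Re g1 + Im (G z) * Im g1)) / Csq (G z)).
  { unfold K. replace (Ci * z * (RtoC 2 * (G1 z * / G z)))%C with
      (RtoC 2 * (g1 * / G z))%C by (unfold g1; ring).
    rewrite re_scal_l. unfold Csq in *. set (b := G z) in *. clearbody g1 b.
    destruct b as [b1 b2], g1 as [c1 c2]. unfold Cmult, Cinv, Re, Im in *; simpl in *. field.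
    intros Z. apply (Rlt_irrefl 0). rewrite <- Z at 2. lra. }
  rewrite E. unfold Csq in *.
  apply is_derive_ln_sumsq; auto.
- unfold circ. rewrite cis_2PI, cis_0. reflexivity.
Qed.

Lemma one_minus_neq_0 (w : C) : Cmod w < 1 -> (RtoC 1 - w)%C <> RtoC 0.
Proof.
intros H. apply Cminus_neq_0. intros E. rewrite <- E, Cmod_1 in H. lra.
Qed.

Lemma Cmod_scal_lt1 (c z : C) (s : R) : Cmod c = s -> 0 < s -> Cdisc (/ s) z -> Cmod (c * z) < 1.
Proof.
intros Hc Hs Hz. rewrite Cmod_mult, Hc. unfold Cdisc in Hz.
apply Rmult_lt_compat_l with (r := s) in Hz; auto. rewrite Rinv_r in Hz; lra.
Qed.

(** It bounds the total effect of the regularisation near the diagonal. *)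
Lemma poisson_mass (s y : R) : 0 < s < 1 ->
  RInt (fun x => (1 - s ^ 2) / Csq (RtoC 1 - RtoC s * cis (x - y))%C) 0 (2 * PI) = 2 * PI.
Proof.
intros Hs.
set (c := (RtoC s * cis (- y))%C).
assert (Hc : Cmod c = s) by (apply Cmod_R_cis; lra).
(* The Poisson kernel is the real part of (1 + c z) / (1 - c z) on the unit circle. *)
set (K := fun z => ((RtoC 1 + c * z) * / (RtoC 1 + RtoC (-1) * (c * z)))%C).
assert (Em : forall z, (RtoC 1 + RtoC (-1) * (c * z))%C = (RtoC 1 - c * z)%C).
{ intros z. replace (RtoC (-1)) with (- RtoC 1)%C by (rewrite <- RtoC_opp; reflexivity). ring. }
assert (HK : holo 2 (Cdisc (/ s)) K).
{ assert (hc := holo_const 2 (Cdisc (/ s))). assert (hi := holo_id 2 (Cdisc (/ s))).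
  assert (Hp : holo 2 (Cdisc (/ s)) (fun z => c * z)%C) by (apply holo_mult; auto).
  apply holo_mult; [apply holo_plus; auto|].
  apply holo_inv.
  - intros z Hz. rewrite Em. apply one_minus_neq_0. apply Cmod_scal_lt1 with s; auto; lra.
  - apply holo_plus; auto. apply holo_mult; auto. }
assert (H1 : 1 < / s) by (rewrite <- Rinv_1; apply Rinv_lt_contravar; lra).
assert (H := mean_value K (/ s) 1 HK ltac:(lra)).
rewrite (RInt_ext _ (fun x => Re (K (RtoC 1 * cis x)%C))).
- rewrite H. unfold K.
  replace ((RtoC 1 + c * RtoC 0) * / (RtoC 1 + RtoC (-1) * (c * RtoC 0)))%C with (RtoC 1).
  + simpl. ring.
  + rewrite Em. replace (RtoC 1 - c * RtoC 0)%C with (RtoC 1) by ring. field.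
- intros x _. unfold K. rewrite Em.
  replace (c * (RtoC 1 * cis x))%C with (RtoC s * cis (x - y))%C.
  2: { unfold c, Rminus. rewrite cis_plus. ring. }
  assert (N : (RtoC 1 - RtoC s * cis (x - y))%C <> RtoC 0).
  { apply one_minus_neq_0. rewrite Cmod_R_cis; lra. }
  assert (P := Csq_pos _ N).
  unfold Csq in *. generalize dependent (x - y). intros t _ P.
  pose proof (sin2_cos2 t) as S. unfold Rsqr in S.
  unfold cis, Cmult, Cplus, Cminus, Copp, Cinv, RtoC, Re, Im in *; simpl in *.
  match type of P with 0 < ?D => set (d := D) in * end.
  assert (Ed : d = 1 + s * s - 2 * s * cos t).
  { unfold d. transitivity (1 - 2 * s * cos t + s * s * (sin t * sin t + cos t * cos t)); [ring|].
    rewrite S; ring. }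
  field_simplify_eq; [|lra].
  transitivity (1 - s * s * (sin t * sin t + cos t * cos t)); [rewrite S; ring|ring].
Qed.

(** The mean value property of H(z0) / H. *)
Lemma min_modulus (H : C -> C) (z0 : C) (s rad m : R) :
  holo 2 (fun z => Cmod (z - z0) < rad) H ->
  (forall z, Cmod (z - z0) < rad -> H z <> RtoC 0) -> 0 < s < rad -> 0 < m ->
  (forall z, Cmod (z - z0) = s -> m <= Cmod (H z)) -> m <= Cmod (H z0).
Proof.
intros Hh Hn Hs Hm Hmin.
set (c := H z0).
assert (Hc : c <> RtoC 0).
{ apply Hn. replace (z0 - z0)%C with (RtoC 0) by ring. rewrite Cmod_0; lra. }
set (K := fun z => (c * / H (z0 + z))%C).
assert (HK : holo 2 (Cdisc rad) K).
{ apply holo_mult; [apply holo_const|].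
  assert (Hd : forall z, Cdisc rad z -> Cmod (z0 + z - z0) < rad).
  { intros z Hz. replace (z0 + z - z0)%C with z by ring. exact Hz. }
  apply (holo_inv 2 (Cdisc rad) (fun z => H (z0 + z)%C)).
  - intros z Hz. apply Hn, Hd; auto.
  - apply (holo_comp 2 (Cdisc rad) (fun z => Cmod (z - z0) < rad) H (fun z => z0 + z)%C); auto.
    apply holo_plus; [apply holo_const|apply holo_id]. }
assert (HM := mean_value K rad s HK ltac:(lra)).
assert (E0 : K (RtoC 0) = RtoC 1).
{ unfold K. replace (z0 + RtoC 0)%C with z0 by ring. fold c. field; auto. }
rewrite E0 in HM. change (Re (RtoC 1)) with 1 in HM. rewrite Rmult_1_r in HM.
assert (Hle : RInt (fun x => Re (K (RtoC s * cis x)%C)) 0 (2 * PI) <=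
   RInt (fun _ => Cmod c / m) 0 (2 * PI)).
{ assert (HPI := PI_RGT_0). apply RInt_le; [lra| | |].
  - apply ex_RInt_cont. apply (continuous_Re_circ K rad); [apply holo_S; auto|lra].
  - apply ex_RInt_cont. intros; apply continuous_const.
  - intros x _. eapply Rle_trans; [apply Rle_abs|].
    eapply Rle_trans; [apply re_le_Cmod|]. unfold K.
    assert (Hz : Cmod (z0 + RtoC s * cis x - z0) = s).
    { replace (z0 + RtoC s * cis x - z0)%C with (RtoC s * cis x)%C by ring.
      apply Cmod_R_cis; lra. }
    assert (Hg := Hmin _ Hz).
    rewrite Cmod_mult, Cmod_inv by (apply Hn; lra).
    apply Rmult_le_compat_l; [apply Cmod_ge_0|].
    apply Rinv_le_contravar; auto. }
rewrite RInt_const in Hle. change (scal (2 * PI - 0) (Cmod c / m)) with ((2 * PI - 0) * (Cmod c / m)) in Hle.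
assert (HPI := PI_RGT_0).
assert (H1 : 1 <= Cmod c / m).
{ apply Rmult_le_reg_l with (2 * PI); [lra|]. rewrite HM in Hle. lra. }
apply Rmult_le_compat_r with (r := m) in H1; [|lra].
unfold Rdiv in H1. rewrite Rmult_assoc, Rinv_l in H1; lra.
Qed.

(** * Positivity of the logarithmic energy *)

Definition contR (f : R -> R) : Prop := forall x, continuous f x.

Lemma contR_const (c : R) : contR (fun _ => c).
Proof. intros x. apply continuous_const. Qed.

Lemma contR_plus (f g : R -> R) : contR f -> contR g -> contR (fun x => f x + g x).
Proof. intros Hf Hg x. apply (continuous_plus (K := R_AbsRing) (V := R_NormedModule)); auto. Qed.

Lemma contR_mult (f g : R -> R) : contR f -> contR g -> contR (fun x => f x * g x).
Proof. intros Hf Hg x. apply (continuous_mult (K := R_AbsRing)); auto. Qed.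

Lemma contR_ext (f g : R -> R) : (forall x, f x = g x) -> contR f -> contR g.
Proof. intros H Hf x. apply (continuous_ext f); auto. Qed.

Lemma contR_comp (h f : R -> R) : (forall x, continuous h (f x)) -> contR f -> contR (fun x => h (f x)).
Proof. intros Hh Hf x. apply (continuous_comp f h); auto. Qed.

Lemma contR_ln (f : R -> R) : (forall x, 0 < f x) -> contR f -> contR (fun x => ln (f x)).
Proof.
intros Hp. apply contR_comp. intros x.
apply (ex_derive_continuous (K := R_AbsRing) (V := R_NormedModule)). auto_derive; auto.
Qed.

Lemma contR_inv (f : R -> R) : (forall x, f x <> 0) -> contR f -> contR (fun x => / f x).
Proof.
intros Hp. apply contR_comp. intros x.
apply (ex_derive_continuous (K := R_AbsRing) (V := R_NormedModule)). auto_derive; auto.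
Qed.

Definition pint (f : R -> R) : R := RInt f 0 (2 * PI).

Lemma pint_plus (f g : R -> R) : contR f -> contR g ->
  pint (fun x => f x + g x) = pint f + pint g.
Proof.
intros. apply (RInt_plus (V := R_CompleteNormedModule)); apply ex_RInt_cont; auto.
Qed.

Lemma pint_scal (c : R) (f : R -> R) : contR f -> pint (fun x => c * f x) = c * pint f.
Proof. intros. apply (RInt_scal (V := R_CompleteNormedModule)). apply ex_RInt_cont; auto. Qed.

Lemma pint_const (c : R) : pint (fun _ => c) = 2 * PI * c.
Proof.
unfold pint. rewrite RInt_const. change (scal (2 * PI - 0) c) with ((2 * PI - 0) * c). ring.
Qed.

Lemma pint_ext (f g : R -> R) : (forall x, f x = g x) -> pint f = pint g.
Proof. intros H. apply (RInt_ext (V := R_CompleteNormedModule)). auto. Qed.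

Lemma pint_le (f g : R -> R) : contR f -> contR g -> (forall x, f x <= g x) -> pint f <= pint g.
Proof.
intros. pose proof PI_RGT_0. apply RInt_le; auto; try (apply ex_RInt_cont; auto). lra.
Qed.

Lemma pint_abs_le (f g : R -> R) : contR f -> contR g -> (forall x, Rabs (f x) <= g x) ->
  Rabs (pint f) <= pint g.
Proof.
intros Hf Hg H. apply Rabs_le. split.
- assert (E : - pint g = pint (fun x => -1 * g x)) by (rewrite pint_scal; auto; ring).
  rewrite E. apply pint_le; auto.
  + apply contR_mult; auto. apply contR_const.
  + intros x. specialize (H x). apply Rabs_le_between in H. lra.
- apply pint_le; auto. intros x. eapply Rle_trans; [apply Rle_abs|apply H].
Qed.

(** Finite sums of products p(x) p(y). For these the double integral against c(x) c(y) is a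
    sum of squares and the order of integration is no issue. *)
Inductive psd_kernel : (R -> R -> R) -> Prop :=
| psd_kernel_0 : psd_kernel (fun _ _ => 0)
| psd_kernel_add k p : psd_kernel k -> contR p -> psd_kernel (fun x y => k x y + p x * p y)
| psd_kernel_ext k k' : (forall x y, k x y = k' x y) -> psd_kernel k -> psd_kernel k'.

Lemma psd_kernel_plus (k l : R -> R -> R) : psd_kernel k -> psd_kernel l -> psd_kernel (fun x y => k x y + l x y).
Proof.
intros Hk Hl. induction Hl as [|l p Hl IH Hp|l l' E Hl IH].
- apply psd_kernel_ext with k; auto. intros; ring.
- apply psd_kernel_ext with (fun x y => (k x y + l x y) + p x * p y); [intros; ring|].
  apply psd_kernel_add; auto.
- apply psd_kernel_ext with (fun x y => k x y + l x y); auto. intros; rewrite E; auto.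
Qed.

Lemma psd_kernel_mul1 (k : R -> R -> R) (p : R -> R) : psd_kernel k -> contR p ->
  psd_kernel (fun x y => k x y * (p x * p y)).
Proof.
intros Hk Hp. induction Hk as [|k q Hk IH Hq|k k' E Hk IH].
- apply psd_kernel_ext with (fun _ _ => 0); [intros; ring|constructor].
- apply psd_kernel_ext with (fun x y => k x y * (p x * p y) + (q x * p x) * (q y * p y));
    [intros; ring|].
  apply (psd_kernel_add _ (fun x => q x * p x)); auto. apply contR_mult; auto.
- apply psd_kernel_ext with (fun x y => k x y * (p x * p y)); auto. intros; rewrite E; auto.
Qed.

(** A product of sums of p(x) p(y) is a sum of such products: the Schur product theorem for
    kernels presented in this form. *)
Lemma psd_kernel_mult (k l : R -> R -> R) : psd_kernel k -> psd_kernel l -> psd_kernel (fun x y => k x y * l x y).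
Proof.
intros Hk Hl. induction Hl as [|l p Hl IH Hp|l l' E Hl IH].
- apply psd_kernel_ext with (fun _ _ => 0); [intros; ring|constructor].
- apply psd_kernel_ext with (fun x y => k x y * l x y + k x y * (p x * p y)); [intros; ring|].
  apply psd_kernel_plus; auto. apply psd_kernel_mul1; auto.
- apply psd_kernel_ext with (fun x y => k x y * l x y); auto. intros; rewrite E; auto.
Qed.

Lemma psd_kernel_const (c : R) : 0 <= c -> psd_kernel (fun _ _ => c).
Proof.
intros Hc. apply psd_kernel_ext with (fun x y => 0 + sqrt c * sqrt c).
- intros. rewrite sqrt_sqrt; lra.
- apply (psd_kernel_add (fun _ _ => 0) (fun _ => sqrt c)); [constructor|apply contR_const].
Qed.

Lemma psd_kernel_pow (k : R -> R -> R) (n : nat) : psd_kernel k -> psd_kernel (fun x y => k x y ^ n).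
Proof.
intros Hk. induction n as [|n IH].
- apply psd_kernel_ext with (fun _ _ => 1); [reflexivity|]. apply psd_kernel_const. lra.
- apply (psd_kernel_mult k (fun x y => k x y ^ n)); auto.
Qed.

Lemma psd_kernel_contR (k : R -> R -> R) (y : R) : psd_kernel k -> contR (fun x => k x y).
Proof.
intros Hk. induction Hk as [|k q Hk IH Hq|k k' E Hk IH].
- apply contR_const.
- apply contR_plus; auto. apply contR_mult; auto. apply contR_const.
- apply contR_ext with (fun x => k x y); auto.
Qed.

(** The inner integral is returned as an explicit continuous function J, because the outer
    integral needs its continuity. *)
Lemma psd_kernel_energy (k : R -> R -> R) (c : R -> R) : psd_kernel k -> contR c ->
  exists J, contR J /\ (forall y, J y = pint (fun x => c x * k x y)) /\
    0 <= pint (fun y => c y * J y).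
Proof.
intros Hk Hc. induction Hk as [|k q Hk IH Hq|k k' E Hk IH].
- exists (fun _ => 0). split; [apply contR_const|]. split.
  + intros y. rewrite (pint_ext _ (fun _ => 0)) by (intros; ring).
    rewrite pint_const. ring.
  + rewrite (pint_ext _ (fun _ => 0)) by (intros; ring). rewrite pint_const. lra.
- destruct IH as [J [HJ [HJe HJp]]].
  set (m := pint (fun x => c x * q x)).
  exists (fun y => J y + m * q y).
  assert (Hcq : contR (fun x => c x * q x)) by (apply contR_mult; auto).
  split; [apply contR_plus; auto; apply contR_mult; auto; apply contR_const|]. split.
  + intros y. rewrite HJe.
    rewrite (pint_ext (fun x => c x * (k x y + q x * q y))
      (fun x => c x * k x y + q y * (c x * q x))) by (intros; ring).
    rewrite pint_plus, pint_scal; auto.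
    * unfold m; ring.
    * apply contR_mult; auto. apply psd_kernel_contR; auto.
    * apply contR_mult; auto. apply contR_const.
  + rewrite (pint_ext _ (fun y => c y * J y + m * (c y * q y))) by (intros; ring).
    rewrite pint_plus, pint_scal; auto.
    * fold m. nra.
    * apply contR_mult; auto.
    * apply contR_mult; auto. apply contR_const.
- destruct IH as [J [HJ [HJe HJp]]]. exists J. repeat split; auto.
  intros y. rewrite HJe. apply pint_ext. intros; rewrite E; auto.
Qed.

(** The Taylor polynomial of - ln (1 - x). Its nonnegative coefficients preserve positive
    kernels. *)
Fixpoint ln_partial (m : nat) (x : R) : R :=
  match m with O => 0 | S n => ln_partial n x + x ^ S n / INR (S n) end.

Lemma ln_partial_approx (m : nat) (x kappa : R) : Rabs x <= kappa -> kappa < 1 ->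
  Rabs (ln (1 - x) + ln_partial m x) <= kappa ^ m / (1 - kappa).
Proof.
intros Hx Hk.
assert (Hk0 : 0 <= kappa) by (eapply Rle_trans; [apply Rabs_pos|apply Hx]).
assert (HdS : forall t, t <> 1 -> is_derive (ln_partial m) t ((1 - t ^ m) / (1 - t))).
{ intros t Ht. clear Hx. induction m as [|m IH].
  - simpl. replace ((1 - 1) / (1 - t)) with 0 by (field; lra).
    exact (is_derive_const (K := R_AbsRing) (V := R_NormedModule) 0 t).
  - change (is_derive (fun x => ln_partial m x + x ^ S m / INR (S m)) t ((1 - t ^ S m) / (1 - t))).
    replace ((1 - t ^ S m) / (1 - t)) with ((1 - t ^ m) / (1 - t) + t ^ m)
      by (simpl; field; lra).
    apply (is_derive_plus (K := R_AbsRing) (V := R_NormedModule)); auto.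
    assert (HS : INR (S m) <> 0) by (apply not_0_INR; lia).
    apply is_derive_ext with (fun x => / INR (S m) * x ^ S m).
    { intros s. unfold Rdiv. apply Rmult_comm. }
    replace (t ^ m) with (/ INR (S m) * (INR (S m) * 1 * t ^ m)) by (field; auto).
    apply is_derive_scal. apply (is_derive_pow (fun x => x) (S m) t 1).
    apply (is_derive_id (K := R_AbsRing)). }
(* The derivative of ln (1 - t) + ln_partial m t is - t^m / (1 - t). *)
set (h := fun t => ln (1 - t) + ln_partial m t).
assert (Hh : forall t, Rabs t <= kappa -> is_derive h t (- (t ^ m / (1 - t)))).
{ intros t Ht. apply Rabs_le_between in Ht.
  replace (- (t ^ m / (1 - t))) with (- / (1 - t) + (1 - t ^ m) / (1 - t)) by (field; lra).
  apply (is_derive_plus (K := R_AbsRing) (V := R_NormedModule)); [|apply HdS; lra].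
  auto_derive; [lra|field; lra]. }
assert (h0 : h 0 = 0).
{ unfold h. rewrite Rminus_0_r, ln_1. replace (ln_partial m 0) with 0; [ring|].
  clear. induction m as [|m IH]; [reflexivity|].
  change (0 = ln_partial m 0 + 0 ^ S m / INR (S m)). rewrite <- IH, pow_i by lia. unfold Rdiv; ring. }
change (Rabs (h x) <= kappa ^ m / (1 - kappa)).
replace (h x) with (h x - h 0) by lra.
eapply Rle_trans; [apply (bounded_variation h (fun t => - (t ^ m / (1 - t))) (kappa ^ m / (1 - kappa)))|].
- intros t Ht. rewrite !Rminus_0_r in Ht.
  assert (Ht' : Rabs t <= kappa) by lra. split; [apply Hh; auto|].
  apply Rabs_le_between in Ht' as Ht2.
  rewrite Rabs_Ropp. unfold Rdiv. rewrite Rabs_mult.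
  apply Rmult_le_compat; try apply Rabs_pos.
  + rewrite <- RPow_abs. apply pow_incr. split; [apply Rabs_pos|auto].
  + rewrite Rabs_pos_eq.
    * apply Rinv_le_contravar; lra.
    * apply Rlt_le, Rinv_0_lt_compat; lra.
- rewrite Rminus_0_r.
  assert (0 <= kappa ^ m / (1 - kappa)).
  { apply Rmult_le_pos; [apply pow_le; auto|apply Rlt_le, Rinv_0_lt_compat; lra]. }
  nra.
Qed.

Lemma psd_kernel_ln_partial (k : R -> R -> R) (m : nat) : psd_kernel k -> psd_kernel (fun x y => ln_partial m (k x y)).
Proof.
intros Hk. induction m as [|m IH].
- constructor.
- apply (psd_kernel_plus (fun x y => ln_partial m (k x y)) (fun x y => k x y ^ S m / INR (S m))); auto.
  apply (psd_kernel_mult (fun x y => k x y ^ S m) (fun _ _ => / INR (S m))).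
  + apply psd_kernel_pow; auto.
  + apply psd_kernel_const. apply Rlt_le, Rinv_0_lt_compat. apply lt_0_INR; lia.
Qed.

Section Energy.
Variables (W : R -> C) (A B : R) (c : R -> R).
Hypothesis HWr : contR (fun x => Re (W x)).
Hypothesis HWi : contR (fun x => Im (W x)).
Hypothesis HA : 0 < A.
Hypothesis HB : forall x, Csq (W x) <= B.
Hypothesis Hc : contR c.
Hypothesis Hc1 : forall x, Rabs (c x) <= 1.
Hypothesis Hc0 : pint c = 0.

Let u (x : R) := Csq (W x) + A.
Let K (x y : R) := (Csq (W x) * Csq (W y) +
  2 * A * (Re (W x) * Re (W y) + Im (W x) * Im (W y))) / (u x * u y).

Let Hu (x : R) : A <= u x.
Proof. unfold u. pose proof (Csq_ge_0 (W x)). lra. Qed.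

Let HCsq : contR (fun x => Csq (W x)).
Proof.
apply contR_ext with (fun x => Re (W x) * Re (W x) + Im (W x) * Im (W x)).
- intros x. unfold Csq; ring.
- apply contR_plus; apply contR_mult; auto.
Qed.

Let Hucont : contR u.
Proof. apply contR_plus; auto. apply contR_const. Qed.

Let HKpsd : psd_kernel K.
Proof.
assert (Hi : contR (fun x => / u x)).
{ apply contR_inv; auto. intros x. pose proof (Hu x). lra. }
apply psd_kernel_ext with (fun x y => (((0 + (Csq (W x) * / u x) * (Csq (W y) * / u y)) +
   (sqrt (2 * A) * (Re (W x) * / u x)) * (sqrt (2 * A) * (Re (W y) * / u y))) +
   (sqrt (2 * A) * (Im (W x) * / u x)) * (sqrt (2 * A) * (Im (W y) * / u y)))).
- intros x y. unfold K.
  assert (Sq : sqrt (2 * A) * sqrt (2 * A) = 2 * A) by (apply sqrt_sqrt; lra).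
  replace (sqrt (2 * A) * (Re (W x) * / u x) * (sqrt (2 * A) * (Re (W y) * / u y))) with
    ((sqrt (2 * A) * sqrt (2 * A)) * (Re (W x) * Re (W y)) / (u x * u y))
    by (field; pose proof (Hu x); pose proof (Hu y); lra).
  replace (sqrt (2 * A) * (Im (W x) * / u x) * (sqrt (2 * A) * (Im (W y) * / u y))) with
    ((sqrt (2 * A) * sqrt (2 * A)) * (Im (W x) * Im (W y)) / (u x * u y))
    by (field; pose proof (Hu x); pose proof (Hu y); lra).
  rewrite Sq. field; pose proof (Hu x); pose proof (Hu y); lra.
- apply (psd_kernel_add _ (fun x => sqrt (2 * A) * (Im (W x) * / u x))).
  2: { apply contR_mult; [apply contR_const|]. apply contR_mult; auto. }
  apply (psd_kernel_add _ (fun x => sqrt (2 * A) * (Re (W x) * / u x))).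
  2: { apply contR_mult; [apply contR_const|]. apply contR_mult; auto. }
  apply (psd_kernel_add _ (fun x => Csq (W x) * / u x)).
  2: { apply contR_mult; auto. }
  constructor.
Qed.

Let HK1 (x y : R) : 1 - K x y = A * (Csq (W x - W y) + A) / (u x * u y).
Proof.
unfold K. pose proof (Hu x) as H1. pose proof (Hu y) as H2.
unfold u in *. unfold Csq, Cminus in *. rewrite re_plus, re_opp.
replace (Im (W x + - W y)%C) with (Im (W x) - Im (W y)) by (unfold Im, Cplus, Copp; simpl; ring).
field. lra.
Qed.

Let kappa := Rmax (1 / 2) (1 - A * A / ((B + A) * (B + A))).

Let HB0 : 0 <= B.
Proof. eapply Rle_trans; [apply Csq_ge_0|apply (HB 0)]. Qed.

Let Hkappa : 1 / 2 <= kappa < 1.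
Proof.
split; [apply Rmax_l|]. apply Rmax_lub_lt; [lra|].
assert (0 < A * A / ((B + A) * (B + A))); [|lra].
apply Rdiv_lt_0_compat; nra.
Qed.

Let HKabs (x y : R) : Rabs (K x y) <= kappa.
Proof.
pose proof (Hu x) as H1. pose proof (Hu y) as H2.
pose proof (HB x) as B1. pose proof (HB y) as B2.
assert (P : 0 < u x * u y) by (apply Rmult_lt_0_compat; lra).
apply Rabs_le. split.
- apply Rle_trans with (- (1 / 2)); [lra|].
  unfold K. apply Rmult_le_reg_r with (u x * u y); auto.
  unfold Rdiv at 2. rewrite Rmult_assoc, Rinv_l, Rmult_1_r by lra.
  unfold u, Csq in *.
  set (a := Re (W x)) in *. set (b := Im (W x)) in *.
  set (a' := Re (W y)) in *. set (b' := Im (W y)) in *.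
  assert (0 <= (a + a') ^ 2 + (b + b') ^ 2)
    by (apply Rplus_le_le_0_compat; apply pow2_ge_0).
  assert (0 <= (a ^ 2 + b ^ 2) * (a' ^ 2 + b' ^ 2)).
  { apply Rmult_le_pos; apply Rplus_le_le_0_compat; apply pow2_ge_0. }
  assert (0 <= (a ^ 2 + b ^ 2)) by (apply Rplus_le_le_0_compat; apply pow2_ge_0).
  assert (0 <= (a' ^ 2 + b' ^ 2)) by (apply Rplus_le_le_0_compat; apply pow2_ge_0).
  (* |w w'|^2 + 2 A Re (w conj w') + A^2 = |w conj w' + A|^2 is nonnegative. *)
  assert (0 <= (a * a' + b * b' + A) ^ 2 + (a * b' - b * a') ^ 2)
    by (apply Rplus_le_le_0_compat; apply pow2_ge_0).
  assert (Q : 0 <= (a ^ 2 + b ^ 2) * (a' ^ 2 + b' ^ 2) + 2 * A * (a * a' + b * b') + A * A)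
    by nra.
  assert (Q2 : 0 <= A * ((a + a') ^ 2 + (b + b') ^ 2)) by nra.
  nra.
- apply Rle_trans with (1 - A * A / ((B + A) * (B + A))); [|apply Rmax_r].
  enough (A * A / ((B + A) * (B + A)) <= 1 - K x y) by lra.
  rewrite HK1. unfold Rdiv. apply Rmult_le_compat.
  + nra.
  + apply Rlt_le, Rinv_0_lt_compat. nra.
  + pose proof (Csq_ge_0 (W x - W y)). nra.
  + apply Rinv_le_contravar; auto. unfold u in *. apply Rmult_le_compat; lra.
Qed.

Let Hln (x y : R) : ln (Csq (W x - W y) + A) = ln (1 - K x y) + ln (u x) + (ln (u y) - ln A).
Proof.
pose proof (Hu x) as H1. pose proof (Hu y) as H2. pose proof (Csq_ge_0 (W x - W y)) as H3.
assert (P : 0 < u x * u y) by (apply Rmult_lt_0_compat; lra).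
rewrite HK1. unfold Rdiv. rewrite !ln_mult; try lra.
- rewrite ln_Rinv, ln_mult by lra. ring.
- apply Rmult_lt_0_compat; lra.
- apply Rinv_0_lt_compat; auto.
Qed.

(** The logarithmic energy of a charge c of total mass zero has a sign. With u = |W|^2 + A,
    |W x - W y|^2 + A = u(x) u(y) (1 - K(x, y)) / A, where K is a positive kernel with
    |K| <= kappa < 1. The terms depending on x or y alone are killed by the zero mean of c,
    and - ln (1 - K) is a uniform limit of positive kernels. The inner integral is only compared
    with a continuous function J, up to eta, which avoids any regularity question about it. *)
Lemma energy_bound (J : R -> R) (eta : R) : contR J ->
  (forall y, Rabs (pint (fun x => c x * ln (Csq (W x - W y) + A)) - J y) <= eta) ->
  pint (fun y => c y * J y) <= 2 * PI * eta.
Proof.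
intros HJ Heta. pose proof PI_RGT_0 as HPI.
assert (Hlnu : contR (fun x => ln (u x))).
{ apply contR_ln; auto. intros x. pose proof (Hu x); lra. }
set (L := pint (fun x => c x * ln (u x))).
assert (key : forall m, pint (fun y => c y * J y) <=
   2 * PI * (eta + 2 * PI * (kappa ^ m / (1 - kappa)))).
{ intros m. set (e := kappa ^ m / (1 - kappa)).
  destruct (psd_kernel_energy _ c (psd_kernel_ln_partial K m HKpsd) Hc) as [I [HI [HIe HIp]]].
  assert (Hk1 : forall y, contR (fun x => ln (1 - K x y))).
  { intros y. apply contR_ln.
    - intros x. pose proof (HKabs x y) as Q. apply Rabs_le_between in Q. lra.
    - apply contR_plus; [apply contR_const|].
      apply contR_ext with (fun x => -1 * K x y); [intros; ring|].
      apply contR_mult; [apply contR_const|]. apply psd_kernel_contR; auto. }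
  assert (Hk2 : forall y, contR (fun x => ln_partial m (K x y))).
  { intros y. apply (psd_kernel_contR (fun x y => ln_partial m (K x y))). apply psd_kernel_ln_partial; auto. }
  assert (H1 : forall y, pint (fun x => c x * ln (Csq (W x - W y) + A)) =
     pint (fun x => c x * (ln (1 - K x y) + ln_partial m (K x y))) - I y + L).
  { intros y. rewrite HIe.
    rewrite (pint_ext _ (fun x => (c x * (ln (1 - K x y) + ln_partial m (K x y)) +
       -1 * (c x * ln_partial m (K x y))) + (c x * ln (u x) + (ln (u y) - ln A) * c x)))
      by (intros x; rewrite Hln; ring).
    assert (C1 := contR_mult _ _ Hc (contR_plus _ _ (Hk1 y) (Hk2 y))).
    assert (C2 := contR_mult _ _ Hc (Hk2 y)).
    assert (C3 := contR_mult _ _ (contR_const (-1)) C2).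
    assert (C4 := contR_mult _ _ Hc Hlnu).
    assert (C5 := contR_mult _ _ (contR_const (ln (u y) - ln A)) Hc).
    rewrite (pint_plus _ _ (contR_plus _ _ C1 C3) (contR_plus _ _ C4 C5)),
      (pint_plus _ _ C1 C3), (pint_plus _ _ C4 C5), (pint_scal _ _ C2), (pint_scal _ _ Hc), Hc0.
    fold L. ring. }
  assert (H2 : forall y, Rabs (pint (fun x => c x * (ln (1 - K x y) + ln_partial m (K x y))))
     <= 2 * PI * e).
  { intros y. rewrite <- pint_const. apply pint_abs_le.
    - apply contR_mult; auto. apply contR_plus; auto.
    - apply contR_const.
    - intros x. rewrite Rabs_mult. apply Rle_trans with (1 * e); [|lra].
      apply Rmult_le_compat; try apply Rabs_pos; auto.
      apply ln_partial_approx; [apply HKabs|apply Hkappa]. }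
  assert (H3 : forall y, c y * J y <= (-1 * (c y * I y) + L * c y) + (eta + 2 * PI * e)).
  { intros y. specialize (Heta y). specialize (H2 y). rewrite H1 in Heta.
    set (Q := pint (fun x => c x * (ln (1 - K x y) + ln_partial m (K x y)))) in *. specialize (Hc1 y).
    assert (G : Rabs (J y + I y - L) <= eta + 2 * PI * e).
    { replace (J y + I y - L) with (- ((Q - I y + L) - J y) + Q) by ring.
      eapply Rle_trans; [apply Rabs_triang|]. rewrite Rabs_Ropp. lra. }
    enough (c y * (J y + I y - L) <= eta + 2 * PI * e) by lra.
    eapply Rle_trans; [apply Rle_abs|]. rewrite Rabs_mult.
    pose proof (Rabs_pos (J y + I y - L)). pose proof (Rabs_pos (c y)). nra. }
  set (E := eta + 2 * PI * e) in *. clearbody E.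
  assert (C2 := contR_mult _ _ Hc HI).
  assert (C3 := contR_plus _ _ (contR_mult _ _ (contR_const (-1)) C2)
    (contR_mult _ _ (contR_const L) Hc)).
  apply Rle_trans with (pint (fun y => (-1 * (c y * I y) + L * c y) + E)).
  { apply pint_le; [|exact (contR_plus _ _ C3 (contR_const E))|exact H3].
    apply contR_mult; auto. }
  rewrite (pint_plus _ _ C3 (contR_const E)),
    (pint_plus _ _ (contR_mult _ _ (contR_const (-1)) C2) (contR_mult _ _ (contR_const L) Hc)),
    (pint_scal _ _ C2), (pint_scal _ _ Hc), pint_const, Hc0. lra. }
apply Rnot_lt_le. intros Hlt.
set (gap := pint (fun y => c y * J y) - 2 * PI * eta) in *.
assert (Hgap : 0 < gap) by (unfold gap; lra).
set (e0 := gap * (1 - kappa) / (4 * PI * PI)).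
assert (He0 : 0 < e0).
{ unfold e0. apply Rdiv_lt_0_compat; [apply Rmult_lt_0_compat; lra|nra]. }
destruct (pow_lt_1_zero kappa ltac:(rewrite Rabs_pos_eq; lra) e0 He0) as [N HN].
specialize (HN N (Nat.le_refl N)). specialize (key N).
rewrite Rabs_pos_eq in HN by (apply pow_le; lra).
assert (HH : 2 * PI * (2 * PI * (kappa ^ N / (1 - kappa))) < gap).
{ replace gap with (2 * PI * (2 * PI * (e0 / (1 - kappa)))) by (unfold e0; field; lra).
  apply Rmult_lt_compat_l; [lra|]. apply Rmult_lt_compat_l; [lra|].
  apply Rmult_lt_compat_r; auto. apply Rinv_0_lt_compat; lra. }
unfold gap in HH. lra.
Qed.

End Energy.

(** * The difference-quotient kernel of a univalent function *)

(** The argument is taken in [-PI, PI] so that compactness arguments on that interval reach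
    the whole circle. *)
Lemma cis_surj (w : C) : Cmod w = 1 -> exists t, - PI <= t <= PI /\ w = cis t.
Proof.
intros Hw.
assert (H : Re w ^ 2 + Im w ^ 2 = 1) by (rewrite <- Cmod2_alt, Hw; ring).
assert (Hx : -1 <= Re w <= 1).
{ pose proof (re_le_Cmod w) as Q. rewrite Hw in Q. apply Rabs_le_between in Q. lra. }
pose proof (acos_bound (Re w)) as Hb.
assert (Hs : sin (acos (Re w)) = Rabs (Im w)).
{ rewrite sin_acos by auto. replace (1 - (Re w)²) with ((Im w)²) by (unfold Rsqr; nra).
  apply sqrt_Rsqr_abs. }
destruct (Rle_dec 0 (Im w)) as [P|P].
- exists (acos (Re w)). split; [lra|]. unfold cis. rewrite cos_acos, Hs, Rabs_pos_eq by auto.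
  apply surjective_pairing.
- exists (- acos (Re w)). split; [lra|]. unfold cis.
  rewrite cos_neg, sin_neg, cos_acos, Hs, Rabs_left by lra.
  rewrite Ropp_involutive. apply surjective_pairing.
Qed.

Lemma circ_surj (r : R) (w : C) : 0 < r -> Cmod w = r -> exists t, - PI <= t <= PI /\ w = circ r t.
Proof.
intros Hr Hw. destruct (cis_surj (RtoC (/ r) * w)%C) as [t [Ht E]].
- assert (0 < / r) by (apply Rinv_0_lt_compat; auto).
  rewrite Cmod_mult, Cmod_R, Hw, Rabs_pos_eq by lra. field; lra.
- exists t. split; auto. unfold circ. rewrite <- E.
  replace (RtoC r * (RtoC (/ r) * w))%C with (RtoC r * RtoC (/ r) * w)%C by ring.
  rewrite <- RtoC_mult. replace (r * / r) with 1 by (field; lra). ring.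
Qed.

Lemma bounded_2d (f : R -> R -> R) (a : R) : 0 < a ->
  (forall x y, continuity_2d_pt f x y) ->
  exists B, forall x y, - a <= x <= a -> - a <= y <= a -> Rabs (f x y) <= B.
Proof.
intros Ha Hf.
destruct (uniform_continuity_2d f (- a) a (- a) a ltac:(intros; apply Hf) (mkposreal 1 Rlt_0_1))
  as [d Hd]. simpl in Hd.
destruct (nfloor_ex (a / d)) as [N HN].
{ apply Rdiv_le_0_compat; [lra|apply cond_pos]. }
(* Walk from the origin to (x, y) in M steps, on each of which f varies by less than 1. *)
set (M := S N).
assert (HM : a / INR M < d).
{ unfold M. rewrite S_INR. pose proof (cond_pos d). pose proof (pos_INR N).
  apply Rmult_lt_reg_r with (INR N + 1); [lra|].
  unfold Rdiv. rewrite Rmult_assoc, Rinv_l, Rmult_1_r by lra.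
  destruct HN as [_ HN]. apply Rmult_lt_compat_r with (r := d) in HN; auto.
  unfold Rdiv in HN. rewrite Rmult_assoc, Rinv_l, Rmult_1_r in HN; lra. }
assert (HM0 : 0 < INR M) by (apply lt_0_INR; unfold M; lia).
exists (Rabs (f 0 0) + INR M). intros x y Hx Hy.
assert (Hk : forall k, (k <= M)%nat ->
  Rabs (f (INR k * (x / INR M)) (INR k * (y / INR M))) <= Rabs (f 0 0) + INR k).
{ assert (Hin : forall k u, (k <= M)%nat -> - a <= u <= a -> - a <= INR k * (u / INR M) <= a).
  { intros k u Hk Hu.
    assert (0 <= INR k / INR M <= 1).
    { split; [apply Rdiv_le_0_compat; auto; apply pos_INR|].
      apply Rmult_le_reg_r with (INR M); auto. unfold Rdiv.
      rewrite Rmult_assoc, Rinv_l, Rmult_1_r, Rmult_1_l by lra. apply le_INR; auto. }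
    replace (INR k * (u / INR M)) with (INR k / INR M * u) by (field; lra). nra. }
  assert (Hst : forall k u, - a <= u <= a ->
    Rabs (INR (S k) * (u / INR M) - INR k * (u / INR M)) < d).
  { intros k u Hu. rewrite S_INR.
    replace ((INR k + 1) * (u / INR M) - INR k * (u / INR M)) with (u / INR M) by ring.
    unfold Rdiv. rewrite Rabs_mult, (Rabs_pos_eq (/ INR M)).
    2: { apply Rlt_le, Rinv_0_lt_compat; auto. }
    eapply Rle_lt_trans; [|apply HM]. apply Rmult_le_compat_r.
    - apply Rlt_le, Rinv_0_lt_compat; auto.
    - apply Rabs_le; auto. }
  induction k as [|k IH]; intros Hk.
  - simpl. rewrite !Rmult_0_l. lra.
  - specialize (IH ltac:(lia)).
    assert (G := Hd _ _ _ _ (Hin k x ltac:(lia) Hx) (Hin k y ltac:(lia) Hy)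
      (Hin (S k) x Hk Hx) (Hin (S k) y Hk Hy) (Hst k x Hx) (Hst k y Hy)).
    rewrite S_INR in *.
    match goal with |- Rabs ?p <= _ =>
      match type of G with Rabs (_ - ?q) < _ => replace p with ((p - q) + q) by ring end end.
    eapply Rle_trans; [apply Rabs_triang|]. lra. }
specialize (Hk M (Nat.le_refl M)).
replace (INR M * (x / INR M)) with x in Hk by (field; lra).
replace (INR M * (y / INR M)) with y in Hk by (field; lra). exact Hk.
Qed.

Section Kernel.
Variable l : nat -> C.
Hypothesis Hl : radius_ge l 1.
Hypothesis Hl0 : l O = RtoC 0.
Hypothesis Hinj : forall z w, Cmod z < 1 -> Cmod w < 1 ->
  (z * Cexp (pser l z) = w * Cexp (pser l w))%C -> z = w.

(** With L = pser l and f(z) = z exp(L(z)), this is z / f(z). *)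
Definition einv (z : C) : C := Cexp (- pser l z).

(** The divided difference of exp(- L), in a form that is regular on the diagonal. *)
Definition einv_dq (z0 z : C) : C :=
  (- (einv z0 * dq l z0 z * Cexp1 (- (pser l z - pser l z0))))%C.

(** Equal to (1/f(z) - 1/f(z0)) / (1/z - 1/z0) and extended to the diagonal and to the axes: the
    kernel of the Grunsky coefficients, nonvanishing exactly because f is injective. *)
Definition qker (z0 z : C) : C := (einv z - z * einv_dq z0 z)%C.

Lemma holo_einv (n : nat) : holo n (Cdisc 1) einv.
Proof.
apply (holo_comp n (Cdisc 1) (fun _ => True) Cexp (fun z => - pser l z)%C); auto.
- apply holo_Cexp.
- apply holo_opp, holo_pser; auto.
Qed.

Lemma einv_0 : einv (RtoC 0) = RtoC 1.
Proof.
unfold einv. rewrite pser_0, Hl0. replace (- RtoC 0)%C with (RtoC 0); [apply Cexp_0|].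
apply injective_projections; simpl; ring.
Qed.

Lemma einv_dq_spec (z0 z : C) : Cmod z0 < 1 -> Cmod z < 1 ->
  ((z - z0) * einv_dq z0 z = einv z - einv z0)%C.
Proof.
intros H0 Hz. unfold einv_dq.
assert (H1 := dq_spec l 1 z0 z Hl H0 Hz).
set (t := (- (pser l z - pser l z0))%C).
replace ((z - z0) * - (einv z0 * dq l z0 z * Cexp1 t))%C with
  (einv z0 * (- ((z - z0) * dq l z0 z) * Cexp1 t))%C by ring.
rewrite H1. fold t. rewrite Cexp1_spec.
replace (einv z) with (einv z0 * Cexp t)%C; [ring|].
unfold einv. rewrite <- Cexp_plus. f_equal. unfold t. ring.
Qed.

Lemma qker_spec (z0 z : C) : Cmod z0 < 1 -> Cmod z < 1 ->
  ((z0 - z) * qker z0 z = z0 * einv z - z * einv z0)%C.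
Proof.
intros H0 Hz. unfold qker.
replace ((z0 - z) * (einv z - z * einv_dq z0 z))%C with
  ((z0 - z) * einv z + z * ((z - z0) * einv_dq z0 z))%C by ring.
rewrite einv_dq_spec by auto. ring.
Qed.

Lemma holo_einv_dq (n : nat) (z0 : C) : Cmod z0 < 1 -> holo n (Cdisc 1) (einv_dq z0).
Proof.
intros H0. apply holo_opp. apply holo_mult.
- apply holo_mult; [apply holo_const|]. apply holo_pser. apply radius_ge_dqcoef; auto.
- apply (holo_comp n (Cdisc 1) (fun _ => True) Cexp1 (fun z => - (pser l z - pser l z0))%C); auto.
  + apply holo_Cexp1.
  + apply holo_opp. apply (holo_plus n (Cdisc 1) (pser l) (fun _ => - pser l z0)%C).
    * apply holo_pser; auto.
    * apply holo_const.
Qed.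

Lemma holo_qker (n : nat) (z0 : C) : Cmod z0 < 1 -> holo n (Cdisc 1) (qker z0).
Proof.
intros H0.
apply (holo_plus n (Cdisc 1) einv (fun z => - (z * einv_dq z0 z))%C); [apply holo_einv|].
apply holo_opp. apply holo_mult; [apply holo_id|apply holo_einv_dq; auto].
Qed.

Lemma qker_0_r (z0 : C) : qker z0 (RtoC 0) = RtoC 1.
Proof. unfold qker. rewrite einv_0. ring. Qed.

Lemma inj_einv (z w : C) : Cmod z < 1 -> Cmod w < 1 ->
  (w * einv z = z * einv w)%C -> z = w.
Proof.
intros Hz Hw H. apply Hinj; auto.
assert (E1 := Cexp_opp (pser l z)). assert (E2 := Cexp_opp (pser l w)).
fold (einv z) in E1. fold (einv w) in E2.
replace (z * Cexp (pser l z))%C with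
  (Cexp (pser l z) * Cexp (pser l w) * (z * einv w))%C.
2: { replace (Cexp (pser l z) * Cexp (pser l w) * (z * einv w))%C with
       (z * Cexp (pser l z) * (Cexp (pser l w) * einv w))%C by ring. rewrite E2; ring. }
rewrite <- H.
replace (Cexp (pser l z) * Cexp (pser l w) * (w * einv z))%C with
  (w * Cexp (pser l w) * (Cexp (pser l z) * einv z))%C by ring.
rewrite E1; ring.
Qed.

Lemma qker_neq_0_off (z0 z : C) : Cmod z0 < 1 -> Cmod z < 1 -> z <> z0 ->
  qker z0 z <> RtoC 0.
Proof.
intros H0 Hz N E. apply N. apply inj_einv; auto.
assert (H := qker_spec z0 z H0 Hz). rewrite E in H.
replace ((z0 - z) * RtoC 0)%C with (RtoC 0) in H by ring.
replace (z0 * einv z)%C with ((z0 * einv z - z * einv z0) + z * einv z0)%C by ring.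
rewrite <- H. ring.
Qed.

Lemma pser_l_continuous (z : C) : Cmod z < 1 -> continuous (pser l) z.
Proof. intros Hz. apply holo_continuous with (Cdisc 1); auto. apply holo_pser; auto. Qed.

Lemma einv_continuous (z : C) : Cmod z < 1 -> continuous einv z.
Proof. intros Hz. apply holo_continuous with (Cdisc 1); auto. apply holo_einv; auto. Qed.

Lemma cont2_qker (P Q : R -> R -> C) (x y : R) :
  Cmod (P x y) < 1 -> Cmod (Q x y) < 1 -> cont2 P x y -> cont2 Q x y ->
  cont2 (fun u v => qker (P u v) (Q u v)) x y.
Proof.
intros HP HQ cP cQ. unfold qker.
apply cont2_plus; [apply (cont2_comp einv Q); auto; apply einv_continuous; auto|].
apply cont2_opp, cont2_mult; auto. unfold einv_dq. apply cont2_opp.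
apply cont2_mult; [apply cont2_mult|].
- apply (cont2_comp einv P); auto; apply einv_continuous; auto.
- intros eps Heps. destruct (dq_continuous l 1 _ _ Hl HP HQ eps Heps) as [d [Hd H]].
  destruct (cP d Hd) as [d1 [Hd1 H1]]. destruct (cQ d Hd) as [d2 [Hd2 H2]].
  exists (Rmin d1 d2). split; [apply Rmin_glb_lt; auto|]. intros u v Hu Hv.
  assert (L1 := Rmin_l d1 d2). assert (L2 := Rmin_r d1 d2).
  apply H; [apply H1|apply H2]; lra.
- apply (cont2_comp Cexp1 (fun u v => - (pser l (Q u v) - pser l (P u v)))%C).
  + eapply is_derive_continuous_C. apply is_derive_Cexp1.
  + apply cont2_opp. apply cont2_plus; [|apply cont2_opp].
    * apply (cont2_comp (pser l) Q); auto. apply pser_l_continuous; auto.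
    * apply (cont2_comp (pser l) P); auto. apply pser_l_continuous; auto.
Qed.

Lemma is_derive_einv (z : C) : Cmod z < 1 -> is_derive einv z (einv_dq z z).
Proof.
intros Hz. apply (is_derive_of_quotient einv (einv_dq z) z (1 - Cmod z)); [lra| |].
- intros w Hw. apply einv_dq_spec; auto.
  replace w with ((w - z) + z)%C by ring. eapply Rle_lt_trans; [apply Cmod_triangle|]. lra.
- apply holo_continuous with (Cdisc 1); auto. apply holo_einv_dq; auto.
Qed.

Lemma qker_continuous_l (z : C) : Cmod z < 1 -> forall eps, 0 < eps ->
  exists d, 0 < d /\ forall w, Cmod (w - z) < d -> Cmod (qker w z - qker z z) < eps.
Proof.
intros Hz eps Heps.
(* Symmetry of the divided difference of l makes w the variable of a power series. *)
set (h := fun w => (einv z - z * - (einv w * dq l z w * Cexp1 (- (pser l z - pser l w))))%C).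
assert (Hh : continuous h z).
{ apply holo_continuous with (Cdisc 1); auto. unfold h.
  apply (holo_plus 1 (Cdisc 1) (fun _ => einv z) (fun w => - (z * - (einv w * dq l z w *
     Cexp1 (- (pser l z - pser l w)))))%C); [apply holo_const|].
  apply holo_opp. apply holo_mult; [apply holo_const|]. apply holo_opp.
  apply holo_mult; [apply holo_mult|].
  - apply holo_einv.
  - apply holo_pser, radius_ge_dqcoef; auto.
  - apply (holo_comp 1 (Cdisc 1) (fun _ => True) Cexp1 (fun w => - (pser l z - pser l w))%C); auto.
    + apply holo_Cexp1.
    + apply holo_opp. apply (holo_plus 1 (Cdisc 1) (fun _ => pser l z) (fun w => - pser l w)%C).
      * apply holo_const.
      * apply holo_opp, holo_pser; auto. }
destruct (proj1 (continuous_C_eps h z) Hh eps Heps) as [d [Hd H]].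
exists (Rmin d (1 - Cmod z)). split; [apply Rmin_glb_lt; lra|]. intros w Hw.
assert (H1 : Cmod (w - z) < d) by (eapply Rlt_le_trans; [apply Hw|apply Rmin_l]).
assert (H2 : Cmod (w - z) < 1 - Cmod z) by (eapply Rlt_le_trans; [apply Hw|apply Rmin_r]).
assert (Hw1 : Cmod w < 1).
{ replace w with ((w - z) + z)%C by ring. eapply Rle_lt_trans; [apply Cmod_triangle|]. lra. }
assert (E : forall w, Cmod w < 1 -> qker w z = h w).
{ intros w' Hw'. unfold qker, einv_dq, h. rewrite (dq_sym l 1 w' z); auto. }
rewrite !E by auto. apply H; auto.
Qed.

(** On the diagonal the kernel is - z^2 (1/f)'(z), so this says that the derivative of an
    injective function has no zero. If qker z0 z0 = 0, take w near z0. If qker w w is not zero,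
    then qker w has no zero in the disc, so its modulus at z0 is at least its minimum on a
    fixed circle around z0, which stays away from 0, whereas qker w z0 tends to qker z0 z0 = 0.
    Hence qker w w = 0 for all w near z0, and f is constant there. *)
Lemma qker_neq_0_diag (z0 : C) : Cmod z0 < 1 -> qker z0 z0 <> RtoC 0.
Proof.
intros H0 E0.
assert (Hz0 : z0 <> RtoC 0).
{ intros E. rewrite E, qker_0_r in E0. apply RtoC_inj in E0. lra. }
set (rad := 1 - Cmod z0). set (s := rad / 2).
assert (Hs : 0 < s < rad) by (unfold s, rad; lra).
assert (Hdisc : forall z, Cmod (z - z0) < rad -> Cmod z < 1).
{ intros z Hz. replace z with ((z - z0) + z0)%C by ring.
  eapply Rle_lt_trans; [apply Cmod_triangle|]. unfold rad in Hz; lra. }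
set (zc := fun x => (z0 + circ s x)%C).
assert (Hzc : forall x, Cmod (zc x - z0) = s).
{ intros x. unfold zc. replace (z0 + circ s x - z0)%C with (circ s x) by ring.
  apply Cmod_circ; lra. }
assert (Hzc1 : forall x, Cmod (zc x) < 1) by (intros x; apply Hdisc; rewrite Hzc; lra).
assert (Hsurj : forall z, Cmod (z - z0) = s -> exists x, - PI <= x <= PI /\ z = zc x).
{ intros z Hz. destruct (circ_surj s (z - z0) ltac:(lra) Hz) as [x [Hx E]].
  exists x. split; auto. unfold zc. rewrite <- E. ring. }
assert (czc : forall x y, cont2 (fun u _ => zc u) x y).
{ intros x y. apply cont2_plus; [apply cont2_const|].
  apply cont2_mult; [apply cont2_const|apply cont2_cis1]. }
assert (HPI := PI_RGT_0).
(* On the circle the numerator (z0 - z) qker z0 z is bounded below, and it is the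
   numerator, not the kernel, that is compared with its value at nearby base points w. *)
set (F := fun x : R => (z0 * einv (zc x) - zc x * einv z0)%C).
assert (cF : forall x y, cont2 (fun u _ => F u) x y).
{ intros x y. apply cont2_plus.
  - apply cont2_mult; [apply cont2_const|].
    apply (cont2_comp einv (fun u _ => zc u)); auto. apply einv_continuous; auto.
  - apply cont2_opp, cont2_mult; auto. apply cont2_const. }
assert (HF : forall x, 0 < Csq (F x)).
{ intros x. apply Csq_pos. intros E. assert (G : zc x = z0).
  { apply inj_einv; auto. unfold F in E.
    replace (z0 * einv (zc x))%C with ((z0 * einv (zc x) - zc x * einv z0) + zc x * einv z0)%C
      by ring. rewrite E. ring. }
  specialize (Hzc x). rewrite G in Hzc. replace (z0 - z0)%C with (RtoC 0) in Hzc by ring.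
  rewrite Cmod_0 in Hzc. lra. }
destruct (bounded_2d (fun u _ => ln (Csq (F u))) PI HPI) as [B HB].
{ intros x y. apply (continuity_1d_2d_pt_comp ln (fun u _ => Csq (F u))).
  - apply derivable_continuous_pt. exists (/ Csq (F x)). apply derivable_pt_lim_ln; auto.
  - destruct (proj1 (cont2_parts _ _ _) (cF x y)) as [c1 c2]. unfold Csq.
    apply (continuity_2d_pt_ext (fun u v => Re (F u) * Re (F u) + Im (F u) * Im (F u))).
    { intros; ring. }
    apply (continuity_2d_pt_plus (fun u _ => Re (F u) * Re (F u)) (fun u _ => Im (F u) * Im (F u)));
      apply continuity_2d_pt_mult; auto. }
set (m2 := exp (- B)).
assert (Hm2 : forall x, - PI <= x <= PI -> m2 <= Csq (F x)).
{ intros x Hx. specialize (HB x 0 Hx ltac:(lra)). apply Rabs_le_between in HB.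
  unfold m2. rewrite <- (exp_ln (Csq (F x))) by auto.
  destruct (proj1 HB) as [Q|Q]; [left; apply exp_increasing; auto|rewrite Q; lra]. }
set (m0 := sqrt m2).
assert (Hm0 : 0 < m0) by (apply sqrt_lt_R0, exp_pos).
assert (HFm : forall x, - PI <= x <= PI -> m0 <= Cmod (F x)).
{ intros x Hx. unfold m0. rewrite <- (sqrt_pow2 (Cmod (F x))) by apply Cmod_ge_0.
  rewrite <- Csq_Cmod. apply sqrt_le_1_alt. auto. }
destruct (bounded_2d (fun u _ => Csq (einv (zc u))) PI HPI) as [Eb HEb].
{ intros x y.
  assert (ce : cont2 (fun u _ => einv (zc u)) x y).
  { apply (cont2_comp einv (fun u _ => zc u)); auto. apply einv_continuous; auto. }
  destruct (proj1 (cont2_parts _ _ _) ce) as [c1 c2]. unfold Csq.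
  apply (continuity_2d_pt_ext (fun u v => Re (einv (zc u)) * Re (einv (zc u)) +
    Im (einv (zc u)) * Im (einv (zc u)))).
  { intros; ring. }
  apply (continuity_2d_pt_plus (fun u _ => Re (einv (zc u)) * Re (einv (zc u)))
    (fun u _ => Im (einv (zc u)) * Im (einv (zc u))));
      apply continuity_2d_pt_mult; auto. }
assert (HEb0 : 0 <= Eb) by (eapply Rle_trans; [apply Rabs_pos|apply (HEb 0 0); lra]).
set (E1 := Eb + 1).
assert (HE1 : forall x, - PI <= x <= PI -> Cmod (einv (zc x)) <= E1).
{ intros x Hx. specialize (HEb x 0 Hx ltac:(lra)). rewrite Csq_Cmod in HEb.
  rewrite Rabs_pos_eq in HEb by (apply pow_le, Cmod_ge_0).
  unfold E1. pose proof (Cmod_ge_0 (einv (zc x))). nra. }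
destruct (proj1 (continuous_C_eps einv z0) (einv_continuous z0 H0) (m0 / 4) ltac:(lra))
  as [d1 [Hd1 Hc1]].
destruct (qker_continuous_l z0 H0 (m0 / 4) ltac:(lra)) as [d2 [Hd2 Hc2]].
set (d := Rmin (Rmin d1 d2) (Rmin rad (m0 / (4 * E1)))).
assert (Hd : 0 < d).
{ repeat apply Rmin_glb_lt; auto; [unfold rad; lra|].
  apply Rdiv_lt_0_compat; unfold E1; lra. }
assert (Hzero : forall w, Cmod (w - z0) < d -> qker w w = RtoC 0).
{ intros w Hw.
  assert (L1 : Cmod (w - z0) < d1).
  { eapply Rlt_le_trans; [apply Hw|]. eapply Rle_trans; [apply Rmin_l|apply Rmin_l]. }
  assert (L2 : Cmod (w - z0) < d2).
  { eapply Rlt_le_trans; [apply Hw|]. eapply Rle_trans; [apply Rmin_l|apply Rmin_r]. }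
  assert (L3 : Cmod (w - z0) < rad).
  { eapply Rlt_le_trans; [apply Hw|]. eapply Rle_trans; [apply Rmin_r|apply Rmin_l]. }
  assert (L4 : Cmod (w - z0) < m0 / (4 * E1)).
  { eapply Rlt_le_trans; [apply Hw|]. eapply Rle_trans; [apply Rmin_r|apply Rmin_r]. }
  assert (Hw1 : Cmod w < 1) by (apply Hdisc; auto).
  destruct (Ceq_dec (qker w w) (RtoC 0)) as [E|N]; auto. exfalso.
  assert (Hq : m0 / 4 <= Cmod (qker w z0)).
  { apply (min_modulus (qker w) z0 s rad (m0 / 4)); auto; try lra.
    - apply holo_sub with (Cdisc 1); [intros z Hz; apply Hdisc; auto|apply holo_qker; auto].
    - intros z Hz. destruct (Ceq_dec z w) as [E|N']; [rewrite E; auto|].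
      apply qker_neq_0_off; auto.
    - intros z Hz. destruct (Hsurj z Hz) as [x [Hx E]]. subst z.
      assert (Hs1 := qker_spec w (zc x) Hw1 (Hzc1 x)).
      assert (Hlow : m0 / 2 <= Cmod (w * einv (zc x) - zc x * einv w)).
      { specialize (HFm x Hx). specialize (HE1 x Hx). specialize (Hc1 w L1). specialize (Hzc1 x).
        assert (T : Cmod (F x) <= Cmod (w * einv (zc x) - zc x * einv w) +
            (Cmod (w - z0) * Cmod (einv (zc x)) + Cmod (zc x) * Cmod (einv w - einv z0))).
        { rewrite <- !Cmod_mult.
          replace (F x) with ((w * einv (zc x) - zc x * einv w) +
            (- ((w - z0) * einv (zc x)) + zc x * (einv w - einv z0)))%C by (unfold F; ring).
          eapply Rle_trans; [apply Cmod_triangle|]. apply Rplus_le_compat_l.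
          eapply Rle_trans; [apply Cmod_triangle|]. rewrite Cmod_opp. lra. }
        assert (T1 : Cmod (w - z0) * Cmod (einv (zc x)) <= m0 / 4).
        { apply Rle_trans with (m0 / (4 * E1) * E1).
          - apply Rmult_le_compat; try apply Cmod_ge_0; lra.
          - right. field. unfold E1; lra. }
        assert (T2 : Cmod (zc x) * Cmod (einv w - einv z0) <= 1 * (m0 / 4)).
        { apply Rmult_le_compat; try apply Cmod_ge_0; lra. }
        lra. }
      rewrite <- Hs1, Cmod_mult in Hlow.
      assert (Hd3 : Cmod (w - zc x) <= 2).
      { unfold Cminus. eapply Rle_trans; [apply Cmod_triangle|]. rewrite Cmod_opp.
        specialize (Hzc1 x). lra. }
      pose proof (Cmod_ge_0 (qker w (zc x))). nra. }
  specialize (Hc2 w L2). rewrite E0 in Hc2.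
  replace (qker w z0 - RtoC 0)%C with (qker w z0) in Hc2 by ring. lra. }
(* The derivative of 1 / f = einv z / z is - qker z z / z^2, so 1 / f would be
   constant near z0. *)
set (d' := Rmin d (Rmin rad (Cmod z0))).
assert (Hd' : 0 < d').
{ apply Rmin_glb_lt; auto. apply Rmin_glb_lt; [unfold rad; lra|]. apply Cmod_gt_0; auto. }
assert (Hn0 : forall w, Cmod (w - z0) < d' -> w <> RtoC 0 /\ Cmod w < 1 /\ qker w w = RtoC 0).
{ intros w Hw.
  assert (L1 : Cmod (w - z0) < d) by (eapply Rlt_le_trans; [apply Hw|apply Rmin_l]).
  assert (L2 : Cmod (w - z0) < rad).
  { eapply Rlt_le_trans; [apply Hw|]. eapply Rle_trans; [apply Rmin_r|apply Rmin_l]. }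
  assert (L3 : Cmod (w - z0) < Cmod z0).
  { eapply Rlt_le_trans; [apply Hw|]. eapply Rle_trans; [apply Rmin_r|apply Rmin_r]. }
  split; [|split; auto]. intros E. subst w.
  replace (RtoC 0 - z0)%C with (- z0)%C in L3 by ring. rewrite Cmod_opp in L3. lra. }
set (g := fun w => (einv w * / w)%C).
assert (Hg : forall w, Cmod (w - z0) < d' -> g w = g z0).
{ apply zero_derive_constant. intros w Hw. destruct (Hn0 w Hw) as [N [Hw1 Hq]].
  eapply is_derive_C_eq.
  - apply is_derive_C_mult; [apply is_derive_einv; auto|apply is_derive_C_inv_id; auto].
  - unfold qker in Hq.
    replace (einv_dq w w * / w + einv w * - (/ w * / w))%C with
      (- (einv w - w * einv_dq w w) * (/ w * / w))%C by (field; auto).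
    rewrite Hq. ring. }
set (w := (z0 + RtoC (d' / 2))%C).
assert (Hw : Cmod (w - z0) = d' / 2).
{ unfold w. replace (z0 + RtoC (d' / 2) - z0)%C with (RtoC (d' / 2)) by ring.
  rewrite Cmod_R, Rabs_pos_eq; lra. }
destruct (Hn0 w ltac:(lra)) as [N [Hw1 _]].
assert (Ew : w = z0).
{ apply inj_einv; auto. specialize (Hg w ltac:(lra)). unfold g in Hg.
  replace (z0 * einv w)%C with (z0 * w * (einv w * / w))%C by (field; auto).
  rewrite Hg. field; auto. }
rewrite Ew in Hw. replace (z0 - z0)%C with (RtoC 0) in Hw by ring. rewrite Cmod_0 in Hw. lra.
Qed.

Lemma qker_neq_0 (z0 z : C) : Cmod z0 < 1 -> Cmod z < 1 -> qker z0 z <> RtoC 0.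
Proof.
intros H0 Hz. destruct (Ceq_dec z z0) as [E|N].
- rewrite E. apply qker_neq_0_diag; auto.
- apply qker_neq_0_off; auto.
Qed.

End Kernel.

(** * The bound on the coefficient of z in 1/f *)

Lemma cis_minus_Csq (s t : R) : Csq (RtoC 1 - RtoC s * cis t) = 1 + s ^ 2 - 2 * s * cos t.
Proof.
unfold Csq, cis, Cminus, Cplus, Copp, Cmult, RtoC, Re, Im; simpl.
pose proof (sin2_cos2 t) as S. unfold Rsqr in S.
transitivity (1 - 2 * s * cos t + s * s * (sin t * sin t + cos t * cos t)); [ring|].
rewrite S; ring.
Qed.

Lemma pint_cos (alpha : R) : pint (fun x => cos (x - alpha)) = 0.
Proof.
apply (RInt_derive_periodic (fun x => sin (x - alpha))).
- intros x. auto_derive; auto; unfold Rminus; eqR; ring.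
- intros x. apply (ex_derive_continuous (K := R_AbsRing) (V := R_NormedModule)). auto_derive; auto.
- replace (2 * PI - alpha) with ((0 - alpha) + 2 * PI) by ring.
  rewrite sin_plus, sin_2PI, cos_2PI. ring.
Qed.

Lemma contR_cos (alpha : R) : contR (fun x => cos (x - alpha)).
Proof.
intros x. apply (ex_derive_continuous (K := R_AbsRing) (V := R_NormedModule)). auto_derive; auto.
Qed.

Lemma pint_cos2 (alpha : R) : pint (fun x => cos (x - alpha) * cos (x - alpha)) = PI.
Proof.
assert (H := cos_moment_Re (fun z => cis (- alpha) * z)%C (fun _ => cis (- alpha)) 2 1 alpha).
cbv beta in H. rewrite <- cis_plus in H. replace (alpha + - alpha) with 0 in H by ring.
rewrite cis_0 in H. unfold pint.
rewrite (RInt_ext _ (fun x => Re (cis (- alpha) * circ 1 x)%C * cos (x - alpha))).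
- rewrite H.
  + simpl. ring.
  + intros z _. eapply is_derive_C_eq.
    * apply is_derive_C_mult; [apply is_derive_C_const|apply is_derive_C_id].
    * cbv beta; ring.
  + apply holo_const.
  + lra.
- intros x _. f_equal. unfold circ.
  replace (cis (- alpha) * (RtoC 1 * cis x))%C with (cis (x - alpha)); [reflexivity|].
  unfold Rminus. rewrite cis_plus. ring.
Qed.

(** The inequality ln (1 + q) <= q, arranged so that the right-hand side becomes a
    Poisson kernel. *)
Lemma ln_diff_bound (D eta2 a T : R) : 0 <= D -> 0 < eta2 -> eta2 <= a <= T * eta2 ->
  0 <= ln (D + a) - ln (D + eta2) <= T * (eta2 / (D + eta2)).
Proof.
intros HD He Ha. split.
- destruct (proj1 Ha) as [Q|Q]; [|rewrite Q; lra].
  assert (ln (D + eta2) < ln (D + a)) by (apply ln_increasing; lra). lra.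
- rewrite <- ln_div by lra.
  replace ((D + a) / (D + eta2)) with (1 + (a - eta2) / (D + eta2)) by (field; lra).
  set (q := (a - eta2) / (D + eta2)).
  assert (Hq0 : 0 <= q) by (apply Rdiv_le_0_compat; lra).
  assert (Hq : q <= T * (eta2 / (D + eta2))).
  { replace (T * (eta2 / (D + eta2))) with (T * eta2 / (D + eta2)) by (field; lra).
    apply Rmult_le_compat_r; [apply Rlt_le, Rinv_0_lt_compat; lra|lra]. }
  eapply Rle_trans; [|apply Hq].
  destruct Hq0 as [Q|Q].
  + apply Rlt_le. rewrite <- (ln_exp q) at 2. apply ln_increasing; [lra|].
    apply exp_ineq1. lra.
  + rewrite <- Q, Rplus_0_r, ln_1. lra.
Qed.

Lemma contR_parts (F : R -> C) : (forall x, cont2 (fun u _ => F u) x 0) ->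
  contR (fun x => Re (F x)) /\ contR (fun x => Im (F x)).
Proof.
intros H. split; intros x; destruct (proj1 (cont2_parts _ _ _) (H x)) as [A B];
apply continuity_pt_filterlim; intros eps Heps.
- destruct (A (mkposreal eps Heps)) as [d Hd]. exists d. split; [apply cond_pos|].
  intros t [_ Ht]. apply (Hd t 0); auto. rewrite Rminus_diag, Rabs_R0. apply cond_pos.
- destruct (B (mkposreal eps Heps)) as [d Hd]. exists d. split; [apply cond_pos|].
  intros t [_ Ht]. apply (Hd t 0); auto. rewrite Rminus_diag, Rabs_R0. apply cond_pos.
Qed.

Lemma circ_neq_0 (r x : R) : 0 < r -> circ r x <> RtoC 0.
Proof. intros Hr. apply Cmod_gt_0. rewrite Cmod_circ; lra. Qed.

Lemma Csq_circ_minus (r x y : R) : Csq (circ r y - circ r x)%C = r ^ 2 * (2 - 2 * cos (x - y)).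
Proof.
unfold circ. rewrite cos_minus. unfold Csq, cis, Cminus, Cplus, Copp, Cmult, RtoC, Re, Im; simpl.
pose proof (sin2_cos2 x) as Sx. pose proof (sin2_cos2 y) as Sy. unfold Rsqr in *.
transitivity (r * r * ((sin x * sin x + cos x * cos x) + (sin y * sin y + cos y * cos y)
  - 2 * (cos x * cos y + sin x * sin y))); [ring|]. rewrite Sx, Sy. ring.
Qed.

Section Core.
Variable l : nat -> C.
Hypothesis Hl : radius_ge l 1.
Hypothesis Hl0 : l O = RtoC 0.
Hypothesis Hinj : forall z w, Cmod z < 1 -> Cmod w < 1 ->
  (z * Cexp (pser l z) = w * Cexp (pser l w))%C -> z = w.

Lemma is_derive_einv_0 : is_derive (einv l) (RtoC 0) (- l 1%nat)%C.
Proof.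
assert (Cmod (RtoC 0) < 1) by (rewrite Cmod_0; lra).
eapply is_derive_C_eq.
- apply (is_derive_C_comp Cexp (fun z => - pser l z)%C); [apply is_derive_Cexp|].
  apply (is_derive_opp (K := C_AbsRing) (V := C_NormedModule)).
  apply is_derive_pser with 1; auto.
- rewrite !pser_0, Hl0. unfold dcoef. simpl INR.
  replace (- RtoC 0)%C with (RtoC 0) by (apply injective_projections; simpl; ring).
  rewrite Cexp_0. change (opp (RtoC 1 * l 1%nat)%C * RtoC 1 = - l 1%nat)%C.
  change (opp (RtoC 1 * l 1%nat)%C) with (- (RtoC 1 * l 1%nat))%C. ring.
Qed.

Lemma einv_dq_0_sym (z : C) : Cmod z < 1 -> einv_dq l z (RtoC 0) = einv_dq l (RtoC 0) z.
Proof.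
intros Hz. destruct (Ceq_dec z (RtoC 0)) as [E|N]; [rewrite E; auto|].
assert (H0 : Cmod (RtoC 0) < 1) by (rewrite Cmod_0; lra).
assert (H1 := einv_dq_spec l Hl z (RtoC 0) Hz H0).
assert (H2 := einv_dq_spec l Hl (RtoC 0) z H0 Hz).
replace (einv_dq l z (RtoC 0)) with (- (/ z * ((RtoC 0 - z) * einv_dq l z (RtoC 0))))%C by (field; auto).
replace (einv_dq l (RtoC 0) z) with (/ z * ((z - RtoC 0) * einv_dq l (RtoC 0) z))%C by (field; auto).
rewrite H1, H2. ring.
Qed.

(** This is b_0 - (1/f(z0) - 1/z0), with b_0 = - l 1: as a function of z0 it vanishes at 0 and has
    derivative - recip_coef there. *)
Lemma is_derive_qker_0 (z0 : C) : Cmod z0 < 1 ->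
  is_derive (qker l z0) (RtoC 0) (- l 1%nat - einv_dq l (RtoC 0) z0)%C.
Proof.
intros H0. assert (Hz : Cmod (RtoC 0) < 1) by (rewrite Cmod_0; lra).
destruct (holo_einv_dq l Hl 1 z0 H0) as [f' [Hf' _]].
eapply is_derive_C_eq.
- apply (is_derive_plus (K := C_AbsRing) (V := C_NormedModule) (einv l) (fun z => - (z * einv_dq l z0 z))%C).
  + apply is_derive_einv_0.
  + apply (is_derive_opp (K := C_AbsRing) (V := C_NormedModule) (fun z => z * einv_dq l z0 z)%C).
    apply is_derive_C_mult; [apply is_derive_C_id|apply Hf'; auto].
- rewrite (einv_dq_0_sym z0) by auto.
  change (- l 1%nat + - (RtoC 1 * einv_dq l (RtoC 0) z0 + RtoC 0 * f' (RtoC 0)) =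
    - l 1%nat - einv_dq l (RtoC 0) z0)%C. ring.
Qed.

(** The coefficient of z in 1/f(z) = 1/z + b_0 + b_1 z + ..., that is a_2^2 - a_3. *)
Definition recip_coef : C := (RtoC (1 / 2) * (l 1%nat * l 1%nat) - l 2%nat)%C.

Lemma is_derive_einv_dq_0 : is_derive (einv_dq l (RtoC 0)) (RtoC 0) recip_coef.
Proof.
assert (Hz : Cmod (RtoC 0) < 1) by (rewrite Cmod_0; lra).
eapply is_derive_C_eq.
- apply (is_derive_opp (K := C_AbsRing) (V := C_NormedModule)
    (fun z => einv l (RtoC 0) * dq l (RtoC 0) z * Cexp1 (- (pser l z - pser l (RtoC 0))))%C).
  apply is_derive_C_mult.
  + apply is_derive_C_mult; [apply is_derive_C_const|].
    apply is_derive_pser with 1; auto. apply radius_ge_dqcoef; auto.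
  + apply (is_derive_C_comp Cexp1 (fun z => - (pser l z - pser l (RtoC 0)))%C).
    * apply is_derive_Cexp1.
    * apply (is_derive_opp (K := C_AbsRing) (V := C_NormedModule)
        (fun z => pser l z - pser l (RtoC 0))%C).
      apply (is_derive_C_plus (pser l) (fun _ => - pser l (RtoC 0))%C).
      -- apply is_derive_pser with 1; auto.
      -- apply is_derive_C_const.
- rewrite einv_0 by auto.
  replace (- (pser l (RtoC 0) - pser l (RtoC 0)))%C with (RtoC 0) by ring.
  rewrite Cexp1_deriv_0, Cexp1_0. unfold dq. rewrite !pser_0. unfold dcoef.
  unfold dqcoef. rewrite !pser_0. simpl INR. simpl Nat.add.
  match goal with |- opp ?a = _ => change (opp a) with (- a)%C end.
  match goal with |- context [opp ?a] => change (opp a) with (- a)%C end.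
  unfold recip_coef. ring.
Qed.

(** Compactness of the torus, applied to ln |qker|^2; both bounds come from one estimate. *)
Lemma qker_bounds (r : R) : 0 < r < 1 -> exists m M, 0 < m /\ m <= M /\
  forall x y, m <= Csq (qker l (circ r y) (circ r x)) <= M.
Proof.
intros Hr. pose proof PI_RGT_0 as HPI.
assert (Hc : forall x, Cmod (circ r x) < 1) by (intros; rewrite Cmod_circ; lra).
assert (Hpos : forall x y, 0 < Csq (qker l (circ r y) (circ r x))).
{ intros x y. apply Csq_pos. apply qker_neq_0; auto. }
destruct (bounded_2d (fun x y => ln (Csq (qker l (circ r y) (circ r x)))) PI HPI) as [B HB].
{ intros x y.
  assert (cq : cont2 (fun x y => qker l (circ r y) (circ r x)) x y).
  { apply (cont2_qker l Hl (fun _ y => circ r y) (fun x _ => circ r x)); auto.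
    - apply cont2_mult; [apply cont2_const|apply cont2_cis2].
    - apply cont2_mult; [apply cont2_const|apply cont2_cis1]. }
  apply (continuity_1d_2d_pt_comp ln (fun x y => Csq (qker l (circ r y) (circ r x)))).
  - apply derivable_continuous_pt. eexists. apply derivable_pt_lim_ln; auto.
  - destruct (proj1 (cont2_parts _ _ _) cq) as [c1 c2]. unfold Csq.
    apply (continuity_2d_pt_ext (fun x y =>
      Re (qker l (circ r y) (circ r x)) * Re (qker l (circ r y) (circ r x)) +
      Im (qker l (circ r y) (circ r x)) * Im (qker l (circ r y) (circ r x)))).
    { intros; ring. }
    apply continuity_2d_pt_plus; apply continuity_2d_pt_mult; auto. }
assert (HB0 : 0 <= B) by (eapply Rle_trans; [apply Rabs_pos|apply (HB 0 0); lra]).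
exists (exp (- B)), (exp B). split; [apply exp_pos|]. split.
{ destruct HB0 as [Q|Q]; [left; apply exp_increasing; lra|].
  rewrite <- Q, Ropp_0. lra. }
intros x y.
destruct (circ_surj r (circ r x) ltac:(lra) (Cmod_circ r x ltac:(lra))) as [x' [Hx' Ex]].
destruct (circ_surj r (circ r y) ltac:(lra) (Cmod_circ r y ltac:(lra))) as [y' [Hy' Ey]].
rewrite Ex, Ey. specialize (HB x' y' Hx' Hy'). apply Rabs_le_between in HB.
rewrite <- (exp_ln (Csq (qker l (circ r y') (circ r x')))) by auto.
assert (mono : forall a b, a <= b -> exp a <= exp b).
{ intros a b [Q|Q]; [left; apply exp_increasing; auto|rewrite Q; lra]. }
split; apply mono; lra.
Qed.

(** Apply energy_bound to W = 1/f on |z| = r with c = cos(x - alpha). The kernel is compared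
    with |qker|^2 (D + eta2): the moments of both factors are explicit, giving the terms
    r^2 Re(e^(2 i alpha) b_1) and s, and the error is at most T times a Poisson kernel of
    small mass. Letting s and then r tend to 1 gives |b_1| <= 1. *)
Lemma coefficient_estimate (r s alpha m M : R) : 0 < r < 1 -> 0 < s < 1 -> 0 < m -> m <= M ->
  (forall x y, m <= Csq (qker l (circ r y) (circ r x)) <= M) ->
  - (r ^ 2 * Re (cis (2 * alpha) * recip_coef)%C) <= s + 2 * (M / m) * (1 - s).
Proof.
intros Hr Hs Hm HmM Hq. pose proof PI_RGT_0 as HPI.
set (T := M / m).
(* This eta2 makes D + eta2 a multiple of |1 - s e^(i (x - y))|^2, where
   D = |1/z - 1/zeta|^2 for z = r e^(i x), zeta = r e^(i y). *)
set (eta2 := (1 - s) ^ 2 / (s * r ^ 2)).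
assert (Heta2 : 0 < eta2).
{ apply Rdiv_lt_0_compat; [apply pow_lt; lra|]. apply Rmult_lt_0_compat; [lra|apply pow_lt; lra]. }
(* With this A, |W x - W y|^2 + A = Q (D + A / Q) where Q = |qker|^2 lies in [m, M], and
   A / Q lies between eta2 and T eta2. *)
set (A := M * eta2).
assert (HA : 0 < A) by (apply Rmult_lt_0_compat; lra).
assert (Hcirc : forall x, Cmod (circ r x) < 1) by (intros; rewrite Cmod_circ; lra).
assert (Hc0 : forall x, circ r x <> RtoC 0) by (intros; apply circ_neq_0; lra).
set (W := fun x => (einv l (circ r x) * / circ r x)%C).
assert (cW : forall x y, cont2 (fun u _ => W u) x y).
{ intros x y.
  assert (cc : cont2 (fun u _ => circ r u) x y)
    by (apply cont2_mult; [apply cont2_const|apply cont2_cis1]).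
  apply cont2_mult.
  - apply (cont2_comp (einv l) (fun u _ => circ r u)); auto. apply einv_continuous; auto.
  - apply (cont2_comp (fun z => / z)%C (fun u _ => circ r u)); auto.
    eapply is_derive_continuous_C. apply is_derive_C_inv_id; auto. }
destruct (contR_parts W (fun x => cW x 0)) as [HWr HWi].
assert (HWB : exists B, forall x, Csq (W x) <= B).
{ destruct (bounded_2d (fun u _ => Csq (W u)) PI HPI) as [B HB].
  { intros x y. destruct (proj1 (cont2_parts _ _ _) (cW x y)) as [c1 c2]. unfold Csq.
    apply (continuity_2d_pt_ext (fun u v => Re (W u) * Re (W u) + Im (W u) * Im (W u))).
    { intros; ring. }
    apply (continuity_2d_pt_plus (fun u _ => Re (W u) * Re (W u)) (fun u _ => Im (W u) * Im (W u)));
      apply continuity_2d_pt_mult; auto. }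
  exists B. intros x.
  destruct (circ_surj r (circ r x) ltac:(lra) (Cmod_circ r x ltac:(lra))) as [x' [Hx' Ex]].
  replace (W x) with (W x') by (unfold W; rewrite Ex; auto).
  eapply Rle_trans; [apply Rle_abs|apply (HB x' 0)]; auto; lra. }
destruct HWB as [B HWB].
set (c := fun x => cos (x - alpha)).
assert (Hcc : contR c) by apply contR_cos.
set (D := fun x y => (2 - 2 * cos (x - y)) / r ^ 2).
assert (Hr2 : 0 < r ^ 2) by (apply pow_lt; lra).
assert (HD0 : forall x y, 0 <= D x y).
{ intros x y. apply Rdiv_le_0_compat; auto. pose proof (COS_bound (x - y)). lra. }
assert (HDeta : forall x y, D x y + eta2 =
   / (s * r ^ 2) * Csq (RtoC 1 - RtoC s * cis (x - y))).
{ intros x y. rewrite cis_minus_Csq. unfold D, eta2. field. lra. }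
assert (HWdiff : forall x y, Csq (W x - W y) = Csq (qker l (circ r y) (circ r x)) * D x y).
{ intros x y.
  assert (E : (W x - W y = (circ r y - circ r x) * qker l (circ r y) (circ r x) *
     / (circ r x * circ r y))%C).
  { rewrite qker_spec by auto. unfold W. field. auto. }
  rewrite E, !Csq_mult, Csq_circ_minus. unfold D.
  rewrite !Csq_Cmod, Cmod_inv, Cmod_mult, !Cmod_circ by (try lra; apply Cmult_neq_0; auto).
  field. lra. }
assert (HN : forall t, (RtoC 1 - RtoC s * cis t)%C <> RtoC 0).
{ intros t. apply one_minus_neq_0. rewrite Cmod_R_cis; lra. }
set (J := fun y => 2 * PI * r * Re (cis alpha * (- l 1%nat - einv_dq l (RtoC 0) (circ r y)))%C
   - 2 * PI * s * cos (y - alpha)).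
assert (cE : contR (fun y => Re (cis alpha * einv_dq l (RtoC 0) (circ r y))%C)).
{ refine (continuous_Re_circ (fun z => cis alpha * einv_dq l (RtoC 0) z)%C 1 r _ _); [|lra].
  apply holo_mult; [apply holo_const|]. apply holo_einv_dq; auto. rewrite Cmod_0; lra. }
assert (EJ : forall y, J y = (- (2 * PI * r) * Re (cis alpha * einv_dq l (RtoC 0) (circ r y))%C
  + (- (2 * PI * s)) * cos (y - alpha)) + 2 * PI * r * Re (cis alpha * - l 1%nat)%C).
{ intros y. unfold J.
  replace (cis alpha * (- l 1%nat - einv_dq l (RtoC 0) (circ r y)))%C with
    (cis alpha * - l 1%nat + - (cis alpha * einv_dq l (RtoC 0) (circ r y)))%C by ring.
  rewrite re_plus, re_opp. ring. }
assert (cJ : contR J).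
{ apply (contR_ext _ J (fun y => eq_sym (EJ y))).
  exact (contR_plus _ _ (contR_plus _ _ (contR_mult _ _ (contR_const _) cE)
    (contR_mult _ _ (contR_const _) Hcc)) (contR_const _)). }
(* The logarithm of the kernel splits into ln |qker|^2, whose cosine moment is read off
   at z = 0, and the regularised ln |1/z - 1/zeta|^2, which is ln |1 - s e^(i (x - y))|^2
   up to an additive constant. *)
assert (M1 : forall y, pint (fun x => ln (Csq (qker l (circ r y) (circ r x))) * c x) =
   2 * PI * r * Re (cis alpha * (- l 1%nat - einv_dq l (RtoC 0) (circ r y)))%C).
{ intros y. destruct (holo_qker l Hl 3 (circ r y) (Hcirc y)) as [G1 [HG HG1]].
  unfold pint, c. rewrite (cos_moment_ln (qker l (circ r y)) G1 1 r alpha); auto; [|intros z Hz; apply qker_neq_0; auto].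
  rewrite qker_0_r by auto.
  rewrite (is_derive_C_unique _ _ _ _ (HG (RtoC 0) ltac:(unfold Cdisc; rewrite Cmod_0; lra))
    (is_derive_qker_0 (circ r y) (Hcirc y))).
  f_equal. f_equal. field. }
assert (M2 : forall y, pint (fun x => ln (Csq (RtoC 1 - RtoC s * cis (x - y))) * c x) =
   - (2 * PI * s * cos (y - alpha))).
{ intros y. set (k := (RtoC s * cis (- y))%C).
  assert (Hk : Cmod k = s) by (apply Cmod_R_cis; lra).
  assert (H1 : 1 < / s) by (rewrite <- Rinv_1; apply Rinv_lt_contravar; lra).
  assert (H := cos_moment_ln (fun z => RtoC 1 - k * z)%C (fun _ => - k)%C (/ s) 1 alpha).
  unfold pint, c. rewrite (RInt_ext _ (fun x => ln (Csq (RtoC 1 - k * circ 1 x)) * cos (x - alpha))).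
  - rewrite H; auto; try lra.
    + replace (cis alpha * (- k / (RtoC 1 - k * RtoC 0)))%C with (- (RtoC s * cis (alpha - y)))%C.
      * rewrite re_opp, re_scal_l. unfold cis, Re; simpl.
        replace (y - alpha) with (- (alpha - y)) by ring. rewrite cos_neg. ring.
      * replace (RtoC 1 - k * RtoC 0)%C with (RtoC 1) by ring.
        unfold k, Rminus. rewrite cis_plus. field.
    + intros z Hz. eapply is_derive_C_eq.
      * apply (is_derive_minus (K := C_AbsRing) (V := C_NormedModule)).
        -- apply is_derive_C_const.
        -- apply is_derive_C_mult; [apply is_derive_C_const|apply is_derive_C_id].
      * change (RtoC 0 - (RtoC 0 * z + k * RtoC 1) = - k)%C. ring.
    + apply holo_const.
    + intros z Hz. apply one_minus_neq_0. apply Cmod_scal_lt1 with s; auto; lra.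
  - intros x _. replace (k * circ 1 x)%C with (RtoC s * cis (x - y))%C; [reflexivity|].
    unfold k, circ, Rminus. rewrite cis_plus. ring. }
assert (cq : forall y, contR (fun x => ln (Csq (qker l (circ r y) (circ r x))))).
{ intros y. apply contR_ln; [intros x; specialize (Hq x y); lra|].
  assert (Hh := holo_qker l Hl 1 (circ r y) (Hcirc y)).
  apply contR_ext with (fun x => Re (qker l (circ r y) (circ r x)) * Re (qker l (circ r y) (circ r x))
    + Im (qker l (circ r y) (circ r x)) * Im (qker l (circ r y) (circ r x))).
  { intros x; unfold Csq; ring. }
  assert (P : forall x, continuous (fun t => Re (qker l (circ r y) (circ r t))) x /\
     continuous (fun t => Im (qker l (circ r y) (circ r t))) x).
  { intros x. apply continuous_parts_circle. apply holo_continuous with (Cdisc 1); auto. exact (Hcirc x). }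
  assert (P1 : contR (fun t => Re (qker l (circ r y) (circ r t)))) by (intros x; exact (proj1 (P x))).
  assert (P2 : contR (fun t => Im (qker l (circ r y) (circ r t)))) by (intros x; exact (proj2 (P x))).
  exact (contR_plus _ _ (contR_mult _ _ P1 P1) (contR_mult _ _ P2 P2)). }
assert (cs : forall y, contR (fun x => Csq (RtoC 1 - RtoC s * cis (x - y)))).
{ intros y. apply contR_ext with (fun x => 1 + s ^ 2 + (- (2 * s)) * cos (x - y)).
  - intros x. rewrite cis_minus_Csq. ring.
  - apply contR_plus; [apply contR_const|]. apply contR_mult; [apply contR_const|apply contR_cos]. }
assert (csl : forall y, contR (fun x => ln (Csq (RtoC 1 - RtoC s * cis (x - y))))).
{ intros y. apply contR_ln; auto. intros x. apply Csq_pos; auto. }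
set (eta := 2 * PI * (T * (1 - s))).
assert (HT : 1 <= T).
{ unfold T. apply Rmult_le_reg_r with m; auto. unfold Rdiv.
  rewrite Rmult_assoc, Rinv_l; lra. }
assert (key : forall y,
  Rabs (pint (fun x => c x * ln (Csq (W x - W y) + A)) - J y) <= eta).
{ intros y.
  set (R1 := fun x => ln (Csq (W x - W y) + A) - ln (Csq (qker l (circ r y) (circ r x)))
     - ln (D x y + eta2)).
  (* R1 is the error of replacing the regularised kernel by its explicit model. *)
  assert (HR1 : forall x, 0 <= R1 x <= T * (eta2 / (D x y + eta2))).
  { intros x. unfold R1. specialize (Hq x y). rewrite HWdiff.
    set (Q := Csq (qker l (circ r y) (circ r x))) in *.
    replace (Q * D x y + A) with (Q * (D x y + A / Q)) by (field; lra).
    assert (HAQ : eta2 <= A / Q <= T * eta2).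
    { unfold A, T. split.
      - apply Rmult_le_reg_r with Q; [lra|]. unfold Rdiv. rewrite Rmult_assoc, Rinv_l by lra. nra.
      - unfold Rdiv. replace (M * eta2 * / Q) with (M * / Q * eta2) by ring.
        apply Rmult_le_compat_r; [lra|]. apply Rmult_le_compat_l; [lra|].
        apply Rinv_le_contravar; lra. }
    specialize (HD0 x y).
    rewrite ln_mult by lra.
    replace (ln Q + ln (D x y + A / Q) - ln Q - ln (D x y + eta2)) with
      (ln (D x y + A / Q) - ln (D x y + eta2)) by ring.
    apply ln_diff_bound; auto. }
  assert (Hsr : 0 < / (s * r ^ 2)) by (apply Rinv_0_lt_compat, Rmult_lt_0_compat; lra).
  assert (HlnD : forall x, ln (D x y + eta2) =
     ln (/ (s * r ^ 2)) + ln (Csq (RtoC 1 - RtoC s * cis (x - y)))).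
  { intros x. rewrite HDeta, ln_mult; auto. apply Csq_pos; auto. }
  assert (cWA : contR (fun x => ln (Csq (W x - W y) + A))).
  { apply contR_ln; [intros x; pose proof (Csq_ge_0 (W x - W y)); lra|].
    apply contR_plus; [|apply contR_const].
    apply contR_ext with (fun x => (Re (W x) + - Re (W y)) * (Re (W x) + - Re (W y)) +
      (Im (W x) + - Im (W y)) * (Im (W x) + - Im (W y))).
    { intros x. unfold Csq, Cminus. rewrite re_plus, re_opp.
      unfold Im, Cplus, Copp; simpl. ring. }
    assert (U1 : contR (fun x => Re (W x) + - Re (W y)))
      by (apply contR_plus; auto; apply contR_const).
    assert (U2 : contR (fun x => Im (W x) + - Im (W y)))
      by (apply contR_plus; auto; apply contR_const).
    apply contR_plus; apply contR_mult; auto. }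
  assert (cR1 : contR R1).
  { apply contR_ext with (fun x => ln (Csq (W x - W y) + A) +
      -1 * ln (Csq (qker l (circ r y) (circ r x))) +
      -1 * (ln (/ (s * r ^ 2)) + ln (Csq (RtoC 1 - RtoC s * cis (x - y))))).
    { intros x. unfold R1. rewrite HlnD. ring. }
    apply contR_plus; [apply contR_plus; auto|].
    - apply contR_mult; auto; apply contR_const.
    - apply contR_mult; [apply contR_const|]. apply contR_plus; auto. apply contR_const. }
  assert (E : pint (fun x => c x * ln (Csq (W x - W y) + A)) - J y = pint (fun x => c x * R1 x)).
  { rewrite (pint_ext (fun x => c x * ln (Csq (W x - W y) + A))
      (fun x => ((ln (Csq (qker l (circ r y) (circ r x))) * c x +
        ln (Csq (RtoC 1 - RtoC s * cis (x - y))) * c x) + ln (/ (s * r ^ 2)) * c x) + c x * R1 x)).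
    2: { intros x. unfold R1. rewrite HlnD. ring. }
    assert (C1 : contR (fun x => ln (Csq (qker l (circ r y) (circ r x))) * c x))
      by (apply contR_mult; auto).
    assert (C2 : contR (fun x => ln (Csq (RtoC 1 - RtoC s * cis (x - y))) * c x))
      by (apply contR_mult; auto).
    assert (C3 : contR (fun x => ln (/ (s * r ^ 2)) * c x))
      by (apply contR_mult; auto; apply contR_const).
    assert (C4 : contR (fun x => c x * R1 x)) by (apply contR_mult; auto).
    rewrite pint_plus; auto; [|repeat apply contR_plus; auto].
    rewrite pint_plus; auto; [|repeat apply contR_plus; auto].
    rewrite pint_plus; auto.
    rewrite M1, M2, pint_scal by auto. unfold c at 1. rewrite pint_cos. unfold J. ring. }
  rewrite E.
  apply Rle_trans with (pint (fun x => T * (1 - s) / (1 + s) *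
     ((1 - s ^ 2) / Csq (RtoC 1 - RtoC s * cis (x - y))))).
  { assert (cP : contR (fun x => (1 - s ^ 2) / Csq (RtoC 1 - RtoC s * cis (x - y)))).
    { apply contR_mult; [apply contR_const|]. apply contR_inv; auto.
      intros x. pose proof (Csq_pos _ (HN (x - y))). lra. }
    apply pint_abs_le.
    - apply contR_mult; auto.
    - apply contR_mult; auto. apply contR_const.
    - intros x. specialize (HR1 x). rewrite Rabs_mult, (Rabs_pos_eq (R1 x)) by lra.
      apply Rle_trans with (1 * R1 x).
      { apply Rmult_le_compat_r; [lra|]. apply Rabs_le, COS_bound. }
      rewrite Rmult_1_l. eapply Rle_trans; [apply HR1|].
      rewrite HDeta. pose proof (Csq_pos _ (HN (x - y))).
      right. unfold eta2. field. lra. }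
  rewrite pint_scal.
  - unfold pint. rewrite poisson_mass by auto. unfold eta.
    replace (T * (1 - s) / (1 + s) * (2 * PI)) with (2 * PI * (T * (1 - s)) * / (1 + s)) by (field; lra).
    rewrite <- (Rmult_1_r (2 * PI * (T * (1 - s)))) at 2.
    apply Rmult_le_compat_l.
    + apply Rmult_le_pos; [lra|]. apply Rmult_le_pos; lra.
    + assert (Q : / (1 + s) <= / 1) by (apply Rinv_le_contravar; lra). rewrite Rinv_1 in Q; lra.
  - apply contR_mult; [apply contR_const|]. apply contR_inv; auto.
    intros x. pose proof (Csq_pos _ (HN (x - y))). lra. }
assert (Hfin := energy_bound W A B c HWr HWi HA HWB Hcc
  (fun x => Rabs_le _ _ (COS_bound (x - alpha))) (pint_cos alpha) J eta cJ key).
assert (HJm : pint (fun y => c y * J y) =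
  - (2 * PI * r) * (PI * r * Re (cis (2 * alpha) * recip_coef)%C) - 2 * PI * s * PI).
{ assert (C1 : contR (fun y => Re (cis alpha * einv_dq l (RtoC 0) (circ r y))%C * cos (y - alpha)))
    by (apply contR_mult; auto).
  assert (C2 : contR (fun y => cos (y - alpha) * cos (y - alpha))) by (apply contR_mult; auto).
  rewrite (pint_ext _ (fun y => (- (2 * PI * r) * (Re (cis alpha * einv_dq l (RtoC 0) (circ r y))%C * cos (y - alpha))
   + (- (2 * PI * s)) * (cos (y - alpha) * cos (y - alpha))) +
     (2 * PI * r * Re (cis alpha * - l 1%nat)%C) * cos (y - alpha))).
  2: { intros y. rewrite EJ. unfold c. ring. }
  assert (C3 := contR_mult _ _ (contR_const (- (2 * PI * r))) C1).
  assert (C4 := contR_mult _ _ (contR_const (- (2 * PI * s))) C2).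
  assert (C5 := contR_mult _ _ (contR_const (2 * PI * r * Re (cis alpha * - l 1%nat)%C)) (contR_cos alpha)).
  rewrite (pint_plus _ _ (contR_plus _ _ C3 C4) C5), (pint_plus _ _ C3 C4),
    (pint_scal _ _ C1), (pint_scal _ _ C2), (pint_scal _ _ (contR_cos alpha)),
    pint_cos2, pint_cos.
  assert (H0 : Cmod (RtoC 0) < 1) by (rewrite Cmod_0; lra).
  destruct (holo_einv_dq l Hl 3 (RtoC 0) H0) as [p1 [Hp Hp1]].
  assert (Hm1 := cos_moment_Re (fun z => cis alpha * einv_dq l (RtoC 0) z)%C
     (fun z => cis alpha * p1 z)%C 1 r alpha).
  unfold pint. rewrite Hm1; auto.
  - rewrite (is_derive_C_unique _ _ _ _ (Hp (RtoC 0) H0) is_derive_einv_dq_0).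
    replace (cis alpha * (cis alpha * recip_coef))%C with (cis (2 * alpha) * recip_coef)%C.
    + ring.
    + replace (2 * alpha) with (alpha + alpha) by ring. rewrite cis_plus. ring.
  - intros z Hz. eapply is_derive_C_eq.
    + apply is_derive_C_mult; [apply is_derive_C_const|apply Hp; auto].
    + cbv beta; ring.
  - apply holo_mult; auto. apply holo_const. }
rewrite HJm in Hfin. unfold eta in Hfin.
apply Rmult_le_reg_l with (2 * PI * PI); [nra|].
replace (2 * (M / m) * (1 - s)) with (2 * T * (1 - s)) by reflexivity.
lra.
Qed.

Lemma coefficient_bound : Cmod recip_coef <= 1.
Proof.
destruct (Ceq_dec recip_coef (RtoC 0)) as [E|N].
{ rewrite E, Cmod_0. lra. }
assert (Hb : 0 < Cmod recip_coef) by (apply Cmod_gt_0; auto).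
(* Rotate so that e^(2 i alpha) recip_coef = - |recip_coef|. *)
destruct (cis_surj (- (RtoC (Cmod recip_coef) * / recip_coef))%C) as [t [_ Ht]].
{ rewrite Cmod_opp, Cmod_mult, Cmod_inv, Cmod_R, Rabs_pos_eq by (auto; lra). field. lra. }
assert (Hre : Re (cis (2 * (t / 2)) * recip_coef)%C = - Cmod recip_coef).
{ replace (2 * (t / 2)) with t by field. rewrite <- Ht.
  replace (- (RtoC (Cmod recip_coef) * / recip_coef) * recip_coef)%C with (- RtoC (Cmod recip_coef))%C by (field; auto).
  rewrite re_opp. reflexivity. }
assert (H1 : forall r, 0 < r < 1 -> r ^ 2 * Cmod recip_coef <= 1).
{ intros r Hr. destruct (qker_bounds r Hr) as [m [M [Hm [HmM Hq]]]].
  apply Rle_plus_epsilon. intros eps Heps.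
  assert (HT : 0 < M / m) by (apply Rdiv_lt_0_compat; lra).
  set (s := Rmax (1 / 2) (1 - eps / (2 * (M / m)))).
  assert (Hs : 0 < s < 1).
  { split; [apply Rlt_le_trans with (1 / 2); [lra|apply Rmax_l]|].
    apply Rmax_lub_lt; [lra|].
    assert (0 < eps / (2 * (M / m))) by (apply Rdiv_lt_0_compat; lra). lra. }
  assert (H := coefficient_estimate r s (t / 2) m M Hr Hs Hm HmM Hq). rewrite Hre in H.
  assert (Hs2 : 1 - eps / (2 * (M / m)) <= s) by apply Rmax_r.
  assert (2 * (M / m) * (1 - s) <= eps).
  { apply Rle_trans with (2 * (M / m) * (eps / (2 * (M / m)))).
    - apply Rmult_le_compat_l; lra.
    - right. set (u := M / m) in *. field. lra. }
  lra. }
apply Rnot_lt_le. intros Hgt.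
(* If |recip_coef| > 1, then r^2 = 2 / (1 + |recip_coef|) contradicts H1. *)
set (r := 2 / (1 + Cmod recip_coef)).
assert (Hr01 : 0 < r < 1).
{ unfold r. split; [apply Rdiv_lt_0_compat; lra|].
  apply Rmult_lt_reg_r with (1 + Cmod recip_coef); [lra|]. unfold Rdiv.
  rewrite Rmult_assoc, Rinv_l; lra. }
assert (Hsq : 0 < sqrt r < 1).
{ split; [apply sqrt_lt_R0; lra|]. rewrite <- sqrt_1. apply sqrt_lt_1; lra. }
specialize (H1 (sqrt r) Hsq). rewrite pow2_sqrt in H1 by lra.
unfold r in H1.
apply Rmult_le_compat_r with (r := 1 + Cmod recip_coef) in H1; [|lra].
replace (2 / (1 + Cmod recip_coef) * Cmod recip_coef * (1 + Cmod recip_coef)) with (2 * Cmod recip_coef) in H1 by (field; lra).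
lra.
Qed.

End Core.

(** * Logarithmic coefficients: the square root transform, the inequality and the extremal functions *)

Lemma is_series_terms_bounded (a : nat -> C) (s : C) :
  is_series (K := C_AbsRing) (V := C_NormedModule) a s ->
  exists B, forall n, Cmod (a n) <= B.
Proof.
intros H.
destruct (filterlim_bounded (K := C_AbsRing) (V := C_NormedModule) (sum_n a)) as [M HM].
{ exists s; exact H. }
exists (2 * M). intros n.
assert (HM' : forall n, Cmod (sum_n a n) <= M) by exact HM.
destruct n as [|n].
- specialize (HM' O). rewrite sum_O in HM'. pose proof (Cmod_ge_0 (a O)). lra.
- assert (E : a (S n) = (sum_n a (S n) - sum_n a n)%C).
  { rewrite sum_Sn. change (a (S n) = (sum_n a n + a (S n)) - sum_n a n)%C. ring. }
  rewrite E. unfold Cminus. eapply Rle_trans; [apply Cmod_triangle|]. rewrite Cmod_opp.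
  pose proof (HM' (S n)). pose proof (HM' n). lra.
Qed.

Lemma radius_ge_of_series (a : nat -> C) :
  (forall z, Cmod z < 1 -> exists s,
    is_series (K := C_AbsRing) (V := C_NormedModule) (fun n => a n * z ^ n)%C s) ->
  radius_ge a 1.
Proof.
intros H r Hr. destruct (H (RtoC r)) as [s Hs].
{ rewrite Cmod_R, Rabs_pos_eq; lra. }
destruct (is_series_terms_bounded _ _ Hs) as [B HB]. exists B. intros n.
specialize (HB n). rewrite Cmod_mult, Cmod_pow, Cmod_R, Rabs_pos_eq in HB; lra.
Qed.

(** Half of the series l at z^2: if f(z) = z exp(L(z)), then sqrt(f(z^2)) = z exp(L(z^2) / 2). *)
Definition sqcoef (l : nat -> C) (n : nat) : C :=
  if Nat.even n then (RtoC (/ 2) * l (Nat.div2 n))%C else RtoC 0.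

Lemma sqcoef_even (l : nat -> C) (k : nat) : sqcoef l (2 * k) = (RtoC (/ 2) * l k)%C.
Proof.
unfold sqcoef. rewrite Nat.even_mul, Nat.div2_double. reflexivity.
Qed.

Lemma sqcoef_odd (l : nat -> C) (k : nat) : sqcoef l (S (2 * k)) = RtoC 0.
Proof.
unfold sqcoef. rewrite Nat.even_succ, Nat.odd_mul. reflexivity.
Qed.

Lemma radius_ge_sqcoef (l : nat -> C) : radius_ge l 1 -> radius_ge (sqcoef l) 1.
Proof.
intros Hl r Hr. destruct (Hl (r ^ 2) ltac:(simpl; nra)) as [B HB].
assert (HB0 : 0 <= B).
{ eapply Rle_trans; [|apply (HB O)]. simpl. rewrite Rmult_1_r. apply Cmod_ge_0. }
exists B. intros n. destruct (Nat.Even_or_Odd n) as [[k E]|[k E]]; subst n.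
- rewrite sqcoef_even, Cmod_mult, Cmod_R, Rabs_pos_eq, pow_mult by lra.
  specialize (HB k). assert (0 <= Cmod (l k) * (r ^ 2) ^ k).
  { apply Rmult_le_pos; [apply Cmod_ge_0|]. apply pow_le. simpl; nra. }
  nra.
- rewrite Nat.add_1_r, sqcoef_odd, Cmod_0. lra.
Qed.

Lemma pser_sqcoef (l : nat -> C) (z : C) : radius_ge l 1 -> Cmod z < 1 ->
  pser (sqcoef l) z = (RtoC (/ 2) * pser l (z * z))%C.
Proof.
intros Hl Hz.
assert (Hz2 : Cmod (z * z) < 1).
{ rewrite Cmod_mult. pose proof (Cmod_ge_0 z). nra. }
assert (S1 := csum_correct _ (radius_ge_abs_term _ 1 z (radius_ge_sqcoef l Hl) Hz)).
assert (S2 := is_series_scal (K := C_AbsRing) (V := C_NormedModule) (RtoC (/ 2)) _ _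
  (csum_correct _ (radius_ge_abs_term _ 1 (z * z)%C Hl Hz2))).
assert (S3 : filterlim (fun n => sum_n (fun n => sqcoef l n * z ^ n)%C (2 * n)) eventually
   (locally (T := C_NormedModule) (pser (sqcoef l) z))).
{ apply (filterlim_comp _ _ _ (fun n => (2 * n)%nat) (sum_n (fun n => sqcoef l n * z ^ n)%C)
    eventually eventually); [|exact S1].
  intros P [N HN]. exists N. intros n Hn. apply HN. lia. }
assert (E : forall n, sum_n (fun n => scal (RtoC (/ 2)) (l n * (z * z) ^ n)%C) n =
   sum_n (fun n => sqcoef l n * z ^ n)%C (2 * n)).
{ assert (T : forall k, (sqcoef l (2 * k) * z ^ (2 * k) =
     RtoC (/ 2) * (l k * (z * z) ^ k))%C).
  { intros k. rewrite sqcoef_even, Cpow_mult_r.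
    replace (z ^ 2)%C with (z * z)%C by (simpl; ring). ring. }
  induction n as [|n IH].
  - rewrite !sum_O. symmetry. apply (T O).
  - replace (2 * S n)%nat with (S (S (2 * n))) by lia.
    rewrite !sum_Sn, IH, sqcoef_odd.
    replace (S (S (2 * n))) with (2 * S n)%nat by lia. rewrite T.
    match goal with |- plus ?a ?b = plus (plus ?a ?c) ?d =>
      change (a + b = (a + c) + d)%C end.
    change (scal (RtoC (/ 2)) (l (S n) * (z * z) ^ S n)%C) with
      (RtoC (/ 2) * (l (S n) * (z * z) ^ S n))%C. ring. }
apply (filterlim_locally_unique (K := C_AbsRing) (V := C_NormedModule)
  (fun n => sum_n (fun n => sqcoef l n * z ^ n)%C (2 * n)) (F := eventually)); auto.
apply filterlim_ext with (1 := E). exact S2.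
Qed.

(** What the coefficient bounds use of log (f(z) / z). Phrasing it for the coefficients alone lets
    the square root transform act on sequences. *)
Definition schlicht_log (l : nat -> C) : Prop :=
  radius_ge l 1 /\ l O = RtoC 0 /\
  forall z w, Cmod z < 1 -> Cmod w < 1 ->
    (z * Cexp (pser l z) = w * Cexp (pser l w))%C -> z = w.

(** h(z) = h(w) gives f(z^2) = f(w^2), so z^2 = w^2; then the exponential factors of h(z) and
    h(w) agree, and z = w. *)
Lemma schlicht_log_sqrt (l : nat -> C) : schlicht_log l -> schlicht_log (sqcoef l).
Proof.
intros [Hl [Hl0 Hinj]]. split; [apply radius_ge_sqcoef; auto|]. split.
{ replace O with (2 * 0)%nat by lia. rewrite sqcoef_even, Hl0. ring. }
intros z w Hz Hw H.
(* h(u)^2 = f(u^2) for h(u) = u exp(sqcoef series) and f(z) = z exp(l series). *)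
assert (E2 : forall u, Cmod u < 1 ->
  (u * Cexp (pser (sqcoef l) u) * (u * Cexp (pser (sqcoef l) u)) =
   u * u * Cexp (pser l (u * u)))%C).
{ intros u Hu. rewrite pser_sqcoef by auto.
  replace (pser l (u * u)) with
    (RtoC (/ 2) * pser l (u * u) + RtoC (/ 2) * pser l (u * u))%C at 3.
  - rewrite Cexp_plus. ring.
  - replace (RtoC (/ 2) * pser l (u * u) + RtoC (/ 2) * pser l (u * u))%C with
      (RtoC (/ 2 + / 2) * pser l (u * u))%C by (rewrite RtoC_plus; ring).
    replace (/ 2 + / 2) with 1 by field. ring. }
assert (Hsq : (z * z = w * w)%C).
{ apply Hinj.
  - rewrite Cmod_mult. pose proof (Cmod_ge_0 z). nra.
  - rewrite Cmod_mult. pose proof (Cmod_ge_0 w). nra.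
  - rewrite <- !E2, H by auto. reflexivity. }
assert (EL : pser (sqcoef l) z = pser (sqcoef l) w) by (rewrite !pser_sqcoef, Hsq; auto).
rewrite EL in H. assert (N := Cexp_neq_0 (pser (sqcoef l) w)).
replace z with (z * Cexp (pser (sqcoef l) w) * / Cexp (pser (sqcoef l) w))%C by (field; auto).
rewrite H. field; auto.
Qed.

Lemma schlicht_log_second (l : nat -> C) : schlicht_log l ->
  Cmod (RtoC (1 / 2) * (l 1%nat * l 1%nat) - l 2%nat) <= 1.
Proof. intros [H1 [H2 H3]]. exact (coefficient_bound l H1 H2 H3). Qed.

(** Bieberbach's bound |a_2| <= 2: l 1 = a_2 is twice the second coefficient of the square
    root transform, whose first coefficient vanishes. *)
Lemma schlicht_log_first (l : nat -> C) : schlicht_log l -> Cmod (l 1%nat) <= 2.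
Proof.
intros H. assert (A := schlicht_log_second _ (schlicht_log_sqrt l H)).
change (sqcoef l 1) with (RtoC 0) in A.
change (sqcoef l 2) with (RtoC (/ 2) * l 1%nat)%C in A.
replace (RtoC (1 / 2) * (RtoC 0 * RtoC 0) - RtoC (/ 2) * l 1%nat)%C with
  (- (RtoC (/ 2) * l 1%nat))%C in A by ring.
rewrite Cmod_opp, Cmod_mult, Cmod_R, Rabs_pos_eq in A; lra.
Qed.

(** The logarithmic coefficients provide the power series L, and f(z) = z exp(L(z)), also at
    z = 0, so the injectivity of f is that of z exp(L(z)). *)
Lemma log_coeffs_schlicht (f : C -> C) (gamma : nat -> C) :
  class_S f -> is_log_coeffs f gamma ->
  schlicht_log (fun n => match n with O => RtoC 0 | S _ => (RtoC 2 * gamma n)%C end).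
Proof.
intros [[_ [Hf0 _]] Hinj] [L [[_ [_ HL]] Hs]].
set (l := fun n => match n with O => RtoC 0 | S _ => (RtoC 2 * gamma n)%C end).
assert (Hser : forall z, Cmod z < 1 ->
  is_series (K := C_AbsRing) (V := C_NormedModule) (fun n => l n * z ^ n)%C (L z)).
{ intros z Hz. destruct (Hs z Hz) as [s [H1 H2]].
  apply (is_series_decr_1 (K := C_AbsRing) (V := C_NormedModule)).
  apply (is_series_scal (K := C_AbsRing) (V := C_NormedModule) (RtoC 2)) in H1.
  refine (eq_ind _ (fun s => is_series (K := C_AbsRing) (V := C_NormedModule) _ s) _ _ _).
  - eapply is_series_ext; [|exact H1].
    intros n. unfold l. change (RtoC 2 * (gamma (S n) * z ^ S n) = RtoC 2 * gamma (S n) * z ^ S n)%C.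
    ring.
  - rewrite H2. unfold l.
    change (RtoC 2 * s = RtoC 2 * s + - (RtoC 0 * z ^ 0))%C. ring. }
assert (HlL : forall z, Cmod z < 1 -> pser l z = L z).
{ intros z Hz. apply csum_unique. apply Hser; auto. }
assert (Hfz : forall z, Cmod z < 1 -> (z * Cexp (pser l z) = f z)%C).
{ intros z Hz. destruct (Ceq_dec z (RtoC 0)) as [E|N].
  - rewrite E, Hf0. ring.
  - rewrite HlL, HL by auto. field; auto. }
split; [|split; [reflexivity|]].
- apply radius_ge_of_series. intros z Hz. exists (L z). auto.
- intros z w Hz Hw H. rewrite !Hfz in H by auto. apply Hinj; auto.
Qed.

(** With t = |gamma_1| <= 1 and u = |gamma_2|, |gamma_1^2 - gamma_2| <= 1/2 gives
    t^2 - 1/2 <= u <= t^2 + 1/2. The upper bound follows from t^2 <= t. The lower one is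
    u >= 0 when t <= sqrt 2 / 2, and beyond that point t - t^2 + 1/2 decreases. *)
Lemma log_coeffs_bounds (f : C -> C) (gamma : nat -> C) :
  class_S f -> is_log_coeffs f gamma ->
  - (sqrt 2 / 2) <= Cmod (gamma 2%nat) - Cmod (gamma 1%nat) <= 1 / 2.
Proof.
intros HS Hg. assert (H := log_coeffs_schlicht f gamma HS Hg).
assert (A := schlicht_log_second _ H). assert (B := schlicht_log_first _ H). cbv beta iota in A, B.
rewrite Cmod_mult, Cmod_R, Rabs_pos_eq in B by lra.
set (g1 := gamma 1%nat) in *. set (g2 := gamma 2%nat) in *.
replace (RtoC (1 / 2) * (RtoC 2 * g1 * (RtoC 2 * g1)) - RtoC 2 * g2)%C with
  (RtoC 2 * (g1 * g1 - g2))%C in A.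
2: { replace (RtoC (1 / 2)) with (/ RtoC 2)%C.
     - field.
     - rewrite <- RtoC_inv by lra. f_equal. lra. }
rewrite Cmod_mult, Cmod_R, Rabs_pos_eq in A by lra.
assert (T1 : Cmod g2 <= Cmod (g1 * g1 - g2) + Cmod g1 * Cmod g1).
{ replace g2 with (- (g1 * g1 - g2) + g1 * g1)%C at 1 by ring.
  eapply Rle_trans; [apply Cmod_triangle|]. rewrite Cmod_opp, Cmod_mult. lra. }
assert (T2 : Cmod g1 * Cmod g1 <= Cmod (g1 * g1 - g2) + Cmod g2).
{ rewrite <- Cmod_mult. replace (g1 * g1)%C with ((g1 * g1 - g2) + g2)%C at 1 by ring.
  apply Cmod_triangle. }
assert (t0 := Cmod_ge_0 g1). assert (u0 := Cmod_ge_0 g2).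
set (t := Cmod g1) in *. set (u := Cmod g2) in *.
assert (Hk : (sqrt 2 / 2) * (sqrt 2 / 2) = 1 / 2).
{ replace (sqrt 2 / 2 * (sqrt 2 / 2)) with (sqrt 2 * sqrt 2 / 4) by field.
  rewrite sqrt_sqrt; lra. }
assert (Hk0 : 0 < sqrt 2 / 2).
{ assert (0 < sqrt 2) by (apply sqrt_lt_R0; lra). lra. }
set (k := sqrt 2 / 2) in *.
split; [|nra].
destruct (Rle_dec t k) as [Q|Q]; [lra|].
assert (1 / 2 < k) by nra. nra.
Qed.

(** Coefficients of - ln (1 - z). *)
Definition lncoef (n : nat) : C := match n with O => RtoC 0 | S _ => RtoC (/ INR n) end.

Lemma radius_ge_one (a : nat -> C) : (forall n, Cmod (a n) <= 1) -> radius_ge a 1.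
Proof.
intros H r Hr. exists 1. intros n. specialize (H n).
assert (0 <= r ^ n) by (apply pow_le; lra).
assert (r ^ n <= 1) by (rewrite <- (pow1 n); apply pow_incr; lra).
pose proof (Cmod_ge_0 (a n)). nra.
Qed.

Lemma radius_ge_lncoef : radius_ge lncoef 1.
Proof.
apply radius_ge_one. intros [|n]; unfold lncoef.
- rewrite Cmod_0; lra.
- assert (1 <= INR (S n)) by (rewrite S_INR; pose proof (pos_INR n); lra).
  rewrite Cmod_R, Rabs_pos_eq by (apply Rlt_le, Rinv_0_lt_compat; lra).
  rewrite <- Rinv_1. apply Rinv_le_contravar; lra.
Qed.

Lemma geometric_pser (z : C) : Cmod z < 1 -> ((RtoC 1 - z) * pser (fun _ => RtoC 1) z = RtoC 1)%C.
Proof.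
intros Hz.
assert (A : ex_series (fun n => Cmod (RtoC 1 * z ^ n)%C)).
{ apply (radius_ge_abs_term (fun _ => RtoC 1) 1); auto. apply radius_ge_one.
  intros; rewrite Cmod_1; lra. }
assert (E : (pser (fun _ => RtoC 1) z = RtoC 1 + z * pser (fun _ => RtoC 1) z)%C).
{ unfold pser at 1. rewrite (csum_incr _ A). unfold pser. rewrite <- csum_scal by auto.
  f_equal; [simpl; ring|]. apply csum_ext. intros n. simpl. ring. }
replace ((RtoC 1 - z) * pser (fun _ => RtoC 1) z)%C with
  (pser (fun _ => RtoC 1) z - z * pser (fun _ => RtoC 1) z)%C by ring.
rewrite E at 1. ring.
Qed.

(** The left-hand side has derivative zero, since the differentiated series is geometric. *)
Lemma Cexp_pser_lncoef (z : C) : Cmod z < 1 ->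
  (Cexp (pser lncoef z) * (RtoC 1 - z) = RtoC 1)%C.
Proof.
intros Hz.
set (F := fun z => (Cexp (pser lncoef z) * (RtoC 1 - z))%C).
assert (H : F z = F (RtoC 0)).
{ apply (zero_derive_constant F (RtoC 0) 1).
  - intros w Hw. replace (w - RtoC 0)%C with w in Hw by ring.
    eapply is_derive_C_eq.
    + apply is_derive_C_mult.
      * apply (is_derive_C_comp Cexp (pser lncoef)); [apply is_derive_Cexp|].
        apply is_derive_pser with 1; auto. apply radius_ge_lncoef.
      * apply (is_derive_minus (K := C_AbsRing) (V := C_NormedModule));
          [apply is_derive_C_const|apply is_derive_C_id].
    + replace (pser (dcoef lncoef) w) with (pser (fun _ => RtoC 1) w).
      * change (pser (fun _ => RtoC 1) w * Cexp (pser lncoef w) * (RtoC 1 - w) +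
          Cexp (pser lncoef w) * (RtoC 0 - RtoC 1) = RtoC 0)%C.
        replace (pser (fun _ => RtoC 1) w * Cexp (pser lncoef w) * (RtoC 1 - w))%C with
          (Cexp (pser lncoef w) * ((RtoC 1 - w) * pser (fun _ => RtoC 1) w))%C by ring.
        rewrite geometric_pser by auto. ring.
      * apply csum_ext. intros n. f_equal. unfold dcoef, lncoef.
        rewrite <- RtoC_mult, Rinv_r; auto. apply not_0_INR; lia.
  - replace (z - RtoC 0)%C with z by ring. auto. }
change (F z = RtoC 1). rewrite H. unfold F. rewrite pser_0. simpl lncoef. rewrite Cexp_0. ring.
Qed.

(** The reciprocal is 1/z - (a + b) + a b z. For |a| = |b| = 1 this has a coefficient of z of
    modulus 1, the extremal case of the coefficient bound. *)
Definition two_pole (a b z : C) : C := (z * / ((RtoC 1 - a * z) * (RtoC 1 - b * z)))%C.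
Definition two_pole_gamma (a b : C) (n : nat) : C :=
  (RtoC (/ (2 * INR n)) * (a ^ n + b ^ n))%C.

Lemma Cmod_mul1 (a z : C) : Cmod a = 1 -> Cmod z < 1 -> Cmod (a * z) < 1.
Proof. intros Ha Hz. rewrite Cmod_mult, Ha. lra. Qed.

Lemma two_pole_class_S (a b : C) : Cmod a = 1 -> Cmod b = 1 -> class_S (two_pole a b).
Proof.
intros Ha Hb.
assert (Hn : forall c z, Cmod c = 1 -> Cmod z < 1 -> (RtoC 1 - c * z)%C <> RtoC 0).
{ intros c z Hc Hz. apply one_minus_neq_0. apply Cmod_mul1; auto. }
assert (Hd : forall z, Cmod z < 1 -> is_derive (two_pole a b) z
  (RtoC 1 * / ((RtoC 1 - a * z) * (RtoC 1 - b * z)) + z *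
   - (((- a) * (RtoC 1 - b * z) + (RtoC 1 - a * z) * (- b)) *
      (/ ((RtoC 1 - a * z) * (RtoC 1 - b * z)) * / ((RtoC 1 - a * z) * (RtoC 1 - b * z)))))%C).
{ intros z Hz.
  assert (Hlin : forall c, is_derive (fun z => RtoC 1 - c * z)%C z (- c)%C).
  { intros c. eapply is_derive_C_eq.
    - apply (is_derive_minus (K := C_AbsRing) (V := C_NormedModule));
        [apply is_derive_C_const|].
      apply is_derive_C_mult; [apply is_derive_C_const|apply is_derive_C_id].
    - change (RtoC 0 - (RtoC 0 * z + c * RtoC 1) = - c)%C. ring. }
  apply (is_derive_C_mult (fun z => z)
    (fun z => / ((RtoC 1 - a * z) * (RtoC 1 - b * z)))%C); [apply is_derive_C_id|].
  apply (is_derive_C_inv (fun z => (RtoC 1 - a * z) * (RtoC 1 - b * z))%C).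
  - apply Cmult_neq_0; auto.
  - apply (is_derive_C_mult (fun z => RtoC 1 - a * z)%C (fun z => RtoC 1 - b * z)%C); auto. }
split; [split; [|split]|].
- intros z Hz. eexists. apply Hd. exact Hz.
- unfold two_pole. ring.
- eapply is_derive_C_eq; [apply Hd; rewrite Cmod_0; lra|].
  replace (RtoC 1 - a * RtoC 0)%C with (RtoC 1) by ring.
  replace (RtoC 1 - b * RtoC 0)%C with (RtoC 1) by ring.
  field.
- intros z w Hz Hw E. unfold two_pole in E.
  assert (N1 := Hn a z Ha Hz). assert (N2 := Hn b z Hb Hz).
  assert (N3 := Hn a w Ha Hw). assert (N4 := Hn b w Hb Hw).
  (* 1/f(z) - 1/f(w) = (w - z) (1 / (z w) - a b), cleared of denominators. *)
  assert (E2 : ((z - w) * (RtoC 1 - (a * z) * (b * w)) = RtoC 0)%C).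
  { transitivity ((z * / ((RtoC 1 - a * z) * (RtoC 1 - b * z)) -
      w * / ((RtoC 1 - a * w) * (RtoC 1 - b * w))) *
      ((RtoC 1 - a * z) * (RtoC 1 - b * z) * ((RtoC 1 - a * w) * (RtoC 1 - b * w))))%C.
    - field. repeat split; auto.
    - rewrite E. ring. }
  destruct (Ceq_dec z w) as [|N]; auto. exfalso.
  apply (Cmult_neq_0 (z - w) (RtoC 1 - (a * z) * (b * w))); auto.
  + apply Cminus_neq_0; auto.
  + apply one_minus_neq_0. rewrite Cmod_mult.
    pose proof (Cmod_mul1 a z Ha Hz). pose proof (Cmod_mul1 b w Hb Hw).
    pose proof (Cmod_ge_0 (a * z)). pose proof (Cmod_ge_0 (b * w)). nra.
Qed.

Lemma two_pole_log_coeffs (a b : C) : Cmod a = 1 -> Cmod b = 1 ->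
  is_log_coeffs (two_pole a b) (two_pole_gamma a b).
Proof.
intros Ha Hb.
set (L := fun z => (pser lncoef (a * z) + pser lncoef (b * z))%C).
assert (H2 : RtoC 2 <> RtoC 0) by (intros E; apply RtoC_inj in E; lra).
exists L. split; [split; [|split]|].
- intros z Hz.
  assert (H : holo 1 (Cdisc 1) L).
  { apply holo_plus; apply (holo_comp 1 (Cdisc 1) (Cdisc 1) (pser lncoef)).
    - intros; apply Cmod_mul1; auto.
    - apply holo_pser, radius_ge_lncoef.
    - apply holo_mult; [apply holo_const|apply holo_id].
    - intros; apply Cmod_mul1; auto.
    - apply holo_pser, radius_ge_lncoef.
    - apply holo_mult; [apply holo_const|apply holo_id]. }
  apply holo_continuous with (Cdisc 1); auto.
- unfold L. replace (a * RtoC 0)%C with (RtoC 0) by ring.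
  replace (b * RtoC 0)%C with (RtoC 0) by ring. rewrite pser_0. simpl lncoef. ring.
- intros z Hz N. unfold L. rewrite Cexp_plus.
  assert (E1 := Cexp_pser_lncoef (a * z) (Cmod_mul1 a z Ha Hz)).
  assert (E2 := Cexp_pser_lncoef (b * z) (Cmod_mul1 b z Hb Hz)).
  assert (N1 := one_minus_neq_0 _ (Cmod_mul1 a z Ha Hz)).
  assert (N2 := one_minus_neq_0 _ (Cmod_mul1 b z Hb Hz)).
  unfold two_pole.
  transitivity ((Cexp (pser lncoef (a * z)) * (RtoC 1 - a * z)) *
    (Cexp (pser lncoef (b * z)) * (RtoC 1 - b * z)) *
    / ((RtoC 1 - a * z) * (RtoC 1 - b * z)))%C.
  + field; auto.
  + rewrite E1, E2. field; auto.
- intros z Hz. exists (RtoC (/ 2) * L z)%C. split.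
  + assert (A1 := radius_ge_abs_term _ 1 (a * z) radius_ge_lncoef (Cmod_mul1 a z Ha Hz)).
    assert (A2 := radius_ge_abs_term _ 1 (b * z) radius_ge_lncoef (Cmod_mul1 b z Hb Hz)).
    assert (S := is_series_scal (K := C_AbsRing) (V := C_NormedModule) (RtoC (/ 2)) _ _
      (is_series_plus (K := C_AbsRing) (V := C_NormedModule) _ _ _ _
        (csum_correct _ A1) (csum_correct _ A2))).
    apply (is_series_incr_1 (K := C_AbsRing) (V := C_NormedModule)
       (fun n => two_pole_gamma a b n * z ^ n)%C).
    refine (eq_ind (RtoC (/ 2) * L z)%C
      (fun s => is_series (K := C_AbsRing) (V := C_NormedModule) _ s) _ _ _).
    * eapply is_series_ext; [|exact S]. intros n.
      change (RtoC (/ 2) * (lncoef n * (a * z) ^ n + lncoef n * (b * z) ^ n) =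
        two_pole_gamma a b n * z ^ n)%C.
      unfold two_pole_gamma. rewrite !Cpow_mult_l.
      replace (RtoC (/ (2 * INR n))) with (RtoC (/ 2) * lncoef n)%C; [ring|].
      destruct n as [|n]; unfold lncoef.
      -- simpl INR. rewrite Rmult_0_r, Rinv_0. ring.
      -- rewrite Rinv_mult, RtoC_mult. reflexivity.
    * change (RtoC (/ 2) * L z = RtoC (/ 2) * L z + two_pole_gamma a b 0 * z ^ 0)%C.
      unfold two_pole_gamma. simpl INR. rewrite Rmult_0_r, Rinv_0. ring.
  + replace (RtoC (/ 2)) with (/ RtoC 2)%C by (rewrite RtoC_inv; auto; lra). field; auto.
Qed.

Theorem theorem1 :
  (forall (f : C -> C) (gamma : nat -> C),
      class_S f -> is_log_coeffs f gamma ->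
      - (sqrt 2 / 2) <= Cmod (gamma 2%nat) - Cmod (gamma 1%nat) <= 1 / 2) /\
  (exists (f : C -> C) (gamma : nat -> C),
      class_S f /\ is_log_coeffs f gamma /\
      Cmod (gamma 2%nat) - Cmod (gamma 1%nat) = - (sqrt 2 / 2)) /\
  (exists (f : C -> C) (gamma : nat -> C),
      class_S f /\ is_log_coeffs f gamma /\
      Cmod (gamma 2%nat) - Cmod (gamma 1%nat) = 1 / 2).
Proof.
split; [exact log_coeffs_bounds|]. split.
- set (k := sqrt 2 / 2).
  assert (Hk0 : 0 < k).
  { unfold k. assert (0 < sqrt 2) by (apply sqrt_lt_R0; lra). lra. }
  assert (Hk : k * k = 1 / 2).
  { unfold k. replace (sqrt 2 / 2 * (sqrt 2 / 2)) with (sqrt 2 * sqrt 2 / 4) by field.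
    rewrite sqrt_sqrt; lra. }
  assert (Hmod : forall y, y * y = 1 / 2 -> Cmod (k, y) = 1).
  { intros y Hy. unfold Cmod; simpl. replace (k * (k * 1) + y * (y * 1)) with 1 by nra.
    apply sqrt_1. }
  exists (two_pole (k, k) (k, - k)), (two_pole_gamma (k, k) (k, - k)).
  split; [apply two_pole_class_S; apply Hmod; nra|].
  split; [apply two_pole_log_coeffs; apply Hmod; nra|].
  assert (E1 : two_pole_gamma (k, k) (k, - k) 1 = RtoC k).
  { unfold two_pole_gamma, RtoC, Cplus, Cmult; simpl.
    apply injective_projections; simpl; field. }
  assert (E2 : two_pole_gamma (k, k) (k, - k) 2 = RtoC 0).
  { unfold two_pole_gamma, RtoC, Cplus, Cmult; simpl.
    apply injective_projections; simpl; field. }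
  rewrite E1, E2, Cmod_0, Cmod_R, Rabs_pos_eq; lra.
- exists (two_pole (RtoC 1) (RtoC (-1))), (two_pole_gamma (RtoC 1) (RtoC (-1))).
  assert (H1 : Cmod (RtoC (-1)) = 1) by (rewrite Cmod_R, Rabs_left; lra).
  split; [apply two_pole_class_S; auto; apply Cmod_1|].
  split; [apply two_pole_log_coeffs; auto; apply Cmod_1|].
  assert (E1 : two_pole_gamma (RtoC 1) (RtoC (-1)) 1 = RtoC 0).
  { unfold two_pole_gamma, RtoC, Cplus, Cmult; simpl.
    apply injective_projections; simpl; field. }
  assert (E2 : two_pole_gamma (RtoC 1) (RtoC (-1)) 2 = RtoC (1 / 2)).
  { unfold two_pole_gamma, RtoC, Cplus, Cmult; simpl.
    apply injective_projections; simpl; field. }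
  rewrite E1, E2, Cmod_0, Cmod_R, Rabs_pos_eq; lra.
Qed.
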